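(* Let $p\ge 3$, $n\ge 3$, $\beta_\star=\dfrac{2(p+n)}{(n+2)^2}$, and suppose $\phi\in\varPhi_A$. (1) [quasi-admissibility] If there exist $w_*>1$ and $b<1$ such that $$\phi(w)\ \ge\ \frac{p-2}{n+2}-b\,\frac{\beta_\star}{\log w}\qquad\text{for all } w\ge w_*,$$ then $\delta_\phi$ is quasi-admissible. (2) [quasi-inadmissibility] If there exist $w_*>1$ and $b>1$ such that $$\phi(w)\ \le\ \frac{p-2}{n+2}-b\,\frac{\beta_\star}{\log w}\qquad\text{for all } w\ge w_*,$$ then $\delta_\phi$ is quasi-inadmissible (and hence inadmissible).
   Context: Model: $X\sim N_p(\theta,\sigma^2 I_p)$ and $S\sim\sigma^2\chi^2_n$ are independent, $\theta\in\mathbb{R}^p$ and $\sigma^2>0$ both unknown, $p\ge 3$, $n\ge 3$. The mean $\theta$ is estimated under the loss $\|d-\theta\|^2/\sigma^2$; risk is expected loss. Let $W=\|X\|^2/S$ and, for $\phi:[0,\infty)\to\mathbb{R}$, $\delta_\phi(X,S)=(1-\phi(W)/W)X$. An estimator is inadmissible if some other estimator has risk no larger for all $(\theta,\sigma^2)$ and strictly smaller for some $(\theta,\sigma^2)$. Constants: $c_{p,n}=(p-2)/(n+2)$, $d_n=4/(n+2)$. Put $$D_\phi(w)=\frac{\{\phi(w)-2c_{p,n}\}\phi(w)}{w}-d_n\phi'(w)\{1+\phi(w)\}.$$ $\varPhi$ is the class of functions $\phi:[0,\infty)\to\mathbb{R}$ that are absolutely continuous (on compact subintervals of $[0,\infty)$)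 and for which each term of $E[D_\phi(W)]$ is finite, i.e. $\phi(W)^2/W$, $\phi(W)/W$, $\phi'(W)$ and $\phi(W)\phi'(W)$ have finite expectation, for every $(\theta,\sigma^2)$. $\varPhi_A$ is the class of $\phi\in\varPhi$ satisfying: (A1) $\phi(0)=0$ and $\phi(w)\ge 0$ for all $w\ge 0$; (A2) $\phi$ has at most finitely many local extrema (i.e. $\phi$ does not oscillate excessively; in particular $\lim_{w\to\infty}\phi(w)$ exists in $[0,\infty]$); (A3) $\phi'$ has only finitely many discontinuities and is continuous from the right at $0$; (A4) $\liminf_{w\to\infty}w\phi'(w)/\phi(w)\ge 0$ and $\limsup_{w\to\infty}w\phi'(w)/\phi(w)\le 1$. For $\phi,g\in\varPhi$ let $$\Delta(w;\phi,g)=D_\phi(w)-D_{\phi+g}(w)=g(w)\Big\{2\frac{c_{p,n}-\phi(w)}{w}+d_n\phi'(w)-\frac{g(w)}{w}+d_ng'(w)\Big\}+d_ng'(w)\{1+\phi(w)\}.$$ Inequalities involving derivatives are understood at points $w$ where the expressions are defined (almost every $w\geq 0$). $\delta_\phi$ is quasi-admissible if every $g\in\varPhi$ with $\Delta(w;\phi,g)\ge 0$ for all $w$ satisfies $g\equiv 0$. $\delta_\phi$ is quasi-inadmissible if there exists $g\in\varPhi$, non-vanishing on some open interval, with $\Delta(w;\phi,g)\ge 0$ for all $w$. *)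

(* Defs.v *)
From HB Require Import structures.
From mathcomp Require Import all_boot all_order all_algebra.
From mathcomp Require Import all_classical all_reals all_analysis.
From mathcomp Require Import measurable_realfun ring.
Set Implicit Arguments.
Unset Strict Implicit.
Unset Printing Implicit Defensive.
Import Order.TTheory GRing.Theory Num.Theory.
Import numFieldNormedType.Exports.
Local Open Scope classical_set_scope.
Local Open Scope ring_scope.

(* Functions [0, +oo[ -> R are represented by total functions R -> R, of which
   only the restriction to [0, +oo[ is ever used. *)

Section Laws.
Context {R : realType}.

(* normal_prob is a probability on measurableTypeR R, the type R with the Borel
   sigma-algebra under another measure_display than the default one of R. *)
Definition consp n (z : measurableTypeR R * n.-tuple R) : n.+1.-tuple R :=
  [tuple of z.1 :: z.2].

Lemma measurable_consp n : measurable_fun setT (@consp n).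
Proof. exact: measurable_cons. Qed.

HB.instance Definition _ n :=
  isMeasurableFun.Build _ _ _ _ (@consp n) (@measurable_consp n).

(* The product law mu 0 \x ... \x mu (n - 1) on R^n. *)
Fixpoint prod_law n (mu : nat -> probability (measurableTypeR R) R) :
    probability (n.-tuple R) R :=
  match n with
  | 0 => \d_([tuple] : 0.-tuple R)
  | n'.+1 =>
    distribution (mu 0%N \x prod_law n' (fun i => mu i.+1))%E (@consp n')
  end.

Definition sqnorm n (x : n.-tuple R) : R := \sum_(i < n) tnth x i ^+ 2.

Definition scaled_sqnorm n (s : R) (x : n.-tuple R) : R := s ^+ 2 * sqnorm x.

Lemma measurable_scaled_sqnorm n s : measurable_fun setT (@scaled_sqnorm n s).
Proof.
apply: measurable_funM => //; apply: measurable_sum => i.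
by apply: measurable_funX; exact: measurable_tnth.
Qed.

HB.instance Definition _ n s := isMeasurableFun.Build _ _ _ _
  (@scaled_sqnorm n s) (@measurable_scaled_sqnorm n s).

(* N_p(theta, s^2 I_p); s is the standard deviation. *)
Definition normal_vec_law p (theta : p.-tuple R) (s : R) :
    probability (p.-tuple R) R :=
  prod_law p (fun i => normal_prob (nth 0 theta i) s).

(* s^2 chi^2_n: the law of s^2 times the sum of the squares of n independent
   standard normal variables. *)
Definition scaled_chi2_law n (s : R) : probability R R :=
  distribution (prod_law n (fun=> normal_prob 0 1)) (@scaled_sqnorm n s).

(* The joint law of (X, S). *)
Definition model p n (theta : p.-tuple R) (s : R) :
    probability (p.-tuple R * R)%type R :=
  (normal_vec_law theta s \x scaled_chi2_law n s)%E.

(* S > 0 almost surely, so expectations are taken over this set, on which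
   W >= 0. *)
Definition sample_space p : set (p.-tuple R * R) := [set z | 0 < z.2].

End Laws.

Section Estimation.
Context {R : realType}.
Implicit Types (p n : nat) (phi g : R -> R) (w : R).

Definition Wstat p (z : p.-tuple R * R) : R := sqnorm z.1 / z.2.

Definition delta p phi (z : p.-tuple R * R) : p.-tuple R :=
  [tuple (1 - phi (Wstat z) / Wstat z) * tnth z.1 i | i < p].

Definition loss p (d theta : p.-tuple R) (s : R) : R :=
  (\sum_(i < p) (tnth d i - tnth theta i) ^+ 2) / s ^+ 2.

Definition risk p n (d : p.-tuple R * R -> p.-tuple R) (theta : p.-tuple R)
    (s : R) : \bar R :=
  (\int[model n theta s]_(z in @sample_space R p) (loss (d z) theta s)%:E)%E.

Definition inadmissible p n (d : p.-tuple R * R -> p.-tuple R) : Prop :=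
  exists d' : p.-tuple R * R -> p.-tuple R,
    [/\ measurable_fun (@sample_space R p) d',
        forall theta s, 0 < s -> (risk n d' theta s <= risk n d theta s)%E
      & exists theta s, 0 < s /\ (risk n d' theta s < risk n d theta s)%E].

Definition cst_c p n : R := (p%:R - 2) / (n%:R + 2).
Definition cst_d n : R := 4 / (n%:R + 2).
Definition beta_star p n : R := 2 * (p%:R + n%:R) / (n%:R + 2) ^+ 2.

Definition D p n phi w : R :=
  (phi w - 2 * cst_c p n) * phi w / w - cst_d n * derive1 phi w * (1 + phi w).

(* Absolute continuity on [a, b]. *)
Definition abs_continuous (a b : R) (f : R -> R) : Prop :=
  forall e, 0 < e -> exists2 k, 0 < k &
    forall m (u v : 'I_m -> R),
      (forall i, a <= u i /\ u i <= v i /\ v i <= b) ->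
      (forall i j, i != j -> v i <= u j \/ v j <= u i) ->
      \sum_(i < m) (v i - u i) < k ->
      \sum_(i < m) `|f (v i) - f (u i)| < e.

Definition finite_expectation p n (h : R -> R) : Prop :=
  forall (theta : p.-tuple R) s, 0 < s ->
    (model n theta s).-integrable (@sample_space R p)
      (fun z => (h (Wstat z))%:E).

Definition Phi p n phi : Prop :=
  (forall b, 0 <= b -> abs_continuous 0 b phi) /\
  [/\ finite_expectation p n (fun w => phi w ^+ 2 / w),
      finite_expectation p n (fun w => phi w / w),
      finite_expectation p n (derive1 phi)
    & finite_expectation p n (fun w => phi w * derive1 phi w)].

Definition local_max phi w : Prop :=
  \forall v \near w, 0 <= v -> phi v <= phi w.

Definition local_min phi w : Prop :=
  \forall v \near w, 0 <= v -> phi w <= phi v.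

Definition same_plateau phi v w : Prop :=
  forall u, Num.min v w <= u <= Num.max v w -> phi u = phi w.

(* Extrema are not required to be strict, so every point of an interval of
   constancy is one; such an interval counts as a single extremum. Without this
   convention no eventually constant phi (positive-part James-Stein) would have
   finitely many extrema. *)
Definition finitely_many_local_extrema phi : Prop :=
  exists2 F : set R, finite_set F &
    forall w, 0 <= w -> local_max phi w \/ local_min phi w ->
      exists v, [/\ F v, 0 <= v & same_plateau phi v w].

(* A point where phi is not differentiable is a discontinuity of phi'. *)
Definition derivative_discontinuity phi w : Prop :=
  ~ (derivable phi w 1 /\ {for w, continuous (derive1 phi)}).

(* The one-sided derivative phi'(0) exists and is the limit of phi' at 0+. *)
Definition derivative_right_continuous0 phi : Prop :=
  exists2 l : R, (phi h - phi 0) / h @[h --> 0^'+] --> l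
    & derive1 phi w @[w --> 0^'+] --> l.

Definition PhiA p n phi : Prop :=
  [/\ Phi p n phi,
      phi 0 = 0 /\ (forall w, 0 <= w -> 0 <= phi w),
      finitely_many_local_extrema phi,
      finite_set [set w | 0 < w /\ derivative_discontinuity phi w] /\
      derivative_right_continuous0 phi
    & (0 <= limf_einf (fun w => (w * derive1 phi w / phi w)%:E) +oo%R)%E /\
      (limf_esup (fun w => (w * derive1 phi w / phi w)%:E) +oo%R <= 1)%E].

Definition Delta p n phi g w : R := D p n phi w - D p n (phi \+ g) w.

Lemma DeltaE p n phi g w : w != 0 -> derivable phi w 1 -> derivable g w 1 ->
  Delta p n phi g w =
  g w * (2 * (cst_c p n - phi w) / w + cst_d n * derive1 phi w
         - g w / w + cst_d n * derive1 g w) + cst_d n * derive1 g w * (1 + phi w).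
Proof.
move=> w0 dphi dg; rewrite /Delta /D !derive1E deriveD//=.
by field.
Qed.

Definition Delta_ge0 p n phi g : Prop :=
  forall w, 0 < w -> derivable phi w 1 -> derivable g w 1 ->
    0 <= Delta p n phi g w.

Definition quasi_admissible p n phi : Prop :=
  forall g, Phi p n g -> Delta_ge0 p n phi g -> forall w, 0 <= w -> g w = 0.

Definition quasi_inadmissible p n phi : Prop :=
  exists g, [/\ Phi p n g,
    exists a b, [/\ 0 <= a, a < b & forall w, a < w < b -> g w != 0]
    & Delta_ge0 p n phi g].

End Estimation.

(* Main.v *)
(* Write c = (p - 2) / (n + 2), d = 4 / (n + 2), so that beta_star = d (1 + c) / 2.

   Quasi-admissibility. With the energy E = g (1 + phi) + g^2 / 2, the condition
   Delta >= 0 reads d w E' >= g (g + 2 (phi - c)) almost everywhere. Near 0, where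
   phi is small, this keeps g nonnegative. If g were positive somewhere, E would
   stay positive; the lower bound on phi with b < 1 first drives E above
   2 (1 + c)^2 (otherwise 1 / (E ln w) would decrease like - ln ln w), and from
   there on sqrt E grows at least like w^(1 / d). Then E >= C w^(n / 2 + 1), so
   (g + g^2 + phi^2) / W has infinite expectation, because P(S <= s) is of order
   s^(n / 2) near 0. Absolute continuity enters through the theorem that an
   absolutely continuous function is differentiable almost everywhere, and
   nondecreasing if its derivative is almost everywhere nonnegative: its total
   variation defines a Stieltjes measure dominated by Lebesgue measure, to which
   Radon-Nikodym and Lebesgue differentiation apply.

   Quasi-inadmissibility. Conditions (A2)-(A4) give
   2 b beta_star / ln w <= 2 (c - phi) + d w phi' for large w; then
   g = e ((1 - w0 / w)^+)^2 / ln w has Delta > 0 beyond w0 when e is small. By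
   Stein's identity for X and for the normal variables underlying S, the risk of
   delta_phi minus that of delta_(phi + g) equals (n + 2) E[Delta(W)] > 0. *)

From HB Require Import structures.
From mathcomp Require Import all_boot all_order all_algebra.
From mathcomp Require Import all_classical all_reals all_analysis.
From mathcomp Require Import measurable_realfun finmap ring lra.
Require Import Defs.
Set Implicit Arguments.
Unset Strict Implicit.
Unset Printing Implicit Defensive.
Import Order.TTheory GRing.Theory Num.Theory.
Import numFieldNormedType.Exports.
Local Open Scope classical_set_scope.
Local Open Scope ring_scope.

(** * Absolutely continuous functions *)

Section AbsoluteContinuity.
Context {R : realType}.
Implicit Types (a b e x y : R) (f g : R -> R) (s t : seq (R * R)).

(** Why E: [phi'] and [g'] enter [Delta] only through [g phi' + g g' + g' (1 + phi)], which is E',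
    so a single function is followed instead of a pair. Why b = 1 is critical: for small [g], E is
    about (1 + c) g. If c - phi = b beta_star / ln w, equality in d w E' >= g (g + 2 (phi - c))
    becomes, with t = ln w, v = 1 / E and k = 1 / (1 + c)^2, the linear equation v' = b v / t - k /
    d; the value beta_star = d (1 + c) / 2 is the one that makes the coefficient of v / t equal to
    b. Its solutions are t^b times (a constant minus k / d times the integral of t^(-b)). For b < 1
    the integral diverges, v is driven to 0 and E cannot stay small. For b > 1 there is the global
    solution v = k t / (d (b - 1)), that is E of order 1 / ln w, whence the shape of the
    perturbation. Obstacle: the inequality holds only almost everywhere, so each comparison with an
    ODE is phrased as monotonicity of an absolutely continuous function built from w and E. *)

Definition clamp a b x := Num.max a (Num.min x b).

Definition apart (I J : R * R) := (I.2 <= J.1) || (J.2 <= I.1).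

Definition nonoverlapping s := all (fun I => I.1 <= I.2) s && pairwise apart s.

Definition total_length s := \sum_(I <- s) (I.2 - I.1).

Definition increments f s := \sum_(I <- s) `|f I.2 - f I.1|.

(** Composition with [clamp] extends a function constantly outside an interval, so no end points
    need be carried along. Lists of intervals are easy to refine, and the weak bound [<= e] survives
    suprema over partitions. *)
Definition globally_ac f := forall e, 0 < e -> exists2 k, 0 < k &
  forall s, nonoverlapping s -> total_length s < k -> increments f s <= e.

Lemma apart_sym : symmetric apart.
Proof. by move=> I J; rewrite /apart orbC. Qed.

Lemma clamp_itv a b x : a <= b -> a <= clamp a b x <= b.
Proof.
by move=> ab; rewrite /clamp le_max lexx/= ge_max ab/= ge_min lexx orbT.
Qed.

Lemma clampE a b x : a <= x <= b -> clamp a b x = x.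
Proof. by move=> /andP[ax xb]; rewrite /clamp min_l// max_r. Qed.

Lemma le_clamp a b : {homo clamp a b : x y / x <= y}.
Proof.
move=> x y xy; rewrite /clamp ge_max le_max lexx/= le_max.
by apply/orP; right; rewrite le_min !ge_min xy/= lexx orbT.
Qed.

Lemma clamp_lip a b x y : a <= b -> x <= y -> clamp a b y - clamp a b x <= y - x.
Proof.
move=> ab xy; rewrite /clamp.
by case: (leP x b) => ?; case: (leP y b) => ?; case: (leP a x) => ?;
  case: (leP a y) => ?; case: (leP a b) => ?; lra.
Qed.

Lemma abs_continuous_globally_ac a b f : a <= b -> abs_continuous a b f ->
  globally_ac (f \o clamp a b).
Proof.
move=> ab acf e e0; have [k k0 h] := acf e e0; exists k => // s /andP[les aps] ls.
pose c (I : R * R) := (clamp a b I.1, clamp a b I.2).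
pose u (i : 'I_(size s)) := (c (nth (0, 0) s i)).1.
pose v (i : 'I_(size s)) := (c (nth (0, 0) s i)).2.
have := h _ u v; rewrite /u /v /c/= => {}h.
rewrite /increments (big_nth (0, 0)) big_mkord /=; apply/ltW/h.
- move=> i; have /andP[-> _] := clamp_itv (nth (0, 0) s i).1 ab.
  have /andP[_ ->] := clamp_itv (nth (0, 0) s i).2 ab.
  by split => //; split => //; apply: le_clamp; exact: (all_nthP _ les).
- move=> i j ij; have : apart (nth (0, 0) s i) (nth (0, 0) s j).
    move: ij; rewrite neq_lt => /orP[] ij.
      by apply: (pairwiseP _ aps) => //; rewrite inE.
    by rewrite apart_sym; apply: (pairwiseP _ aps) => //; rewrite inE.
  by move=> /orP[] /(le_clamp a b); [left|right].
- apply: le_lt_trans ls; rewrite /total_length (big_nth (0, 0)) big_mkord.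
  by apply: ler_sum => i _; apply: clamp_lip => //; exact: (all_nthP _ les).
Qed.

Lemma globally_acD f g : globally_ac f -> globally_ac g -> globally_ac (f \+ g).
Proof.
move=> acf acg e e0; have e20 : 0 < e / 2 by lra.
have [k k0 hk] := acf _ e20; have [l l0 hl] := acg _ e20.
exists (Num.min k l); first by rewrite lt_min k0.
move=> s sN; rewrite lt_min => /andP[/(hk _ sN) fs /(hl _ sN) gs].
rewrite [leRHS](splitr e); apply: le_trans (lerD fs gs).
rewrite /increments -big_split/=; apply: ler_sum => I _.
by rewrite opprD addrACA ler_normD.
Qed.

Lemma globally_acN f : globally_ac f -> globally_ac (\- f).
Proof.
move=> acf e /acf[k k0 hk]; exists k => // s sN /(hk _ sN) le_e.
apply: le_trans le_e; apply: ler_sum => I _.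
by rewrite -opprD normrN.
Qed.

Lemma globally_ac_continuous f : globally_ac f -> continuous f.
Proof.
move=> acf x; apply/cvgrPdist_le => e /acf[k k0 hk].
near=> y; have xyk : `|x - y| < k by near: y; apply: cvgr_dist_lt.
have h a b : a <= b -> b - a < k -> `|f b - f a| <= e.
  move=> ab bak; have := hk [:: (a, b)].
  by rewrite /nonoverlapping /total_length /increments !big_seq1/= ab; apply.
have [xy|yx] := leP x y; last first.
  by apply: h; [exact: ltW|rewrite (le_lt_trans (ler_norm _) xyk)].
by rewrite distrC; apply: h => //; rewrite (le_lt_trans (ler_norm _))// distrC.
Unshelve. all: by end_near. Qed.

Definition cells a (l : seq R) : seq (R * R) := zip (a :: l) l.

Lemma increments_cells a b f l : itv_partition a b l ->
  increments f (cells a l) = variation a b f l.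
Proof.
move=> /variation_zip ->; rewrite /increments /cells.
elim: l a => [|c l ih] a; first by rewrite !big_nil.
by rewrite /= !big_cons/= ih.
Qed.

Lemma cells_partition a b (l : seq R) : itv_partition a b l ->
  [/\ nonoverlapping (cells a l), total_length (cells a l) = b - a
    & all (fun I => (a <= I.1) && (I.2 <= b)) (cells a l)].
Proof.
rewrite /nonoverlapping /total_length.
elim: l a => [a /itv_partition_nil ->|c l ih a acl].
  by rewrite /= big_nil subrr.
have ac : a < c by case: acl => /= /andP[].
have cb := itv_partition_le (itv_partition_cons acl).
have [/andP[ihl ihp] iht iha] := ih _ (itv_partition_cons acl).
rewrite /= big_cons/= -/(cells c l) ihl ihp iht (ltW ac) lexx cb/=.
split; last 2 first.
- by rewrite addrC subrKA.
- by apply: sub_all iha => I /andP[cI ->]; rewrite (le_trans (ltW ac) cI).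
rewrite andbT; apply: sub_all iha => I /andP[cI _]; rewrite /apart/= cI.
by [].
Qed.

Lemma total_lengthD s t : total_length (s ++ t) = total_length s + total_length t.
Proof. by rewrite /total_length big_cat. Qed.

Lemma incrementsD f s t : increments f (s ++ t) = increments f s + increments f t.
Proof. by rewrite /increments big_cat. Qed.

Lemma nonoverlapping_refine t I s (l : seq R) :
  itv_partition I.1 I.2 l -> nonoverlapping (t ++ I :: s) ->
  nonoverlapping (t ++ cells I.1 l ++ s).
Proof.
move=> /cells_partition[/andP[cl cp] _ ca].
have sub J K : apart J I -> K \in cells I.1 l -> apart J K.
  move=> JI /(allP ca) /andP[IK KI]; case/orP: JI => h; apply/orP.
    by left; rewrite (le_trans h).
  by right; rewrite (le_trans KI).
rewrite /nonoverlapping !all_cat/= !pairwise_cat/=.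
rewrite !allrel_catr !allrel_consr cl cp/=.
move=> /andP[/and3P[-> _ ->]] /and3P[] /andP[tI ->] -> /andP[Is ->].
rewrite !andbT/=; apply/andP; split; apply/allrelP => J K.
  by move=> /(allP tI) JI; exact: sub.
by move=> JI Ks; rewrite apart_sym; apply: sub JI; rewrite apart_sym (allP Is).
Qed.

Local Notation TV := total_variation.

(** Cutting an interval into cells changes neither the total length nor the absence of overlaps, so
    the same [k] and [e] serve for every refinement, and a supremum over partitions gives the
    variation. The intervals in [t] have already been cut; the induction moves those of [s] into [t]
    one at a time. *)
Lemma increments_total_variation f (k e : R) :
  (forall s, nonoverlapping s -> total_length s < k -> increments f s <= e) ->
  forall s t, nonoverlapping (t ++ s) -> total_length (t ++ s) < k ->
    ((increments f t)%:E + \sum_(I <- s) TV I.1 I.2 f <= e%:E)%E.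
Proof.
move=> hk; elim => [|I s ih] t tsN tsk.
  by rewrite big_nil adde0 lee_fin hk// -[t]cats0.
have I12 : I.1 <= I.2.
  by move: tsN => /andP[]; rewrite all_cat/= => /and3P[].
have s0 : (0 <= \sum_(I <- s) TV I.1 I.2 f)%E.
  rewrite big_seq sume_ge0// => J Js; apply: total_variation_ge0.
  move: tsN => /andP[]; rewrite all_cat/= => /and3P[_ _ /allP sle _].
  exact: sle.
have refine l : itv_partition I.1 I.2 l ->
    ((increments f t)%:E + (variation I.1 I.2 f l)%:E +
      \sum_(I <- s) TV I.1 I.2 f <= e%:E)%E.
  move=> Il; have [_ len _] := cells_partition Il.
  rewrite -(increments_cells f Il) -EFinD -incrementsD.
  apply: ih; rewrite -catA; first exact: nonoverlapping_refine.
  by move: tsk; rewrite !total_lengthD len /total_length big_cons.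
(* Finiteness comes before the supremum because the remaining sum must be subtracted from both sides
   in the extended reals. *)
have sfin : \sum_(I <- s) TV I.1 I.2 f \is a fin_num.
  rewrite ge0_fin_numE//.
  have [l Il] : exists l, itv_partition I.1 I.2 l.
    move: I12; rewrite le_eqVlt => /orP[/eqP ->|I12]; last first.
      by exists [:: I.2]; exact: itv_partition1.
    by exists [::]; split.
  have := refine _ Il; rewrite -EFinD addeC -leeBrDr// => /le_lt_trans; apply.
  by rewrite -EFinB ltry.
rewrite big_cons addeCA -leeBrDr; last by rewrite fin_numD sfin.
apply: ge_ereal_sup => _ [_ [l /refine le_e <-] <-].
by rewrite leeBrDr ?fin_numD ?sfin// addeCA addeA.
Qed.

Lemma total_variation_fin f a b : globally_ac f -> a <= b ->
  TV a b f \is a fin_num.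
Proof.
move=> /(_ _ ltr01)[k k0 hk] ab.
have small x y : x <= y -> y - x < k -> TV x y f \is a fin_num.
  move=> xy yxk; rewrite ge0_fin_numE ?total_variation_ge0//.
  have := @increments_total_variation f k 1 hk [:: (x, y)] [::].
  rewrite /nonoverlapping /total_length !big_seq1/= xy => /(_ isT yxk).
  by rewrite /increments big_nil add0e => /le_lt_trans; apply; exact: ltry.
(* Variation is at most 1 on intervals shorter than [k]; [[a, b]] is covered by finitely many steps
   of length [k / 2]. *)
suff steps m x : a <= x -> x - a <= m%:R * (k / 2) -> TV a x f \is a fin_num.
  apply: (steps (Num.truncn ((b - a) / (k / 2))).+1) => //.
  by rewrite -ler_pdivrMr; [exact/ltW/truncnS_gt|lra].
elim: m x => [|m ih] x ax.
  rewrite mul0r subr_le0 => xa; have -> : x = a by lra.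
  by rewrite total_variationxx.
rewrite -natr1 mulrDl mul1r => xam.
have [|] := leP a (x - k / 2) => h; last by apply: small => //; lra.
rewrite (@total_variationD _ a x (x - k / 2)) ?fin_numD; [|lra|lra].
by rewrite ih//; [apply: small; lra|lra].
Qed.

(** An increment of the variation function is the variation over that interval, so the bound on sums
    of variations with [t] empty is the claim. *)
Lemma globally_ac_total_variation f a b : globally_ac f -> a <= b ->
  globally_ac (fun x => fine (TV a (clamp a b x) f)).
Proof.
move=> acf ab e e0; have [k k0 hk] := acf e e0; exists k => // s sN sk.
have fin x : TV a (clamp a b x) f \is a fin_num.
  by apply: total_variation_fin => //; have /andP[] := clamp_itv x ab.
pose c (I : R * R) := (clamp a b I.1, clamp a b I.2).
have /andP[sle sap] := sN.
have csN : nonoverlapping (map c s).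
  rewrite /nonoverlapping all_map pairwise_map; apply/andP; split.
    by apply: sub_all sle => I /= I12; exact: le_clamp.
  by apply: sub_pairwise sap => I J /orP[] /(le_clamp a b) h; apply/orP; [left|right].
have := @increments_total_variation f k e hk (map c s) [::] csN.
rewrite /total_length big_map/= /increments big_nil add0e.
have len : \sum_(I <- s) (clamp a b I.2 - clamp a b I.1) < k.
  apply: le_lt_trans sk; rewrite /total_length big_seq [leRHS]big_seq.
  by apply: ler_sum => I /(allP sle) I12; exact: clamp_lip.
move=> /(_ len); rewrite -lee_fin; apply: le_trans.
rewrite big_map -sumEFin big_seq [leRHS]big_seq; apply: lee_sum => I Is /=.
have cI : clamp a b I.1 <= clamp a b I.2 by apply/le_clamp/(allP sle).
have /andP[aI _] := clamp_itv I.1 ab.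
have E := total_variationD f aI cI.
rewrite E fineD//; last by apply: total_variation_fin.
rewrite addrAC subrr add0r ger0_norm ?fine_ge0 ?total_variation_ge0//.
by rewrite fineK//; exact: total_variation_fin.
Qed.

End AbsoluteContinuity.

(** * The Stieltjes measure of an absolutely continuous nondecreasing function *)

Section StieltjesDensity.
Context {R : realType}.

Lemma ereal_cvg_le (u : (\bar R)^nat) (l c : \bar R) :
  u n @[n --> \oo] --> l -> (forall n, (u n <= c)%E) -> (l <= c)%E.
Proof.
move=> ul uc; rewrite -(cvg_lim (@ereal_hausdorff R) ul).
by apply: lime_le; [apply/cvg_ex; exists l|exact: nearW].
Qed.

Local Notation mu := (@lebesgue_measure R).

Section density.
Variable F : R -> R.
Hypotheses (ndF : {homo F : x y / x <= y}) (acF : globally_ac F).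

Lemma cumulative_of_ac : right_continuous F.
Proof. exact/right_continuousW/globally_ac_continuous. Qed.

HB.instance Definition _ := isCumulative.Build R _ R F ndF cumulative_of_ac.

Let muF := lebesgue_stieltjes_measure (F : cumulative R R).

Lemma stieltjes_itv (a b : R) : a <= b -> muF `]a, b] = (F b - F a)%:E.
Proof.
move=> ab; rewrite /muF /lebesgue_stieltjes_measure /measure_extension.
rewrite measurable_mu_extE/=; last exact: is_ocitv.
by rewrite wlength_itv_bnd.
Qed.

(** The [A i] may overlap, so their union is cut again into finitely many disjoint half-open
    intervals. On that one decomposition the total length is the Lebesgue measure and the sum of
    increments of [F] is the Stieltjes measure, which turns absolute continuity into the claim. *)
Lemma stieltjes_fin_bigcup_le (k e : R) (A : nat -> set R) n :
  (forall s, nonoverlapping s -> total_length s < k -> increments F s <= e) ->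
  (forall i, ocitv (A i)) ->
  (mu (\big[setU/set0]_(i < n) A i) < k%:E)%E ->
  (muF (\big[setU/set0]_(i < n) A i) <= e%:E)%E.
Proof.
move=> hk ocA; set U := \big[setU/set0]_(i < n) A i => Uk.
have mU : measurable (U : set (SetRing.type (ocitv_type R))).
  by apply: bigsetU_measurable => i _; apply: sub_gen_smallest; exact: ocA.
have [B [finB neB trB mB UE]] := SetRing.ring_finite_set mU.
pose Bs : seq (set R) := fset_set B.
pose ends (X : set R) := xget (0, 0) [set I : R * R | I.1 < I.2 /\ X = `]I.1, I.2]%classic].
have endsP X : B X -> (ends X).1 < (ends X).2 /\ X = `](ends X).1, (ends X).2]%classic.
  move=> BX; rewrite /ends; case: xgetP => [I _ []//|].
  have /ocitvP[X0|[I I12 XI]] := mB X (mem_set BX).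
    by have := neB _ BX; rewrite X0 => -[].
  by move=> /(_ I) /=; case.
have mB' X : B X -> measurable (X : set (measurableTypeR R)).
  by move=> /endsP[_ ->]; exact: measurable_itv.
have sumB (nu : {measure set (measurableTypeR R) -> \bar R}) :
    nu U = (\sum_(X <- Bs) nu X)%E.
  have := @measure_fin_bigcup _ _ _ nu _ B id finB trB mB'.
  rewrite -UE => ->. by rewrite fsbig_finite.
pose s := [seq ends X | X <- Bs].
have inB X : X \in Bs -> B X.
  by rewrite /Bs -[X \in _]/(X \in fset_set B) in_fset_set//; exact: set_mem.
have sN : nonoverlapping s.
  rewrite /nonoverlapping all_map pairwise_map; apply/andP; split.
    by apply/allP => X /inB /endsP[/ltW].
  have := fset_uniq (fset_set B); rewrite uniq_pairwise.
  apply: (@sub_in_pairwise _ (mem Bs)); last exact/allP.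
  move=> X Y /inB BX /inB BY /= XY.
  have [X12 XE] := endsP _ BX; have [Y12 YE] := endsP _ BY.
  have := trB X Y BX BY; rewrite /apart; case: leP => //= h1; case: leP => //= h2.
  move=> XYI; case/eqP: XY; apply: XYI.
  (* If neither interval ended before the other began, the smaller right end point would belong to
     both. *)
  exists (Num.min (ends X).2 (ends Y).2).
  move: (ends X) (ends Y) XE YE X12 Y12 h1 h2 => I J -> -> I12 J12 h1 h2.
  by split; rewrite /= in_itv/= lt_min ge_min lexx ?orbT ?I12 ?J12 ?h1 ?h2.
have lenE : (total_length s)%:E = mu U.
  rewrite sumB /total_length big_map -sumEFin big_seq [RHS]big_seq.
  apply: eq_bigr => X /inB /endsP[].
  move: (ends X) => I I12 ->.
  by have := lebesgue_measure_itv `]I.1, I.2]; rewrite /= lte_fin I12 => ->.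
have incE : (increments F s)%:E = muF U.
  have -> : muF U = _ := sumB (lebesgue_stieltjes_measure (F : cumulative R R)).
  rewrite /increments big_map -sumEFin big_seq [RHS]big_seq.
  apply: eq_bigr => X /inB /endsP[].
  move: (ends X) => I /ltW I12 ->; have muI := stieltjes_itv I12.
  rewrite ger0_norm ?subr_ge0; last exact: ndF.
  exact/esym/muI.
by rewrite -incE lee_fin; apply: hk => //; rewrite -lte_fin lenE.
Qed.

(** A Lebesgue-null set has a countable cover by half-open intervals of total length below [k].
    Finite subunions have Stieltjes measure at most [e], and continuity from below extends this to
    the whole cover. *)
Lemma stieltjes_null_dominates : muF `<< mu.
Proof.
apply/null_content_dominatesP => A mA muA0; apply/eqP; rewrite eq_le measure_ge0.
rewrite andbT; apply/lee_addgt0Pr => e e0; rewrite add0e.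
have [k k0 hk] := acF e0.
have [C [/= mC AC] Ck] : exists2 C : (set R)^nat,
    @measurable_cover _ (ocitv_type R) A C &
    (\sum_(i <oo) wlength idfun (C i) < k%:E)%E.
  have : (mu A < k%:E)%E by rewrite muA0 lte_fin.
  rewrite [mu A]/(mu_ext _ _) => /ereal_inf_lt[_ [C CA <-] Ck].
  by exists C.
have mC' i : measurable (C i : set (measurableTypeR R)).
  by have [I _ <-] := mC i; exact: measurable_itv.
have muC i : mu (C i) = wlength idfun (C i).
  rewrite /lebesgue_measure /lebesgue_stieltjes_measure /measure_extension.
  by rewrite measurable_mu_extE.
have fin_le n : (muF (\big[setU/set0]_(i < n) C i) <= e%:E)%E.
  apply: (stieltjes_fin_bigcup_le hk) => //.
  apply: le_lt_trans Ck; apply: le_trans (_ : (\sum_(i < n) mu (C i) <= _)%E).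
    by apply: content_subadditive => //; exact: bigsetU_measurable.
  under eq_bigr do rewrite muC.
  rewrite -(big_mkord xpredT (wlength idfun \o C)).
  by apply: nneseries_lim_ge => i _ _; exact: wlength_ge0.
pose U n : set (measurableTypeR R) := \big[setU/set0]_(i < n) C i.
have mU n : measurable (U n) by exact: bigsetU_measurable.
have ndU : {homo U : m n / (m <= n)%N >-> (m <= n)%O}.
  by move=> m n mn; apply/subsetPset; exact: subset_bigsetU.
have muU := nondecreasing_cvg_mu
  (mu := lebesgue_stieltjes_measure (F : cumulative R R)) mU
  (bigcupT_measurable U mU) ndU.
apply: le_trans (_ : muF (\bigcup_n U n) <= _)%E.
  apply: le_measure; [exact: mem_set| |].
    by apply: mem_set; exact: bigcupT_measurable.
  apply: subset_trans AC _ => x [i _ Cix]; exists i.+1 => //.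
  by rewrite /U big_ord_recr; right.
apply: (ereal_cvg_le muU); exact: fin_le.
Qed.

(** Radon-Nikodym is applied to the restriction to []a, b]], which is a finite measure; the
    restriction disappears on the subintervals []a, x]]. *)
Lemma ac_nondecreasing_density (a b : R) : a <= b ->
  exists2 h : R -> R, mu.-integrable setT (EFin \o h) &
    forall x, a <= x <= b -> (F x - F a)%:E = (\int[mu]_(t in `]a, x]) (h t)%:E)%E.
Proof.
move=> ab.
have mab : measurable (`]a, b] : set (measurableTypeR R)) by exact: measurable_itv.
have finab : (muF `]a, b] < +oo)%E by rewrite stieltjes_itv// ltry.
have [|h [_ hfin hint hE]] := @radon_nikodym_sigma_finite _ _ _ mu (mfrestr mab finab).
  apply/null_content_dominatesP => A mA A0.
  have /null_content_dominatesP/(_ A mA A0) muFA0 := stieltjes_null_dominates.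
  apply/eqP; rewrite eq_le measure_ge0 andbT -muFA0.
  by apply: le_measure; [apply: mem_set; exact: measurableI|exact: mem_set|].
exists (fine \o h).
  by apply: eq_integrable hint => // x _ /=; rewrite fineK.
move=> x /andP[ax xb]; under eq_integral do rewrite fineK//.
rewrite -hE; last exact: measurable_itv.
rewrite -stieltjes_itv//; congr (muF _); apply/esym/setIidl.
by apply: subset_itvl; rewrite bnd_simp.
Qed.

End density.
End StieltjesDensity.

(** * Almost everywhere differentiability and monotonicity *)

Section AbsoluteContinuityFTC.
Context {R : realType}.
Implicit Types (f : R -> R) (a b x : R).
Local Notation mu := (@lebesgue_measure R).

(** With V the variation function, f = V - (V - f), and both terms are nondecreasing and absolutely
    continuous; the density is the difference of theirs. *)
Lemma abs_continuous_density f a b : a <= b -> abs_continuous a b f ->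
  exists2 h : R -> R, mu.-integrable setT (EFin \o h) &
    forall x, a <= x <= b -> (f x - f a)%:E = (\int[mu]_(t in `]a, x]) (h t)%:E)%E.
Proof.
move=> ab /(abs_continuous_globally_ac ab) acf.
pose fc := f \o clamp a b.
pose V x := fine (total_variation a (clamp a b x) fc).
have acV : globally_ac V by exact: globally_ac_total_variation.
have clampK x : clamp a b (clamp a b x) = clamp a b x.
  exact/clampE/clamp_itv.
have VB x y : x <= y -> V y - V x = fine (total_variation (clamp a b x) (clamp a b y) fc).
  move=> /(le_clamp a b) xy; have /andP[ax _] := clamp_itv x ab.
  rewrite /V (total_variationD _ ax xy) fineD ?total_variation_fin//.
  by rewrite addrAC subrr add0r.
have VW x y : x <= y -> `|fc y - fc x| <= V y - V x.
  move=> xy; rewrite VB//; have cxy := le_clamp a b xy.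
  rewrite -lee_fin fineK ?total_variation_fin//.
  by have := total_variation_ge fc cxy; rewrite /fc/= !clampK.
have [|hV ihV hVE] := @ac_nondecreasing_density R V _ acV a b ab.
  by move=> x y /VW xy; rewrite -subr_ge0 (le_trans _ xy).
have acW : globally_ac (V \- fc) by apply: globally_acD => //; exact: globally_acN.
have [|hW ihW hWE] := @ac_nondecreasing_density R (V \- fc) _ acW a b ab.
  move=> x y /VW xy; rewrite /= -subr_ge0.
  by have := ler_norm (fc y - fc x); lra.
exists (hV \- hW).
  by rewrite (_ : _ \o _ = (EFin \o hV) \- (EFin \o hW))%E//; exact: integrableB.
move=> x axb; under eq_integral do rewrite /= EFinB.
rewrite integralB//; last 2 first.
  - exact: integrableS ihV.
  - exact: integrableS ihW.
rewrite -hVE// -hWE// -EFinB /=; congr EFin.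
rewrite /fc/= clampE// (@clampE _ _ _ a) ?lexx//.
by rewrite -[RHS]/(_ - _); ring.
Qed.

Lemma abs_continuous_ae_derivable f a b : a <= b -> abs_continuous a b f ->
  exists h : R -> R, [/\ mu.-integrable setT (EFin \o h),
    forall x, a <= x <= b -> (f x - f a)%:E = (\int[mu]_(t in `]a, x]) (h t)%:E)%E &
    {ae mu, forall x, a < x < b -> derivable f x 1 /\ derive1 f x = h x}].
Proof.
move=> ab /(abs_continuous_density ab)[h ih hE]; exists h; split => //.
have lh : locally_integrable setT h.
  by apply: open_integrable_locally => //; exact: openT.
have iy y : mu.-integrable `]a, y] (EFin \o h) by exact: integrableS ih.
have := @FTC1 R h (BRight a) iy lh.
apply: (@filterS _ _ (ae_filter_ringOfSetsType mu)) => x + /andP[ax xb]; rewrite lte_fin => /(_ ax)[dF F'].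
have fE : {near x, (fun y => f a + \int[mu]_(t in `]a, y]) h t) =1 f}.
  near=> y; have axb : a <= y <= b.
    by apply/andP; split; near: y; [exact: lt_le_nbhsr|exact: lt_le_nbhsl].
  by rewrite /Rintegral -hE//= addrC subrK.
have d2 : is_derive x 1 (fun y => f a + \int[mu]_(t in `]a, y]) h t) (h x).
  rewrite -F' derive1E; rewrite -[X in is_derive _ _ _ X]add0r.
  apply: is_deriveD; exact: DeriveDef.
have d3 := near_eq_is_derive fE d2.
by split; [exact: ex_derive|rewrite derive1E derive_val].
Unshelve. all: by end_near. Qed.

Lemma abs_continuous_nondecreasing f a b : a <= b -> abs_continuous a b f ->
  {ae mu, forall x, a < x < b -> derivable f x 1 -> 0 <= derive1 f x} -> f a <= f b.
Proof.
move=> ab acf f'_ge0; have [h [ih hE h'E]] := abs_continuous_ae_derivable ab acf.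
rewrite -subr_ge0 -lee_fin hE ?ab ?lexx//.
have h_ge0 : {ae mu, forall x, a < x < b -> 0 <= h x}.
  have := @filterI _ _ (ae_filter_ringOfSetsType mu) _ _ f'_ge0 h'E.
  by apply: (@filterS _ _ (ae_filter_ringOfSetsType mu)) => x [x1 x2] axb; have [/(x1 axb) + <-] := x2 axb.
have ih' : mu.-integrable `]a, b[ (EFin \o h) by exact: integrableS ih.
rewrite -(@integral_itv_bndo_bndc _ (BRight a) b); last exact: measurable_int ih'.
(* The density is nonnegative only almost everywhere, so it is replaced by its absolute value before
   the sign of the integral is read off. *)
rewrite (@ae_eq_integral _ _ _ mu `]a, b[ (fun x => `|(h x)%:E|%E))//.
- by apply: integral_ge0 => x _; exact: abse_ge0.
- exact: measurable_int ih'.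
- by apply: measurableT_comp => //; exact: measurable_int ih'.
- apply: (@filterS _ _ (ae_filter_ringOfSetsType mu)) h_ge0 => x h0; rewrite /= in_itv/= => axb.
  by rewrite ger0_norm// h0.
Qed.

End AbsoluteContinuityFTC.

(** * Operations preserving absolute continuity *)

Section AbsoluteContinuityClosure.
Context {R : realType}.
Implicit Types (f g F psi : R -> R) (a b c x y : R).
Local Notation mu := (@lebesgue_measure R).

Lemma derivable_is_derive f x : derivable f x 1 -> is_derive x 1 f (derive1 f x).
Proof. by move=> df; rewrite derive1E; exact: DeriveDef. Qed.

Lemma derivable_continuous f x : derivable f x 1 -> {for x, continuous f}.
Proof. by move=> df; apply/differentiable_continuous; rewrite -derivable1_diffP. Qed.

(** Common source of the closure under sums, products and composition with a Lipschitz function: in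
    each case the increments are controlled by those of two absolutely continuous functions. *)
Lemma abs_continuous_dominated f g F a b (L : R) :
  abs_continuous a b f -> abs_continuous a b g ->
  (forall x y, a <= x -> x <= y -> y <= b ->
    `|F y - F x| <= L * (`|f y - f x| + `|g y - g x|)) ->
  abs_continuous a b F.
Proof.
move=> acf acg FL e e0.
have L1 : 0 < `|L| + 1 by rewrite ltr_wpDl.
have e20 : 0 < e / 2 / (`|L| + 1) by rewrite !divr_gt0.
have [k k0 hk] := acf _ e20; have [l l0 hl] := acg _ e20.
exists (Num.min k l); first by rewrite lt_min k0.
move=> m u v uv uv2; rewrite lt_min => /andP[/(hk _ _ _ uv uv2) fs /(hl _ _ _ uv uv2) gs].
apply: (@le_lt_trans _ _ ((`|L| + 1) * (\sum_(i < m) `|f (v i) - f (u i)| +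
    \sum_(i < m) `|g (v i) - g (u i)|))).
  rewrite -big_split/= mulr_sumr; apply: ler_sum => i _.
  have [au [uvi vb]] := uv i; apply: le_trans (FL _ _ au uvi vb) _.
  by rewrite ler_wpM2r ?addr_ge0// (le_trans (ler_norm _))// lerDl.
rewrite -ltr_pdivlMl// mulrC [ltRHS](_ : _ = e / 2 / (`|L| + 1) + e / 2 / (`|L| + 1)).
  exact: ltrD.
by rewrite -mulrDl -splitr.
Qed.

Lemma abs_continuousS f a b a' b' : a <= a' -> b' <= b ->
  abs_continuous a b f -> abs_continuous a' b' f.
Proof.
move=> aa bb acf e /acf[k k0 hk]; exists k => // m u v uv; apply: hk => i.
by have [? [? ?]] := uv i; split; [lra|split => //; lra].
Qed.

Lemma abs_continuous_lipschitz F a b (L : R) :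
  (forall x y, a <= x -> x <= y -> y <= b -> `|F y - F x| <= L * (y - x)) ->
  abs_continuous a b F.
Proof.
move=> FL e e0; have L1 : 0 < `|L| + 1 by rewrite ltr_wpDl.
exists (e / (`|L| + 1)); first exact: divr_gt0.
move=> m u v uv uv2; rewrite ltr_pdivlMr//; apply: le_lt_trans.
rewrite mulr_suml; apply: ler_sum => i _.
have [au [uvi vb]] := uv i; apply: le_trans (FL _ _ au uvi vb) _.
by rewrite mulrC ler_wpM2l ?subr_ge0// (le_trans (ler_norm _))// lerDl.
Qed.

Lemma abs_continuous_bounded f a b : a <= b -> abs_continuous a b f ->
  exists M : R, forall x, a <= x <= b -> `|f x| <= M.
Proof.
move=> ab /(abs_continuous_globally_ac ab) /globally_ac_continuous cf.
have [|c _ fc] := @EVT_max R (fun x => `|(f \o clamp a b) x|) a b ab.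
  by apply: continuous_subspaceT => x; apply: cvg_norm; exact: cf.
exists `|(f \o clamp a b) c| => x axb.
by have := fc x; rewrite in_itv/= clampE// => /(_ axb).
Qed.

Lemma abs_continuousM f g a b : a <= b ->
  abs_continuous a b f -> abs_continuous a b g -> abs_continuous a b (f \* g).
Proof.
move=> ab acf acg.
have [M fM] := abs_continuous_bounded ab acf.
have [N gN] := abs_continuous_bounded ab acg.
apply: (@abs_continuous_dominated f g _ _ _ (`|M| + `|N|)) => // x y ax xy yb.
have -> : (f \* g) y - (f \* g) x = (f y - f x) * g y + f x * (g y - g x).
  by rewrite /=; ring.
have gy : `|g y| <= `|M| + `|N|.
  have : `|g y| <= N by apply: gN; rewrite yb andbT; lra.
  by have := normr_ge0 M; have := ler_norm N; lra.
have fx : `|f x| <= `|M| + `|N|.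
  have : `|f x| <= M by apply: fM; rewrite ax/=; lra.
  by have := normr_ge0 N; have := ler_norm M; lra.
rewrite (le_trans (ler_normD _ _))// !normrM mulrDr lerD//.
  by rewrite mulrC ler_wpM2r.
by rewrite ler_wpM2r.
Qed.

Lemma abs_continuousD f g a b :
  abs_continuous a b f -> abs_continuous a b g -> abs_continuous a b (f \+ g).
Proof.
move=> acf acg; apply: (@abs_continuous_dominated f g _ _ _ 1) => // x y ax xy yb.
by rewrite mul1r /= opprD addrACA ler_normD.
Qed.

Lemma abs_continuous_cst c a b : abs_continuous a b (fun=> c).
Proof. by apply: (@abs_continuous_lipschitz _ _ _ 0) => *; rewrite subrr normr0 mul0r. Qed.

Lemma is_derive_lipschitz psi (psi' : R -> R) a b (L : R) :
  (forall x, a <= x <= b -> is_derive x 1 psi (psi' x)) ->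
  (forall x, a <= x <= b -> `|psi' x| <= L) ->
  forall x y, a <= x -> x <= y -> y <= b -> `|psi y - psi x| <= L * (y - x).
Proof.
move=> dpsi psiL x y ax xy yb.
have [z||z zxy ->] := @MVT_segment _ psi psi' _ _ xy.
- rewrite in_itv/= => /andP[xz zy]; apply: dpsi.
  by apply/andP; split; lra.
- apply: derivable_within_continuous => z; rewrite in_itv/= => /andP[xz zy].
  by have [|//] := dpsi z; apply/andP; split; lra.
- rewrite normrM (ger0_norm (_ : 0 <= y - x)) ?subr_ge0// ler_wpM2r ?subr_ge0// psiL//.
  by move: zxy; rewrite in_itv/= => /andP[? ?]; apply/andP; split; lra.
Qed.

Lemma abs_continuous_comp f psi (psi' : R -> R) a b m M (L : R) :
  abs_continuous a b f -> (forall x, a <= x <= b -> m <= f x <= M) ->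
  (forall x, m <= x <= M -> is_derive x 1 psi (psi' x)) ->
  (forall x, m <= x <= M -> `|psi' x| <= L) ->
  abs_continuous a b (psi \o f).
Proof.
move=> acf fmM dpsi psiL.
have lip := is_derive_lipschitz dpsi psiL.
apply: (@abs_continuous_dominated f f _ _ _ `|L|) => // x y ax xy yb /=.
have /andP[mx xM] : m <= f x <= M by apply: fmM; rewrite ax/=; lra.
have /andP[my yM] : m <= f y <= M by apply: fmM; rewrite yb andbT; lra.
apply: (@le_trans _ _ (`|L| * `|f y - f x|)); last by rewrite ler_wpM2l// lerDl.
have L_le z : 0 <= z -> L * z <= `|L| * z by move=> z0; rewrite ler_wpM2r ?ler_norm.
have [fxy|/ltW fyx] := leP (f x) (f y).
  rewrite [X in _ <= _ * X]ger0_norm ?subr_ge0//; apply: le_trans (lip _ _ mx fxy yM) _.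
  by rewrite L_le ?subr_ge0.
rewrite distrC [X in _ <= _ * X]distrC [X in _ <= _ * X]ger0_norm ?subr_ge0//.
by apply: le_trans (lip _ _ my fyx xM) _; rewrite L_le ?subr_ge0.
Qed.

Lemma abs_continuous_dist f a b x e : a <= b -> abs_continuous a b f ->
  a <= x <= b -> 0 < e ->
  exists2 k, 0 < k & forall y, a <= y <= b -> `|y - x| < k -> `|f y - f x| < e.
Proof.
move=> ab /(abs_continuous_globally_ac ab) /globally_ac_continuous cf axb e0.
have /cvgrPdist_lt /(_ _ e0) /nbhs_ballP[k k0 xk] := cf x.
exists k => // y ayb yx; have := xk y; rewrite /ball/= !clampE// distrC => /(_ yx).
by rewrite distrC.
Qed.

End AbsoluteContinuityClosure.

(** * The differential inequality Delta >= 0 *)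

Section DifferentialInequality.
Context {R : realType} (phi g : R -> R) (c d : R).
Hypotheses (c_gt0 : 0 < c) (d_gt0 : 0 < d).
Hypothesis acphi : forall b, 0 <= b -> abs_continuous 0 b phi.
Hypothesis acg : forall b, 0 <= b -> abs_continuous 0 b g.
Hypotheses (phi0 : phi 0 = 0) (phi_ge0 : forall w : R, 0 <= w -> 0 <= phi w).
Hypothesis Delta_ge : forall w : R, 0 < w -> derivable phi w 1 -> derivable g w 1 ->
  0 <= g w * (2 * (c - phi w) / w + d * derive1 phi w - g w / w + d * derive1 g w)
       + d * derive1 g w * (1 + phi w).

Local Notation mu := (@lebesgue_measure R).

(* [Delta] is the derivative of [d * energy] plus terms without derivatives. *)
Definition energy (w : R) : R := g w * (1 + phi w) + g w ^+ 2 / 2.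

Lemma abs_continuous_energy (a b : R) : 0 <= a -> a <= b -> abs_continuous a b energy.
Proof.
move=> a0 ab; have b0 : 0 <= b by lra.
have acga : abs_continuous a b g by exact: abs_continuousS (acg b0).
have acpa : abs_continuous a b phi by exact: abs_continuousS (acphi b0).
have -> : energy = (g \* (cst 1 \+ phi)) \+ (cst 2^-1 \* (g \* g)).
  by apply/funext => w; rewrite /energy/= mulrC; field.
apply: abs_continuousD; apply: abs_continuousM => //.
- by apply: abs_continuousD => //; exact: abs_continuous_cst.
- exact: abs_continuous_cst.
- exact: abs_continuousM.
Qed.

Definition energy_slope_ge (w e' : R) := g w * (g w + 2 * (phi w - c)) <= d * w * e'.

Lemma is_derive_energy (w : R) : 0 < w -> derivable phi w 1 -> derivable g w 1 ->
  exists2 e' : R, is_derive w 1 energy e' & energy_slope_ge w e'.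
Proof.
move=> w0 dphi dg; have := Delta_ge w0 dphi dg.
have hphi := derivable_is_derive dphi; have hg := derivable_is_derive dg.
move: (derive1 phi w : R) (derive1 g w : R) hphi hg => phi' g' hphi hg D_ge0.
exists (g' * (1 + phi w + g w) + g w * phi').
  by rewrite /energy; apply: is_derive_eq; rewrite /GRing.scale/=; by field.
rewrite /energy_slope_ge -subr_ge0; move: (mulr_ge0 (ltW w0) D_ge0); congr (_ <= _).
by field; rewrite gt_eqF.
Qed.

(** The tool for all comparisons below. Almost every point is a point of differentiability of both
    [phi] and [g]; there [e'] is the derivative of the energy and the slope inequality is available,
    so only a pointwise computation of the derivative of [H] is left to each use. *)
Lemma nondecreasing_along_energy (H : R -> R) a b : 0 <= a -> a <= b ->
  abs_continuous a b H ->
  (forall w e' : R, a < w < b -> is_derive w 1 energy e' -> energy_slope_ge w e' ->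
     exists2 h' : R, is_derive w 1 H h' & 0 <= h') ->
  H a <= H b.
Proof.
move=> a0 ab acH dH; have b0 : 0 <= b by lra.
have [h1 [_ _ dphi]] := abs_continuous_ae_derivable b0 (acphi b0).
have [h2 [_ _ dg]] := abs_continuous_ae_derivable b0 (acg b0).
apply: abs_continuous_nondecreasing => //.
have := @filterI _ _ (ae_filter_ringOfSetsType mu) _ _ dphi dg.
apply: (@filterS _ _ (ae_filter_ringOfSetsType mu)) => w [dphiw dgw] awb _.
have wb : 0 < w < b by case/andP: awb => ? ?; apply/andP; split; lra.
have [dphiw1 _] := dphiw wb; have [dgw1 _] := dgw wb.
have /andP[w0 _] := wb.
have [e' he' ge'] := is_derive_energy w0 dphiw1 dgw1.
have [h' hh' h'0] := dH w e' awb he' ge'.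
by rewrite derive1E derive_val.
Qed.

Lemma is_derive_energy_expR (w e' K : R) : is_derive w 1 energy e' ->
  is_derive w 1 (fun x => energy x * expR (K * x)) ((e' + K * energy w) * expR (K * w)).
Proof.
by move=> he; apply: is_derive_eq; rewrite /GRing.scale/=; ring.
Qed.

Lemma abs_continuous_energy_expR (K a b : R) : 0 <= a -> a <= b ->
  abs_continuous a b (fun x => energy x * expR (K * x)).
Proof.
move=> a0 ab; apply: (abs_continuousM ab); first exact: abs_continuous_energy.
apply: (@abs_continuous_lipschitz _ _ _ _ (`|K| * expR (`|K| * b))).
apply: (@is_derive_lipschitz _ _ (fun x => K * expR (K * x))) => x /andP[ax xb].
  by apply: is_derive_eq; rewrite /GRing.scale/=; ring.
rewrite normrM (ger0_norm (expR_ge0 _)) ler_wpM2l// ler_expR.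
have x0 : 0 <= x by lra.
by apply: (le_trans (ler_norm _)); rewrite normrM (ger0_norm x0) ler_wpM2l.
Qed.


(** Otherwise let z be the last point of [[w1, w2]] with g >= 0. Just after z both [g] and E are
    negative, and the slope inequality gives d w E' >= 2 E - 2 (1 + c) g >= 2 E. Then E exp(- K x)
    is nondecreasing from a nonnegative value at z, so E cannot be negative. *)
Lemma g_neg_left (w1 w2 : R) : 0 < w1 -> w1 <= w2 -> g w2 < 0 -> g w1 < 0.
Proof.
have c0 := c_gt0; have d0 := d_gt0.
move=> w1_gt0 w12 gw2; rewrite ltNge; apply/negP => gw1.
have w2_ge0 : 0 <= w2 by lra.
pose S := [set x | w1 <= x <= w2 /\ 0 <= g x].
have S0 : S !=set0 by exists w1; rewrite /S/= lexx w12.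
have Sub : has_ubound S by exists w2 => x [/andP[]].
pose z := sup S.
have w1z : w1 <= z by apply: ub_le_sup => //; split => //; rewrite lexx.
have zw2 : z <= w2 by apply: ge_sup => // x [/andP[]].
have z0w2 : 0 <= z <= w2 by rewrite zw2 andbT; lra.
have gz : 0 <= g z.
  rewrite leNgt; apply/negP => gz.
  have [|k k0 hk] := abs_continuous_dist w2_ge0 (acg w2_ge0) z0w2 (_ : 0 < - g z).
    by rewrite oppr_gt0.
  have [x [/andP[w1x xw2] gx] zx] := sup_adherent k0 (conj S0 Sub).
  rewrite -/z in zx.
  have xz : x <= z by apply: ub_le_sup => //; split => //; rewrite w1x.
  have xz_k : `|x - z| < k by rewrite ler0_norm; lra.
  have x0w2 : 0 <= x <= w2 by rewrite xw2 andbT; lra.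
  by have := hk x x0w2 xz_k; rewrite ltr_norml => /andP[]; lra.
have zltw2 : z < w2.
  by rewrite lt_neqAle zw2 andbT; apply: contraTneq gz => ->; rewrite -ltNge.
have g_neg (x : R) : z < x <= w2 -> g x < 0.
  move=> /andP[zx xw2]; rewrite ltNge; apply/negP => gx.
  have : x <= z by apply: ub_le_sup => //; split => //; rewrite xw2 andbT; lra.
  by lra.
have [k k0 hk] := abs_continuous_dist w2_ge0 (acg w2_ge0) z0w2 (@ltr01 R).
pose y := Num.min w2 (z + k / 2).
have zy : z < y by rewrite lt_min zltw2/=; lra.
have [yw2 yk] : y <= w2 /\ y <= z + k / 2 by rewrite !ge_min !lexx orbT.
(* With g > -1 the factor 1 + phi + g / 2 is positive, so E has the sign of [g]. *)
have small (x : R) : z < x <= y -> -1 < g x < 0.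
  move=> /andP[zx xy]; rewrite g_neg ?andbT; last by rewrite zx; lra.
  have xz_k : `|x - z| < k by rewrite ger0_norm; lra.
  have x0w2 : 0 <= x <= w2 by apply/andP; split; lra.
  by have := hk x x0w2 xz_k; rewrite ltr_norml => /andP[]; lra.
have energy_neg (x : R) : z < x <= y -> energy x < 0.
  move=> zxy; have /andP[gx1 gx0] := small x zxy.
  have x0 : 0 <= x by case/andP: zxy => ? _; lra.
  rewrite /energy (_ : _ + _ = g x * (1 + phi x + g x / 2)); last by field.
  by rewrite nmulr_rlt0//; have := phi_ge0 x0; lra.
(* The rate 2 / (d w) is largest at the left end z; since E < 0, this worst constant rate
   suffices. *)
pose K := 2 / (d * z).
have z0 : 0 < z by lra.
have := @nondecreasing_along_energy (fun x => energy x * expR (- K * x)) z y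
  (ltW z0) (ltW zy) (abs_continuous_energy_expR _ (ltW z0) (ltW zy)).
have energy_z : 0 <= energy z.
  by rewrite addr_ge0 ?mulr_ge0 ?sqr_ge0 ?invr_ge0// addr_ge0// phi_ge0// ltW.
have energy_y := energy_neg y; rewrite zy lexx in energy_y.
suff dH (w e' : R) : z < w < y -> is_derive w 1 energy e' -> energy_slope_ge w e' ->
    exists2 h' : R, is_derive w 1 (fun x => energy x * expR (- K * x)) h' & 0 <= h'.
  move=> /(_ dH); apply/negP; rewrite -ltNge.
  apply: (@lt_le_trans _ _ 0); last by rewrite mulr_ge0 ?expR_ge0.
  by rewrite pmulr_llt0 ?expR_gt0// energy_y.
move=> /andP[zw wy] he slope; exists ((e' + - K * energy w) * expR (- K * w)).
  exact: is_derive_energy_expR.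
rewrite mulr_ge0 ?expR_ge0//.
have zwy : z < w <= y by rewrite zw ltW.
have /andP[_ gw] := small w zwy; have ew := energy_neg w zwy.
have w0 : 0 < w by lra.
have dw0 : 0 < d * w by rewrite mulr_gt0.
have e'_ge : 2 * energy w <= d * w * e'.
  apply: le_trans slope; rewrite -subr_ge0 /energy.
  rewrite [leRHS](_ : _ = - g w * (2 * (1 + c))); last by field.
  by rewrite mulr_ge0//; lra.
rewrite -(pmulr_rge0 _ dw0); apply: (@le_trans _ _ (2 * energy w * (1 - w / z))).
  have : w / z >= 1 by rewrite ler_pdivlMr// mul1r ltW.
  by move=> ?; rewrite mulr_le0//; lra.
rewrite -subr_ge0 (_ : _ - _ = d * w * e' - 2 * energy w) ?subr_ge0//.
by rewrite /K; field; rewrite !gt_eqF.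
Qed.

(** A negative value would propagate down to 0. Where phi <= c / 2 one has d w E' >= g^2 - c g > 0;
    once [g] is bounded away from 0 this makes E fall at least like a multiple of ln w as w tends to
    0. But E >= - (1 + phi)^2 / 2 by completing the square. *)
Lemma g_ge0 (w : R) : 0 < w -> 0 <= g w.
Proof.
have c0 := c_gt0; have d0 := d_gt0.
move=> w_gt0; rewrite leNgt; apply/negP => gw.
have c20 : 0 < c / 2 by lra.
have w00 : 0 <= (0 : R) <= w by rewrite lexx ltW.
have [k k0 hk] := abs_continuous_dist (ltW w_gt0) (acphi (ltW w_gt0)) w00 c20.
pose w2 := Num.min w (k / 2).
have w2_gt0 : 0 < w2 by rewrite lt_min w_gt0/=; lra.
have [w2w w2k] : w2 <= w /\ w2 <= k / 2 by rewrite !ge_min !lexx orbT.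
have g_neg (x : R) : 0 < x <= w2 -> g x < 0.
  by move=> /andP[x0 xw2]; apply: (g_neg_left x0 _ gw); lra.
have phi_small (x : R) : 0 < x <= w2 -> 0 <= phi x <= c / 2.
  move=> /andP[x0 xw2]; rewrite phi_ge0 ?(ltW x0)//=.
  have := hk x; rewrite subr0 phi0 subr0 (ger0_norm (ltW x0)).
  rewrite (ger0_norm (phi_ge0 (ltW x0))) (ltW x0) => h.
  by apply/ltW/h; lra.
have slope_ge (w' e' : R) : 0 < w' <= w2 -> energy_slope_ge w' e' ->
    g w' ^+ 2 - c * g w' <= d * w' * e'.
  move=> w'w2; apply: le_trans; rewrite /energy_slope_ge -subr_ge0.
  rewrite [leRHS](_ : _ = - g w' * (c - 2 * phi w')); last by ring.
  have /andP[_ ?] := phi_small _ w'w2; have ? := g_neg _ w'w2.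
  by rewrite mulr_ge0//; lra.
have nd (x y : R) : 0 < x -> x <= y -> y <= w2 -> energy x <= energy y.
  move=> x0 xy yw2; apply: nondecreasing_along_energy; rewrite ?(ltW x0)//.
    by apply: abs_continuous_energy => //; rewrite ltW.
  move=> w' e' /andP[xw' w'y] he /slope_ge h; exists e' => //.
  have w'0 : 0 < w' by lra.
  have w'w2 : 0 < w' <= w2 by rewrite w'0; lra.
  rewrite -(pmulr_rge0 _ (mulr_gt0 d_gt0 w'0)); apply: le_trans (h w'w2).
  have := g_neg _ w'w2 => ?.
  by rewrite addr_ge0 ?sqr_ge0// -mulrN mulr_ge0//; lra.
(* Two cases. If E < 0 at some [w3], monotonicity keeps E <= E(w3) to its left, and (1 + c) g <= E.
   If E >= 0 throughout, then g < 0 forces g <= -2 (1 + phi) <= -2. *)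
have [w3 [w3_gt0 w3w2 [eta eta0 g_eta]]] : exists w3 : R, [/\ 0 < w3, w3 <= w2 &
    exists2 eta : R, 0 < eta & forall x, 0 < x <= w3 -> g x <= - eta].
  have [[w3 [/andP[w30 w3w2] ew3]]|no_neg] :=
      pselect (exists w3, 0 < w3 <= w2 /\ energy w3 < 0).
    exists w3; split => //; exists (- energy w3 / (1 + c)).
      by rewrite divr_gt0//; lra.
    move=> x /andP[x0 xw3]; rewrite mulNr opprK.
    have xw2 : 0 < x <= w2 by rewrite x0; lra.
    have /andP[? ?] := phi_small x xw2; have gx := g_neg _ xw2.
    rewrite ler_pdivlMr; last lra.
    apply: le_trans (nd _ _ x0 xw3 w3w2).
    have : 0 <= - g x * (c - phi x) by rewrite mulr_ge0//; lra.
    by have := sqr_ge0 (g x); rewrite /energy; lra.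
  exists w2; split => //; exists 2 => // x xw2.
  have /andP[? ?] := phi_small x xw2; have gx := g_neg _ xw2.
  rewrite leNgt; apply/negP => gx2; apply: no_neg; exists x; split => //.
  rewrite /energy (_ : _ + _ = g x * (1 + phi x + g x / 2)); last by field.
  by rewrite nmulr_rlt0//; lra.
pose kap := eta * c / d.
have kap0 : 0 < kap by rewrite divr_gt0// mulr_gt0.
have ln_bound (x : R) : 0 < x -> x <= w3 -> energy x - kap * ln x <= energy w3 - kap * ln w3.
  move=> x0 xw3.
  apply: (@nondecreasing_along_energy (fun x => energy x - kap * ln x)); rewrite ?(ltW x0)//.
    apply: abs_continuousD; first by apply: abs_continuous_energy => //; rewrite ltW.
    apply: (@abs_continuous_lipschitz _ _ _ _ (kap / x)).
    apply: (@is_derive_lipschitz _ _ (fun y => - (kap / y))) => y /andP[xy yw3].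
      have hln := is_derive1_ln (lt_le_trans x0 xy).
      by apply: is_derive_eq; rewrite /GRing.scale/=; ring.
    have y0 : 0 < y by lra.
    by rewrite normrN ger0_norm ?(ltW (divr_gt0 kap0 y0))// ler_pM2l// lef_pV2.
  move=> w' e' /andP[xw' w'w3] he /slope_ge h.
  have w'0 : 0 < w' by lra.
  have w'w2 : 0 < w' <= w2 by rewrite w'0; lra.
  exists (e' - kap / w').
    have hln := is_derive1_ln w'0.
    by apply: is_derive_eq; rewrite /GRing.scale/=; ring.
  rewrite -(pmulr_rge0 _ (mulr_gt0 d_gt0 w'0)) mulrBr subr_ge0.
  apply: le_trans (h w'w2); rewrite /kap.
  rewrite [leLHS](_ : _ = c * eta); last by field; rewrite !gt_eqF.
  have ge : g w' <= - eta by apply: g_eta; rewrite w'0 ltW.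
  have : c * eta <= c * - g w' by rewrite ler_pM2l//; lra.
  by have := sqr_ge0 (g w'); lra.
(* Chosen so that at w3 exp(- T) the logarithmic bound puts E below - (1 + c)^2 / 2. *)
pose T := (`|energy w3| + (1 + c) ^+ 2 / 2 + 1) / kap.
have T0 : 0 <= T.
  by rewrite divr_ge0 ?(ltW kap0)// !addr_ge0// ?divr_ge0// sqr_ge0.
have x0 : 0 < w3 * expR (- T) by rewrite mulr_gt0 ?expR_gt0.
have xw3 : w3 * expR (- T) <= w3.
  by rewrite ler_piMr ?(ltW w3_gt0)// -[leRHS]expR0 ler_expR; lra.
have := ln_bound _ x0 xw3; rewrite lnM ?posrE ?expR_gt0// expRK.
set x := w3 * _ in x0 xw3 *.
have kT : kap * T = `|energy w3| + (1 + c) ^+ 2 / 2 + 1.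
  by rewrite /T mulrC divfK// gt_eqF.
have xw2 : 0 < x <= w2 by rewrite x0; lra.
have /andP[? ?] := phi_small x xw2.
have ex : - ((1 + c) ^+ 2 / 2) <= energy x.
  have : 0 <= ((1 + c) + (1 + phi x)) * (c - phi x) by rewrite mulr_ge0//; lra.
  by have := sqr_ge0 (g x + (1 + phi x)); rewrite /energy; lra.
by have := ler_norm (energy w3); rewrite mulrDr mulrN kT; lra.
Qed.

Lemma energy_ge (w : R) : 0 < w -> g w <= energy w.
Proof.
move=> w0; have ge0 := g_ge0 w0; have p0 := phi_ge0 (ltW w0).
have : 0 <= g w * phi w by rewrite mulr_ge0.
by have := sqr_ge0 (g w); rewrite /energy; lra.
Qed.

(** Since 0 <= g <= E, the slope inequality gives d w E' >= - 2 c E, and 2 c / (d w) is at most its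
    value at [w1]. Hence positivity of E propagates to the right. *)
Lemma energy_lower (w1 w2 : R) : 0 < w1 -> w1 <= w2 ->
  energy w1 * expR (2 * c / (d * w1) * (w1 - w2)) <= energy w2.
Proof.
have c0 := c_gt0; have d0 := d_gt0.
move=> w1_gt0 w12; set K := _ / _.
have K0 : 0 < K by rewrite divr_gt0 ?mulr_gt0.
suff : energy w1 * expR (K * w1) <= energy w2 * expR (K * w2).
  rewrite -ler_pdivrMr ?expR_gt0// -expRN -mulrA -expRD.
  by rewrite mulrBr.
apply: (@nondecreasing_along_energy (fun x => energy x * expR (K * x))) => //.
- exact: ltW.
- by apply: abs_continuous_energy_expR => //; exact: ltW.
move=> w e' /andP[w1w _] he slope.
exists ((e' + K * energy w) * expR (K * w)); first exact: is_derive_energy_expR.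
rewrite mulr_ge0 ?expR_ge0//.
have w0 : 0 < w by lra.
have gw := g_ge0 w0; have gle := energy_ge w0; have pw := phi_ge0 (ltW w0).
rewrite -(pmulr_rge0 _ (mulr_gt0 d0 w0)) mulrDr.
have : 2 * c * energy w <= d * w * (K * energy w).
  rewrite mulrA ler_wpM2r//; first lra.
  rewrite /K (_ : d * w * _ = 2 * c * (w / w1)); last by field; rewrite !gt_eqF.
  by rewrite ler_peMr ?mulr_ge0 ?(ltW c0)// ler_pdivlMr// mul1r ltW.
have : c * g w <= c * energy w by rewrite ler_pM2l.
have : 0 <= g w * phi w by rewrite mulr_ge0.
by have := sqr_ge0 (g w); move: slope; rewrite /energy_slope_ge; lra.
Qed.

Lemma energy_gt0 (w1 w2 : R) : 0 < w1 -> w1 <= w2 -> 0 < energy w1 -> 0 < energy w2.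
Proof.
move=> w1_gt0 w12 e1; apply: lt_le_trans (energy_lower w1_gt0 w12).
by rewrite mulr_gt0 ?expR_gt0.
Qed.

(** Keeps E away from 0 on compact intervals, where 1 / (E ln w) and the square root of E are then
    absolutely continuous. *)
Lemma energy_pos_lower_bound (w1 w2 : R) : 0 < w1 -> w1 <= w2 -> 0 < energy w1 ->
  exists2 m : R, 0 < m & forall x : R, w1 <= x <= w2 -> m <= energy x.
Proof.
have c0 := c_gt0; have d0 := d_gt0.
move=> w1_gt0 w12 e1; exists (energy w1 * expR (2 * c / (d * w1) * (w1 - w2))).
  by rewrite mulr_gt0 ?expR_gt0.
move=> x /andP[w1x xw2]; apply: le_trans (energy_lower w1_gt0 w1x).
by rewrite ler_pM2l// ler_expR ler_pM2l ?divr_gt0 ?mulr_gt0//; lra.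
Qed.

(** To be read with k = 1 + c, u = g, y = phi - c, e = E, and y' the sum of y and the deficit
    allowed by the lower bound on [phi]. It bounds the right side of the slope inequality below by a
    multiple of E^2, the quadratic term that drives E upwards. The cap e <= 2 k^2 enters through u
    <= 2 k. *)
Lemma square_energy_le (k u y y' e : R) : 0 < k -> 0 <= u -> y <= y' -> 0 <= y' ->
  0 <= k + y -> e = u * (k + y) + u ^+ 2 / 2 -> e <= 2 * k ^+ 2 ->
  e ^+ 2 <= 3 * k ^+ 2 * (u ^+ 2 + 2 * y' * u).
Proof.
move=> k0 u0 yy' y'0 ky eE ek.
have e0 : 0 <= e by rewrite eE addr_ge0 ?mulr_ge0 ?sqr_ge0 ?invr_ge0.
have u2k : u <= 2 * k.
  rewrite -ler_sqr ?nnegrE//; last lra.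
  have : 0 <= u * (k + y) by rewrite mulr_ge0.
  by rewrite exprMn; lra.
pose M := k + y' + u / 2.
have eM : e <= u * M.
  have : u * y <= u * y' by rewrite ler_wpM2l.
  by rewrite eE /M; lra.
have h1 : e * M <= 3 * k ^+ 2 * u + 4 * k ^+ 2 * y'.
  have : e * k <= u * M * k by rewrite ler_wpM2r// ltW.
  have : e * (y' + u / 2) <= 2 * k ^+ 2 * (y' + u / 2) by rewrite ler_wpM2r//; lra.
  have : u * (k * (y' + u / 2)) <= 2 * k * (k * (y' + u / 2)).
    by rewrite ler_wpM2r// mulr_ge0//; lra.
  by rewrite /M; lra.
have h2 : e ^+ 2 <= u * (e * M) by rewrite expr2 mulrCA ler_wpM2l.
apply: le_trans h2 _; apply: le_trans (ler_wpM2l u0 h1) _.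
have : 0 <= k ^+ 2 * (u * y') by rewrite mulr_ge0 ?sqr_ge0// mulr_ge0.
by lra.
Qed.

(** If E stayed below 2 (1 + c)^2, then d w E' + d E / ln w >= kap E^2 for large w. Divided by d w
    E^2 ln w, this says that - 1 / (E ln w) - r ln ln w is nondecreasing, which is impossible: the
    first term is negative and the second tends to minus infinity. *)
Lemma energy_large (b wstar w1 : R) : 0 < b < 1 -> 1 < wstar ->
  (forall w, wstar <= w -> c - b * (d * (1 + c) / 2 / ln w) <= phi w) ->
  0 < w1 -> 0 < energy w1 ->
  exists2 w : R, w1 <= w & 2 * (1 + c) ^+ 2 < energy w.
Proof.
have c0 := c_gt0; have d0 := d_gt0.
move=> /andP[b0 b1] wstar1 phi_lb w1_gt0 e1; apply/not_exists2P => no_large.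
have e_le w : w1 <= w -> energy w <= 2 * (1 + c) ^+ 2.
  by move=> w1w; rewrite leNgt; apply/negP => ?; have [] := no_large w.
(* Beyond exp(t0) the allowed deficit is at most (1 - b) (1 + c), so that 1 + phi >= b (1 + c). *)
pose t0 := b * d / (2 * (1 - b)).
have t00 : 0 < t0 by rewrite divr_gt0 ?mulr_gt0//; lra.
pose x0 := Num.max w1 (Num.max wstar (expR t0)).
have [w1x0 wsx0 tx0] : [/\ w1 <= x0, wstar <= x0 & expR t0 <= x0].
  by rewrite !le_max !lexx !orbT.
have x0_gt0 : 0 < x0 by lra.
have ln_ge x : x0 <= x -> t0 <= ln x.
  by move=> x0x; rewrite -[leLHS]expRK ler_ln ?posrE ?expR_gt0//; lra.
pose kap := (3 * (1 + c) ^+ 2)^-1.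
have kap0 : 0 < kap by rewrite invr_gt0 mulr_gt0// exprn_gt0//; lra.
pose r := kap / d; have r0 : 0 < r by exact: divr_gt0.
pose H x := - (energy x * ln x)^-1 - r * ln (ln x).
have ln_pos x : x0 <= x -> 0 < ln x by move=> /ln_ge; apply: lt_le_trans.
have e_pos x : x0 <= x -> 0 < energy x.
  by move=> x0x; apply: energy_gt0 e1 => //; lra.
have ndH x : x0 <= x -> H x0 <= H x.
  move=> x0x; apply: nondecreasing_along_energy; rewrite ?(ltW x0_gt0)//.
    have [m m0 em] := energy_pos_lower_bound x0_gt0 x0x (e_pos _ (lexx x0)).
    have lnx0 := ln_pos _ (lexx x0).
    have acln : abs_continuous x0 x (@ln R).
      apply: (@abs_continuous_lipschitz _ _ _ _ x0^-1).
      apply: (@is_derive_lipschitz _ _ (fun y => y^-1)) => y /andP[xy yx].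
        by apply: is_derive1_ln; lra.
      by rewrite ger0_norm ?invr_ge0 ?lef_pV2 ?posrE//; lra.
    have acE : abs_continuous x0 x (energy \* @ln R).
      by apply: abs_continuousM => //; apply: abs_continuous_energy; rewrite ?(ltW x0_gt0).
    have [M EM] := abs_continuous_bounded x0x acE.
    have [N lnN] := abs_continuous_bounded x0x acln.
    apply: abs_continuousD.
      apply: (@abs_continuous_comp _ (energy \* @ln R) (fun y => - y^-1) (fun y => y ^- 2)
        _ _ (m * ln x0) M ((m * ln x0) ^- 2) acE).
      - move=> y xyx; rewrite (le_trans (ler_norm _) (EM _ xyx)) andbT /=.
        have /andP[xy yx] := xyx.
        by rewrite ler_pM ?(ltW m0) ?(ltW lnx0) ?em// ler_ln ?posrE//; lra.
      - move=> y /andP[my yM]; have y0 : 0 < y by apply: lt_le_trans my; rewrite mulr_gt0.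
        have hV := @is_deriveV R id y 1 1 (lt0r_neq0 y0) (is_derive_id y 1).
        by apply: is_derive_eq; rewrite /GRing.scale/=; field; rewrite gt_eqF.
      - move=> y /andP[my yM]; have mx : 0 < m * ln x0 by rewrite mulr_gt0.
        rewrite ger0_norm ?invr_ge0 ?sqr_ge0// lef_pV2 ?posrE ?exprn_gt0//.
          by rewrite ler_sqr ?nnegrE//; lra.
        exact: lt_le_trans my.
    apply: (@abs_continuous_comp _ (@ln R) (fun y => - (r * ln y)) (fun y => - (r / y))
        _ _ (ln x0) N (r / ln x0) acln).
    - move=> y xyx; rewrite (le_trans (ler_norm _) (lnN _ xyx)) andbT.
      by have /andP[xy yx] := xyx; rewrite ler_ln ?posrE//; lra.
    - move=> y /andP[my yM]; have hln := is_derive1_ln (lt_le_trans lnx0 my).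
      by apply: is_derive_eq; rewrite /GRing.scale/=; ring.
    - move=> y /andP[my yM]; have y0 := lt_le_trans lnx0 my.
      by rewrite normrN ger0_norm ?(ltW (divr_gt0 r0 y0))// ler_pM2l// lef_pV2.
  move=> w e' /andP[/ltW x0w _] he slope.
  have w0 : 0 < w by lra.
  have t_gt0 := ln_pos w x0w; have e0 := e_pos w x0w.
  have et0 : energy w * ln w != 0 by rewrite gt_eqF// mulr_gt0.
  exists ((e' * ln w + energy w / w) / (energy w * ln w) ^+ 2 - r / (w * ln w)).
    have hln := is_derive1_ln w0; have hlnt := is_derive1_ln t_gt0.
    have hlnln := is_derive1_comp hlnt hln.
    have hE : is_derive w 1 (fun x => energy x * ln x) (e' * ln w + energy w / w).
      by apply: is_derive_eq; rewrite /GRing.scale/=; ring.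
    have hV := is_deriveV (f := fun x => energy x * ln x) et0 hE.
    have hsum := is_deriveB (is_deriveN hV) (is_deriveZ r hlnln).
    apply: (is_derive_eq hsum); rewrite /GRing.scale/=.
    by field; rewrite !gt_eqF.
  have [[gw gle] pw] := (g_ge0 w0, energy_ge w0, phi_ge0 (ltW w0)).
  pose xt := b * (d * (1 + c) / 2 / ln w).
  have xt0 : 0 < xt by rewrite mulr_gt0// !divr_gt0 ?mulr_gt0//; lra.
  have y'0 : 0 <= phi w - c + xt by have := phi_lb w; rewrite -/xt; lra.
  have xt_le : xt <= (1 - b) * (1 + c).
    have := ln_ge w x0w; rewrite /t0 ler_pdivrMr; last lra.
    move=> h; rewrite /xt mulrA ler_pdivrMr//.
    have : (b * d) * (1 + c) <= (ln w * (2 * (1 - b))) * (1 + c) by rewrite ler_wpM2r//; lra.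
    by lra.
  have k0 : 0 < 1 + c by lra.
  have ky : 0 <= 1 + c + (phi w - c) by lra.
  have yy' : phi w - c <= phi w - c + xt by lra.
  have eE : energy w = g w * (1 + c + (phi w - c)) + g w ^+ 2 / 2.
    by rewrite /energy; ring.
  have sq := square_energy_le k0 gw yy' y'0 ky eE (e_le w (le_trans w1x0 x0w)).
  have kapsq : kap * energy w ^+ 2 <= g w ^+ 2 + 2 * (phi w - c + xt) * g w.
    by rewrite /kap mulrC ler_pdivrMr ?mulr_gt0 ?exprn_gt0//; lra.
  (* Here b < 1 pays: E >= g (1 + phi) >= b (1 + c) g, so the loss caused by the deficit is at most
     d E / ln w, exactly the term produced by differentiating the factor ln w in E ln w. *)
  have dt : d / ln w * energy w >= 2 * xt * g w.
    have -> : 2 * xt * g w = d / ln w * (b * (1 + c) * g w).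
      by rewrite /xt; field; rewrite gt_eqF.
    rewrite ler_wpM2l ?(ltW (divr_gt0 _ _))// eE.
    have : 0 <= g w * (1 + phi w - b * (1 + c)) by rewrite mulr_ge0//; lra.
    by have := sqr_ge0 (g w); lra.
  have main : 0 <= d * w * e' + d / ln w * energy w - kap * energy w ^+ 2.
    by move: slope; rewrite /energy_slope_ge; lra.
  have den : 0 < (energy w) ^+ 2 * (ln w) * (w * d) by rewrite !mulr_gt0.
  rewrite -(pmulr_rge0 _ den); move: main; congr (_ <= _).
  by rewrite /r; field; rewrite !gt_eqF.
(* At w = exp(exp T) the double logarithm equals T, and r T exceeds the absolute value of [H x0]. *)
pose T := x0 + `|H x0| / r + 1.
have HT0 : 0 <= `|H x0| / r by rewrite divr_ge0// ltW.
have X_ge : x0 <= expR (expR T).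
  have := expR_ge1Dx (expR T); have := expR_ge1Dx T.
  by rewrite /T; lra.
have := ndH _ X_ge; apply/negP; rewrite -ltNge /H !expRK.
rewrite (@le_lt_trans _ _ (- (r * T)))//.
  by rewrite gerDr oppr_le0 invr_ge0 mulr_ge0 ?expR_ge0// ltW// e_pos.
have rT : r * T = r * x0 + `|H x0| + r.
  by rewrite /T; field; rewrite gt_eqF.
rewrite -/(H x0) rT; have := ler_norm (- H x0); rewrite normrN.
by have := mulr_gt0 r0 x0_gt0; lra.
Qed.

(** The slope inequality reads d w E' >= 2 E - 2 (1 + c) g, and g <= sqrt (2 E). For q = sqrt E this
    gives d w q' >= q - sqrt 2 (1 + c), whose equilibrium is E = 2 (1 + c)^2; above it, q - sqrt 2
    (1 + c) grows at least like w^(1 / d). *)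
Lemma energy_growth (w1 : R) : 0 < w1 -> 2 * (1 + c) ^+ 2 < energy w1 ->
  exists2 C : R, 0 < C & forall w, w1 <= w -> C * expR (2 / d * ln w) <= energy w.
Proof.
have c0 := c_gt0; have d0 := d_gt0.
move=> w1_gt0 large.
pose s2 : R := Num.sqrt 2.
have s20 : 0 < s2 by rewrite sqrtr_gt0.
have s2s2 : s2 ^+ 2 = 2 by rewrite sqr_sqrtr.
pose H x := (Num.sqrt (energy x) - s2 * (1 + c)) * expR (- (ln x / d)).
have e1 : 0 < energy w1.
  by apply: le_lt_trans large; rewrite mulr_ge0 ?sqr_ge0.
have H1 : 0 < H w1.
  rewrite mulr_gt0 ?expR_gt0// subr_gt0 -ltr_sqr ?nnegrE ?sqrtr_ge0//.
    by rewrite sqr_sqrtr ?(ltW e1)// exprMn s2s2.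
  by rewrite mulr_ge0 ?(ltW s20)//; lra.
have e_pos x : w1 <= x -> 0 < energy x by move=> w1x; exact: energy_gt0 e1.
have ndH w : w1 <= w -> H w1 <= H w.
  move=> w1w; apply: nondecreasing_along_energy; rewrite ?(ltW w1_gt0)//.
    have [m m0 em] := energy_pos_lower_bound w1_gt0 w1w e1.
    have acE : abs_continuous w1 w energy by apply: abs_continuous_energy; rewrite ?(ltW w1_gt0).
    have [M EM] := abs_continuous_bounded w1w acE.
    apply: abs_continuousM => //.
      apply: abs_continuousD; last exact: abs_continuous_cst.
      apply: (@abs_continuous_comp _ energy _ (fun y => (2 * Num.sqrt y)^-1)
        _ _ m M (2 * Num.sqrt m)^-1 acE).
      - by move=> y ywy; rewrite em// (le_trans (ler_norm _) (EM _ ywy)).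
      - by move=> y /andP[my _]; apply: is_derive1_sqrt; exact: lt_le_trans my.
      - move=> y /andP[my _]; have y0 := lt_le_trans m0 my.
        rewrite ger0_norm ?invr_ge0 ?mulr_ge0 ?sqrtr_ge0//.
        by rewrite lef_pV2 ?posrE ?mulr_gt0 ?sqrtr_gt0// ler_pM2l// ler_sqrt// ltW.
    apply: (@abs_continuous_lipschitz _ _ _ _ (expR (- (ln w1 / d)) / (d * w1))).
    apply: (@is_derive_lipschitz _ _ (fun y => - (expR (- (ln y / d)) / (d * y)))).
      move=> y /andP[wy _]; have y0 := lt_le_trans w1_gt0 wy.
      have hln := is_derive1_ln y0.
      by apply: is_derive_eq; rewrite /GRing.scale/=; field; rewrite !gt_eqF.
    move=> y /andP[wy _]; have y0 := lt_le_trans w1_gt0 wy.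
    rewrite normrN ger0_norm ?divr_ge0 ?expR_ge0 ?mulr_ge0 ?(ltW d0) ?(ltW y0)//.
    rewrite ler_pM ?expR_ge0 ?invr_ge0 ?mulr_ge0 ?(ltW d0) ?(ltW y0)//.
      by rewrite ler_expR lerN2 ler_pM2r ?invr_gt0// ler_ln.
    by rewrite lef_pV2 ?posrE ?mulr_gt0// ler_pM2l.
  move=> x e' /andP[/ltW w1x _] he slope.
  have x0 : 0 < x by lra.
  have e0 := e_pos x w1x; pose q := Num.sqrt (energy x).
  have q0 : 0 < q by rewrite sqrtr_gt0.
  have qq : q ^+ 2 = energy x by rewrite sqr_sqrtr ?(ltW e0).
  have hln := is_derive1_ln x0.
  have hq := is_derive1_comp (is_derive1_sqrt e0) he.
  exists (((2 * q)^-1 * e' - (q - s2 * (1 + c)) / (d * x)) * expR (- (ln x / d))).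
    apply: is_derive_eq; rewrite /GRing.scale/= -/q.
    by field; rewrite !gt_eqF.
  rewrite mulr_ge0 ?expR_ge0//.
  have [gx pw] := (g_ge0 x0, phi_ge0 (ltW x0)).
  have gq : g x <= s2 * q.
    rewrite -ler_sqr ?nnegrE ?mulr_ge0 ?(ltW s20) ?(ltW q0)//.
    rewrite exprMn s2s2 qq; have : 0 <= g x * phi x by rewrite mulr_ge0.
    by rewrite /energy; lra.
  have den : 0 < 2 * q * (d * x) by rewrite !mulr_gt0.
  rewrite -(pmulr_rge0 _ den).
  have : 0 <= d * x * e' - 2 * energy x + 2 * (1 + c) * (s2 * q).
    have : (1 + c) * g x <= (1 + c) * (s2 * q) by rewrite ler_wpM2l//; lra.
    by move: slope; rewrite /energy_slope_ge /energy; lra.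
  by rewrite -qq; congr (_ <= _); field; rewrite !gt_eqF.
exists (H w1 ^+ 2); first exact: exprn_gt0.
move=> w w1w; have e0 := e_pos w w1w.
have := ndH w w1w; rewrite {2}/H expRN ler_pdivlMr ?expR_gt0// => h.
have h2 : H w1 * expR (ln w / d) <= Num.sqrt (energy w).
  by have : 0 < s2 * (1 + c) by [rewrite mulr_gt0//; lra]; lra.
have -> : 2 / d * ln w = ln w / d + ln w / d by lra.
rewrite expRD -expr2 -exprMn -[leRHS]sqr_sqrtr ?(ltW e0)//.
by rewrite ler_sqr ?nnegrE ?sqrtr_ge0// mulr_ge0 ?expR_ge0// ltW.
Qed.

End DifferentialInequality.

(** * Tail of the law of W *)

Section ProductLaw.
Context {R : realType}.
Local Notation mu := (@lebesgue_measure R).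

Lemma measurable_box n (A : set R) : measurable A ->
  measurable [set t : n.-tuple R | forall i, A (tnth t i)].
Proof.
move=> mA; rewrite (_ : [set _ | _] = \bigcap_(i in [set: 'I_n]) ((tnth (T:=R))^~ i @^-1` A)).
  apply: fin_bigcap_measurable; first exact: finite_finset.
  by move=> i _; rewrite -[X in measurable X]setTI; exact: measurable_tnth.
by apply/seteqP; split=> [t At i _|t At i]; exact: At.
Qed.

Lemma prod_law_box n (nu : nat -> probability (measurableTypeR R) R) (A : set R) (q : R) :
  0 <= q -> measurable A -> (forall i, (q%:E <= nu i A)%E) ->
  ((q ^+ n)%:E <= prod_law n nu [set t : n.-tuple R | forall i, A (tnth t i)])%E.
Proof.
move=> q0 mA; elim: n nu => [|n ih] nu qA.
  rewrite expr0 /= diracE mem_set// => -[]//.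
rewrite exprS EFinM /= /distribution/= /pushforward.
rewrite (_ : _ @^-1` _ = (A : set (measurableTypeR R)) `*` [set t : n.-tuple R | forall i, A (tnth t i)]).
  rewrite product_measure1E//; last exact: measurable_box.
  apply: lee_pmul; [by rewrite lee_fin|by rewrite lee_fin exprn_ge0|exact: qA|].
  by apply: (ih (fun i => nu i.+1)) => i; exact: qA.
apply/seteqP; split=> [[x t] At|[x t] [/= Ax At] i].
  split; first by have := At ord0; rewrite /consp tnth0.
  by move=> i; have := At (lift ord0 i); rewrite /consp tnthS.
by case: (unliftP ord0 i) => [j ->|->]; rewrite /consp ?tnthS ?tnth0.
Qed.


(** On [[0, 2]] the standard normal density is smallest at 2. *)
Lemma normal_prob_itv_ge (u v : R) : 0 <= u -> u <= v -> v <= 2 ->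
  (((v - u) * normal_pdf 0 1 2)%:E <= normal_prob (0:R) 1 `]u, v])%E.
Proof.
move=> u0 uv v2; rewrite /normal_prob.
have -> : ((v - u) * normal_pdf 0 1 2)%:E = (\int[mu]_(x in `]u, v]) (normal_pdf 0 1 2)%:E)%E.
  rewrite integral_cst//=.
  have := @lebesgue_measure_itv R `]u, v]; rewrite /= lte_fin => ->.
  move: uv; rewrite le_eqVlt => /orP[/eqP <-|uv]; first by rewrite ltxx subrr mul0r mule0.
  by rewrite uv -EFinB -EFinM mulrC.
apply: ge0_le_integral => //.
- by move=> x _; rewrite lee_fin normal_pdf_ge0.
- by apply/measurable_EFinP/measurable_funTS; exact: measurable_normal_pdf.
move=> x; rewrite /= in_itv/= => /andP[ux xv].
rewrite lee_fin !normal_pdfE ?oner_neq0// ler_wpM2l ?normal_peak_ge0//.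
rewrite ler_expR !subr0 !mulNr lerN2 ler_pM2r ?invr_gt0 ?mulrn_wgt0 ?exprn_gt0//.
by rewrite ler_sqr ?nnegrE//; lra.
Qed.

Lemma sqnorm_itv n (t : n.-tuple R) (u v : R) : 0 <= u ->
  (forall i, u < tnth t i <= v) -> n%:R * u ^+ 2 <= sqnorm t <= n%:R * v ^+ 2.
Proof.
move=> u0 tuv; rewrite /sqnorm !mulr_natl -[X in _ *+ X <= _]card_ord -[X in _ <= _ *+ X]card_ord.
rewrite -!sumr_const; apply/andP; split; apply: ler_sum => i _;
  have /andP[ut tv] := tuv i; rewrite ler_sqr ?nnegrE//; lra.
Qed.

(** The cube of side []0, a]] lies in the event; as n > 0, one positive coordinate makes the sum of
    squares positive. *)
Lemma scaled_chi2_itv_ge n (a : R) : (0 < n)%N -> 0 < a -> a <= 2 ->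
  (((a * normal_pdf 0 1 2) ^+ n)%:E <= scaled_chi2_law n (1:R) `]0%R, (n%:R * a ^+ 2)%R]%classic)%E.
Proof.
move=> n0 a0 a2; rewrite /scaled_chi2_law /distribution /pushforward.
have pdf0 : 0 <= normal_pdf (0:R) 1 2 by exact: normal_pdf_ge0.
apply: (@le_trans _ _ (prod_law n (fun=> normal_prob (0:R) 1)
    [set t : n.-tuple R | forall i, `]0, a]%classic (tnth t i)])).
  apply: prod_law_box; [by rewrite mulr_ge0 ?(ltW a0)|exact: measurable_itv|].
  by move=> _; have := @normal_prob_itv_ge 0 a (lexx _) (ltW a0) a2; rewrite subr0.
have mI : measurable `]0, a]%classic by exact: measurable_itv.
apply: le_measure; [apply: mem_set|apply: mem_set|].
- exact: measurable_box.
- by rewrite -[X in measurable X]setTI; apply: measurable_scaled_sqnorm => //; exact: measurable_itv.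
move=> t /= ta; rewrite in_itv/= /scaled_sqnorm expr1n mul1r.
have tnth_itv i : 0 < tnth t i <= a by have := ta i; rewrite in_itv.
have /andP[_ ->] := sqnorm_itv (lexx 0) tnth_itv; rewrite andbT.
rewrite /sqnorm (bigD1 (Ordinal n0))//= ltr_pwDl// ?sumr_ge0// => [|i _].
  by rewrite exprn_gt0//; have /andP[] := tnth_itv (Ordinal n0).
exact: sqr_ge0.
Qed.

Lemma normal_vec_sqnorm_ge1 p : (0 < p)%N ->
  (0 < normal_vec_law [tuple of nseq p (0:R)%R] 1%R [set x | (1 <= sqnorm x)%R])%E.
Proof.
move=> p0; have pdf0 : 0 < normal_pdf (0:R) 1 2.
  by rewrite normal_pdfE ?oner_neq0// mulr_gt0 ?expR_gt0// normal_peak_gt0// oner_neq0.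
have mI : measurable `]1, 2 : R]%classic by exact: measurable_itv.
apply: (@lt_le_trans _ _ (((normal_pdf (0:R) 1 2) ^+ p)%:E)).
  by rewrite lte_fin exprn_gt0.
apply: (@le_trans _ _ (normal_vec_law [tuple of nseq p (0:R)] 1
    [set t : p.-tuple R | forall i, `]1, 2]%classic (tnth t i)])).
  apply: prod_law_box => //; first exact: ltW.
  move=> i; have := @normal_prob_itv_ge 1 2 ler01 _ (lexx _).
  rewrite (_ : 2 - 1 = 1) ?mul1r; last lra.
  rewrite (_ : nth 0 _ i = 0); last by rewrite nth_nseq; case: ifP.
  by apply; lra.
apply: le_measure; [apply: mem_set|apply: mem_set|].
- exact: measurable_box.
- rewrite (_ : [set _ | _] = setT `&` (scaled_sqnorm 1 @^-1` `[1, +oo[)).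
    by apply: measurable_scaled_sqnorm => //; exact: measurable_itv.
  rewrite setTI; apply/seteqP; split => x /=;
  by rewrite in_itv/= andbT /scaled_sqnorm expr1n mul1r.
move=> t /= ta.
have tnth_itv i : 1 < tnth t i <= 2 by have := ta i; rewrite in_itv.
have /andP[+ _] := sqnorm_itv ler01 tnth_itv; apply: le_trans.
by rewrite expr1n mulr1 ler1n.
Qed.

End ProductLaw.

Section TailExpectation.
Context {R : realType}.

Lemma geometric_sum_le (y : R) m : 2 <= y -> \sum_(k < m.+1) y ^+ k <= 2 * y ^+ m.
Proof.
move=> y2; elim: m => [|m ih]; first by rewrite big_ord1 expr0; lra.
rewrite big_ord_recr/=; apply: (@le_trans _ _ (2 * y ^+ m + y ^+ m.+1)).
  by rewrite lerD2r.
have : 2 * y ^+ m <= y * y ^+ m by rewrite ler_wpM2r// exprn_ge0//; lra.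
by rewrite exprS; lra.
Qed.

Lemma measurable_sqnorm p : measurable_fun setT (@sqnorm R p).
Proof.
rewrite (_ : @sqnorm R p = scaled_sqnorm 1); first exact: measurable_scaled_sqnorm.
by apply/funext => x; rewrite /scaled_sqnorm expr1n mul1r.
Qed.

Lemma measurable_sample_space p : measurable (@sample_space R p).
Proof.
rewrite (_ : @sample_space R p = setT `&` snd @^-1` `]0, +oo[).
  by apply: measurable_snd => //; exact: measurable_itv.
by rewrite setTI; apply/seteqP; split => z /=; rewrite /sample_space/= in_itv/= andbT.
Qed.

(** At theta = 0 and s = 1, the event that |X|^2 >= 1 and S <= 4^(-k) / n has probability at least
    of order 2^(- k n) and forces W >= 4^k, where h >= C 2^(k n). Every scale k thus contributes at
    least a fixed amount to the expectation. *)
Lemma finite_expectation_tail p n (h : R -> R) (C w1 : R) :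
  (0 < p)%N -> (0 < n)%N -> 0 < C -> 0 < w1 ->
  (forall w : R, w1 <= w -> C * expR (n%:R / 2 * ln w) <= h w) ->
  ~ finite_expectation p n h.
Proof.
move=> p0 n0 C0 w1_gt0 h_ge /(_ [tuple of nseq p (0:R)] 1 ltr01).
set nu := model n _ _; set D := @sample_space R p => ih.
have mD : measurable D by exact: measurable_sample_space.
pose A := [set x : p.-tuple R | 1 <= sqnorm x].
have mA : measurable A.
  rewrite (_ : A = setT `&` (@sqnorm R p @^-1` `[1, +oo[)).
    by apply: measurable_sqnorm => //; exact: measurable_itv.
  by rewrite setTI; apply/seteqP; split => x /=; rewrite in_itv/= andbT.
have := normal_vec_sqnorm_ge1 (R := R) p0; rewrite -/A.
set PA := normal_vec_law _ _ A => PA0.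
have PAfin : PA \is a fin_num by exact: fin_num_measure.
have pa0 : 0 < fine PA by rewrite fine_gt0// PA0 ltey_eq PAfin.
pose a k : R := 2 ^- k / n%:R.
have n1 : 1 <= n%:R :> R by rewrite ler1n.
have a0 k : 0 < a k by rewrite divr_gt0 ?invr_gt0 ?exprn_gt0//; lra.
have a2 k : a k <= 2.
  rewrite ler_pdivrMr; last lra.
  have : 2 ^- k <= 1 :> R by rewrite invf_le1 ?exprn_gt0// exprn_ege1//; lra.
  by lra.
pose B k : set R := `]0, n%:R * a k ^+ 2]%classic.
have mB k : measurable (B k) by exact: measurable_itv.
pose q := (normal_pdf (0:R) 1 2 / n%:R) ^+ n.
have q0 : 0 < q.
  rewrite exprn_gt0// divr_gt0//; last lra.
  by rewrite normal_pdfE ?oner_neq0// mulr_gt0 ?expR_gt0// normal_peak_gt0// oner_neq0.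
pose E k := A `*` B k.
have mE k : measurable (E k) by exact: measurableX.
have ED k : E k `<=` D by move=> [x s] [_] /=; rewrite /B/= in_itv/= => /andP[].
have nuE k : ((fine PA * (q / 2 ^+ (k * n)))%:E <= nu (E k))%E.
  have -> : nu (E k) = (PA * scaled_chi2_law n 1%R (B k))%E :=
    @product_measure1E _ _ _ _ R
    (normal_vec_law [tuple of nseq p (0:R)] 1) (scaled_chi2_law n 1) A (B k) mA (mB k).
  rewrite EFinM fineK//; apply: lee_pmul => //; [exact: ltW| |].
    by rewrite lee_fin (divr_ge0 (ltW q0))// exprn_ge0.
  apply: le_trans (scaled_chi2_itv_ge n0 (a0 k) (a2 k)); rewrite lee_fin.
  rewrite /q /a exprM -exprVn -exprMn le_eqVlt; apply/orP; left; apply/eqP.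
  by congr (_ ^+ n); ring.
(* Shift of the scales after which the lower bound on [h], valid from [w1] on, applies. *)
pose K := (Num.truncn w1).+1.
have K_ge k : w1 <= 4 ^+ (k + K) :> R.
  apply: ltW; apply: lt_le_trans (truncnS_gt w1) _.
  have : (K <= 4 ^ (k + K))%N.
    by rewrite (leq_trans (ltnW (@ltn_expl 4 K isT)))// leq_exp2l// leq_addl.
  by rewrite -(ler_nat R) natrX.
have W_ge k z : E k z -> 4 ^+ k <= Wstat z.
  move=> [/= Ax]; rewrite /B/= in_itv/= => /andP[s0 sa].
  rewrite /Wstat ler_pdivlMr//; apply: le_trans Ax.
  have na : n%:R * a k ^+ 2 = 4 ^- k / n%:R.
    have p4 : 4 ^+ k = (2 ^+ k) ^+ 2 :> R.
      by rewrite -exprM mulnC exprM; congr (_ ^+ _); lra.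
    have n0' : n%:R != 0 :> R by rewrite pnatr_eq0 -lt0n.
    by rewrite /a p4; field; rewrite n0' expf_neq0.
  apply: (@le_trans _ _ (4 ^+ k * (4 ^- k / n%:R))); first by rewrite ler_wpM2l ?exprn_ge0// -na.
  rewrite mulrA divff ?expf_neq0// mul1r invf_le1//; lra.
have hW_ge k z : E (k + K)%N z -> C * 2 ^+ ((k + K) * n) <= h (Wstat z).
  move=> /W_ge Wk; apply: le_trans (h_ge _ (le_trans (K_ge k) Wk)).
  rewrite ler_pM2l// (_ : 2 ^+ _ = expR (n%:R / 2 * ln (4 ^+ (k + K)))).
    rewrite ler_expR ler_wpM2l//.
    by rewrite ler_ln ?posrE ?exprn_gt0//; exact: lt_le_trans Wk; rewrite exprn_gt0.
  have -> : (4 : R) = 2 ^+ 2 by lra.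
  rewrite -exprM lnXn// (_ : _ * _ = ((k + K) * n)%:R * ln 2).
    by rewrite expRM_natl lnK ?posrE.
  by rewrite -mulr_natl !natrM; field.
(* The events are nested rather than disjoint, so several terms are active at once. They form a
   geometric sum of ratio 2^n >= 2, at most twice its last term, hence at most 2 |h(W)|. *)
pose f N z := \sum_(k < N) (C * 2 ^+ ((k + K) * n)) * \1_(E (k + K)%N) z.
have f_le N z : f N z <= 2 * `|h (Wstat z)|.
  elim: N => [|N ihN]; first by rewrite /f big_ord0 mulr_ge0.
  have [EN|EN] := pselect (E (N + K)%N z); last first.
    by rewrite /f big_ord_recr/= indicE memNset// mulr0 addr0.
  apply: (@le_trans _ _ (2 * (C * 2 ^+ ((N + K) * n)))); last first.
    by rewrite ler_pM2l// (le_trans (hW_ge _ _ EN))// ler_norm.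
  apply: (@le_trans _ _ (C * 2 ^+ (K * n) * \sum_(k < N.+1) (2 ^+ n) ^+ k)).
    rewrite /f mulr_sumr; apply: ler_sum => k _.
    rewrite (_ : C * _ * (2 ^+ n) ^+ k = C * 2 ^+ ((k + K) * n)).
      by rewrite ler_piMr ?indicE ?lern1 ?leq_b1// mulr_ge0 ?exprn_ge0// ltW.
    by rewrite -mulrA -exprM -exprD; congr (_ * _ ^+ _); rewrite mulnDl addnC (mulnC n).
  have y2 : 2 <= 2 ^+ n :> R by rewrite -[leLHS]expr1 ler_weXn2l//; lra.
  apply: le_trans (ler_wpM2l _ (geometric_sum_le N y2)) _.
    by rewrite mulr_ge0 ?exprn_ge0// ltW.
  have -> : 2 ^+ ((N + K) * n) = 2 ^+ (K * n) * (2 ^+ n) ^+ N :> R.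
    by rewrite -exprM -exprD mulnDl addnC (mulnC n).
  by rewrite le_eqVlt; apply/orP; left; apply/eqP; ring.
have mh : measurable_fun D (fun z => (h (Wstat z))%:E) by exact: measurable_int ih.
have int_f N : (\int[nu]_(z in D) (f N z)%:E =
    \sum_(k < N) (C * 2 ^+ ((k + K) * n))%:E * nu (E (k + K)%N))%E.
  rewrite /f; under eq_integral do rewrite -sumEFin.
  rewrite ge0_integral_sum//; last 2 first.
    by move=> k; apply/measurable_EFinP/measurable_funM => //; exact: measurable_indic.
    by move=> k z _; rewrite lee_fin mulr_ge0 ?mulr_ge0 ?exprn_ge0// ltW.
  apply: eq_bigr => k _; under eq_integral do rewrite EFinM.
  rewrite ge0_integralZl//; last 2 first.
    by apply/measurable_EFinP; exact: measurable_indic.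
    by rewrite lee_fin mulr_ge0 ?exprn_ge0// ltW.
  by rewrite integral_indic// setIidl.
have int_h : (\int[nu]_(z in D) `|(h (Wstat z))%:E| < +oo)%E by case/integrableP : ih.
have hfin : (\int[nu]_(z in D) `|(h (Wstat z))%:E|)%E \is a fin_num.
  by rewrite ge0_fin_numE// integral_ge0.
pose M := fine (\int[nu]_(z in D) `|(h (Wstat z))%:E|)%E.
have bound N : N%:R * (C * fine PA * q) <= 2 * M.
  rewrite -lee_fin [X in (_ <= X)%E]EFinM /M fineK//.
  apply: (@le_trans _ _ (\int[nu]_(z in D) (f N z)%:E)%E); last first.
    rewrite -ge0_integralZl//; last exact: measurableT_comp.
    apply: ge0_le_integral => //.
    - move=> z _; rewrite lee_fin sumr_ge0// => k _.
      by rewrite mulr_ge0 ?mulr_ge0 ?exprn_ge0// ltW.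
    - apply/measurable_EFinP/measurable_sum => k.
      by apply: measurable_funM => //; exact: measurable_indic.
    - by apply: measurable_funeM; exact: measurableT_comp.
    - by move=> z _; rewrite -EFinM lee_fin f_le.
  rewrite int_f; apply: (@le_trans _ _ (\sum_(k < N) (C * fine PA * q)%:E)%E).
    by rewrite sumEFin lee_fin sumr_const card_ord mulr_natl.
  apply: lee_sum => k _.
  apply: le_trans (lee_wpmul2l _ (nuE _)); last first.
    by rewrite lee_fin mulr_ge0 ?exprn_ge0// ltW.
  rewrite -EFinM lee_fin le_eqVlt; apply/orP; left; apply/eqP.
  by field; rewrite expf_neq0.
have y0 : 0 < C * fine PA * q by rewrite !mulr_gt0.
have := bound (Num.truncn (2 * M / (C * fine PA * q))).+1.
by rewrite leNgt => /negP; apply; rewrite -ltr_pdivrMr// truncnS_gt.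
Qed.

End TailExpectation.

(** * Proof of quasi-admissibility *)

Section QuasiAdmissibility.
Context {R : realType}.

Lemma cst_c_gt0 p n : (3 <= p)%N -> 0 < cst_c p n :> R.
Proof.
by move=> p3; rewrite /cst_c divr_gt0// subr_gt0 ltr_nat.
Qed.

Lemma cst_d_gt0 n : 0 < cst_d n :> R.
Proof. by rewrite /cst_d divr_gt0. Qed.

Lemma beta_starE p n : beta_star p n = cst_d n * (1 + cst_c p n) / 2 :> R.
Proof.
by rewrite /beta_star /cst_d /cst_c; field; rewrite gt_eqF.
Qed.

Lemma finite_expectationD p n (h1 h2 : R -> R) : finite_expectation p n h1 ->
  finite_expectation p n h2 -> finite_expectation p n (fun w => h1 w + h2 w).
Proof.
move=> f1 f2 theta s s0.
exact: (integrableD (@measurable_sample_space R p) (f1 theta s s0) (f2 theta s s0)).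
Qed.

Lemma quasi_admissible_of_ge p n (phi : R -> R) : (3 <= p)%N -> (3 <= n)%N ->
  PhiA p n phi ->
  (exists wstar b : R, 1 < wstar /\ b < 1 /\ (forall w : R, wstar <= w ->
     (p%:R - 2) / (n%:R + 2) - b * (beta_star p n / ln w) <= phi w)) ->
  quasi_admissible p n phi.
Proof.
move=> p3 n3 [[acphi [phi2 _ _ _]] [phi0 phi_ge0] _ _ _] [wstar [b [wstar1 [b1 phi_lb]]]].
move=> g [acg [g2 g1 _ _]] Delta_g.
have c0 := cst_c_gt0 n p3; have d0 := cst_d_gt0 n.
have Delta_ge w : 0 < w -> derivable phi w 1 -> derivable g w 1 ->
    0 <= g w * (2 * (cst_c p n - phi w) / w + cst_d n * derive1 phi w - g w / w +
      cst_d n * derive1 g w) + cst_d n * derive1 g w * (1 + phi w).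
  by move=> w0 dphi dg; rewrite -DeltaE ?gt_eqF//; exact: Delta_g.
have g_ge w := g_ge0 c0 d0 acphi acg phi0 phi_ge0 Delta_ge (w := w).
have g_pos w : 0 < w -> g w = 0.
  move=> w0; apply/eqP; rewrite eq_le g_ge// andbT leNgt; apply/negP => gw.
  have e0 : 0 < energy phi g w.
    exact: lt_le_trans gw (energy_ge c0 d0 acphi acg phi0 phi_ge0 Delta_ge w0).
  (* Increasing b only weakens the lower bound on [phi]; this makes it positive while keeping it
     below 1. *)
  pose b' := Num.max b (1 / 2).
  have b'01 : 0 < b' < 1 by rewrite lt_max gt_max b1 !ltr_pdivrMr ?divr_gt0 ?orbT//; lra.
  have phi_lb' v : wstar <= v ->
      cst_c p n - b' * (cst_d n * (1 + cst_c p n) / 2 / ln v) <= phi v.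
    move=> wv; apply: le_trans (phi_lb v wv); rewrite -beta_starE lerD2l lerN2.
    rewrite ler_wpM2r//; last by rewrite le_max lexx.
    by rewrite divr_ge0 ?beta_starE ?ln_ge0 ?divr_ge0 ?mulr_ge0//; lra.
  have [w1 ww1 large] :=
    energy_large c0 d0 acphi acg phi0 phi_ge0 Delta_ge b'01 wstar1 phi_lb' w0 e0.
  have w1_gt0 : 0 < w1 by exact: lt_le_trans w0 ww1.
  have [C C0 growth] := energy_growth c0 d0 acphi acg phi0 phi_ge0 Delta_ge w1_gt0 large.
  (* E <= phi^2 + g^2 + g, and the right side divided by W has finite expectation because [phi] and
     [g] belong to [Phi]. *)
  have := finite_expectationD (finite_expectationD phi2 g2) g1.
  apply: (@finite_expectation_tail _ p n _ C w1) => //; [exact: leq_trans p3|exact: leq_trans n3|].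
  move=> v w1v; have v0 : 0 < v by exact: lt_le_trans w1v.
  have [gv pv] := (g_ge v v0, phi_ge0 v (ltW v0)).
  rewrite -!mulrDl ler_pdivlMr//.
  apply: (@le_trans _ _ (energy phi g v)); last first.
    have := sqr_ge0 (phi v - g v); have := sqr_ge0 (g v); have := sqr_ge0 (phi v).
    by rewrite /energy; lra.
  apply: le_trans (growth v w1v); rewrite -[leLHS]mulrA ler_pM2l//.
  (* The exponents agree since 2 / d = n / 2 + 1; the extra 1 compensates for the division by w. *)
  rewrite -{2}(lnK (x := v)) ?posrE// -expRD ler_expR le_eqVlt; apply/orP; left; apply/eqP.
  by rewrite /cst_d; field; rewrite gt_eqF.
(* At 0 the differential inequality says nothing; [g 0 = 0] follows by continuity. *)
move=> w; rewrite le_eqVlt => /orP[/eqP <-|]; last exact: g_pos.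
apply/eqP; rewrite -normr_le0; apply/ler_addgt0Pr => e e0; rewrite add0r.
have [|k k0 hk] := @abs_continuous_dist R g 0 1 0 e ler01 (acg _ ler01) _ e0.
  by rewrite lexx ler01.
pose y := Num.min 1 (k / 2).
have y0 : 0 < y by rewrite lt_min ltr01/=; lra.
have [y1 yk] : y <= 1 /\ y <= k / 2 by rewrite !ge_min !lexx orbT.
have := hk y; rewrite (ltW y0) y1 subr0 (gtr0_norm y0) g_pos// sub0r normrN.
by move=> h; apply/ltW/h => //; lra.
Qed.

End QuasiAdmissibility.

(** * Stein's identity *)

Section NormalDensity.
Context {R : realType}.
Local Notation mu := (@lebesgue_measure R).

Lemma normal_density_ae (m s : R) :
  ae_eq mu setT (Radon_Nikodym_SigmaFinite.f (normal_prob m s) mu)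
    (fun x => (normal_pdf m s x)%:E).
Proof.
apply: integral_ae_eq => //.
- by apply: Radon_Nikodym_SigmaFinite.f_integrable; exact: normal_prob_dominates.
- by apply/measurable_EFinP; exact: measurable_normal_pdf.
move=> A _ mA; rewrite -Radon_Nikodym_SigmaFinite.f_integral//.
exact: normal_prob_dominates.
Qed.

Lemma ge0_integral_normal_prob (m s : R) (f : R -> R) : measurable_fun setT f ->
  (forall x, 0 <= f x) ->
  (\int[normal_prob m s]_x (f x)%:E = \int[mu]_x (f x * normal_pdf m s x)%:E)%E.
Proof.
move=> mf f0.
rewrite -(Radon_Nikodym_SigmaFinite.change_of_variables (mu := mu)) => //; last 2 first.
- exact: normal_prob_dominates.
- exact/measurable_EFinP.
apply: ae_eq_integral => //.
- apply: emeasurable_funM; first exact/measurable_EFinP.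
  apply: measurable_int; apply: Radon_Nikodym_SigmaFinite.f_integrable.
  exact: normal_prob_dominates.
- apply/measurable_EFinP/measurable_funM => //; exact: measurable_normal_pdf.
apply: (@filterS _ _ (ae_filter_ringOfSetsType mu)) (normal_density_ae m s) => x h _.
by rewrite h.
Qed.

Lemma integrable_normal_prob (m s : R) (f : R -> R) : measurable_fun setT f ->
  mu.-integrable setT (fun x => (f x * normal_pdf m s x)%:E) ->
  (normal_prob m s).-integrable setT (EFin \o f).
Proof.
move=> mf /integrableP[_ ifpdf]; apply/integrableP; split; first exact/measurable_EFinP.
rewrite (_ : (\int[_]_x _ = \int[normal_prob m s]_x `|f x|%:E)%E)//.
rewrite ge0_integral_normal_prob//; last exact: measurableT_comp.
apply: le_lt_trans ifpdf; apply: ge0_le_integral => //.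
- by move=> x _; rewrite lee_fin mulr_ge0// normal_pdf_ge0.
- by apply/measurable_EFinP/measurable_funM; [exact: measurableT_comp|exact: measurable_normal_pdf].
- apply: measurableT_comp => //.
  by apply/measurable_EFinP/measurable_funM => //; exact: measurable_normal_pdf.
- by move=> x _; rewrite /= lee_fin normrM (ger0_norm (normal_pdf_ge0 _ _ _)).
Qed.

Lemma integral_normal_prob (m s : R) (f : R -> R) : measurable_fun setT f ->
  mu.-integrable setT (fun x => (f x * normal_pdf m s x)%:E) ->
  (\int[normal_prob m s]_x (f x)%:E = \int[mu]_x (f x * normal_pdf m s x)%:E)%E.
Proof.
move=> mf ifpdf; have mpdf := @measurable_normal_pdf R m s.
pose f1 x := Num.max (f x) 0; pose f2 x := Num.max (- f x) 0.
have mf1 : measurable_fun setT f1 by exact: measurable_maxr.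
have mf2 : measurable_fun setT f2 by apply: measurable_maxr => //; exact: measurableT_comp.
have fE x : f x = f1 x - f2 x by rewrite /f1 /f2; case: leP => ?; case: leP => ?; lra.
have f1_ge0 x : 0 <= f1 x by rewrite le_max lexx orbT.
have f2_ge0 x : 0 <= f2 x by rewrite le_max lexx orbT.
have f1_le x : f1 x <= `|f x| by rewrite ge_max ler_norm normr_ge0.
have f2_le x : f2 x <= `|f x| by rewrite ge_max -normrN ler_norm normr_ge0.
have int_part (g : R -> R) : measurable_fun setT g -> (forall x, 0 <= g x) ->
    (forall x, g x <= `|f x|) -> mu.-integrable setT (fun x => (g x * normal_pdf m s x)%:E).
  move=> mg g0 gf; apply: le_integrable ifpdf => //.
    by apply/measurable_EFinP/measurable_funM.
  move=> x _; rewrite !abse_EFin lee_fin !normrM ler_wpM2r// ger0_norm//.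
have if1 := int_part _ mf1 f1_ge0 f1_le; have if2 := int_part _ mf2 f2_ge0 f2_le.
under eq_integral do rewrite fE EFinB.
rewrite integralB//; [|exact: integrable_normal_prob|exact: integrable_normal_prob].
rewrite !ge0_integral_normal_prob// -integralB//.
by apply: eq_integral => x _; rewrite -EFinB -mulrBl -fE.
Qed.

(** Doubling the variance absorbs a quadratic factor. With t = (x - m)^2 / (2 s^2) one has exp(- t)
    = exp(- t / 2)^2 and (t / 2) exp(- t / 2) <= 1, whence the constant 1 + 2 m^2 + 8 s^2. *)
Lemma normal_pdf_quadratic (m s : R) : 0 < s -> exists2 C : R, 0 < C &
  forall x, (1 + x ^+ 2) * normal_pdf m s x <= C * normal_pdf m (Num.sqrt 2 * s) x.
Proof.
move=> s0; pose s' := Num.sqrt 2 * s.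
have s'0 : 0 < s' by rewrite mulr_gt0// sqrtr_gt0.
have s's' : s' ^+ 2 = 2 * s ^+ 2 by rewrite exprMn sqr_sqrtr.
have peak := normal_peak_gt0 (lt0r_neq0 s0); have peak' := normal_peak_gt0 (lt0r_neq0 s'0).
pose A := 1 + 2 * m ^+ 2 + 8 * s ^+ 2.
have A0 : 0 < A by have := sqr_ge0 m; have := exprn_gt0 2 s0; rewrite /A; lra.
exists (A * normal_peak s / normal_peak s').
  by rewrite divr_gt0// mulr_gt0.
move=> x; rewrite !normal_pdfE ?lt0r_neq0//.
rewrite [leRHS](_ : _ = normal_peak s * (A * normal_fun m s' x)); last first.
  by field; rewrite lt0r_neq0.
rewrite mulrCA ler_pM2l// /normal_fun s's' !mulNr.
pose t := (x - m) ^+ 2 / (s ^+ 2 *+ 2).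
have s20 : 0 < s ^+ 2 by exact: exprn_gt0.
have t0 : 0 <= t by rewrite divr_ge0 ?sqr_ge0// mulrn_wge0// ltW.
have -> : (x - m) ^+ 2 / ((2 * s ^+ 2) *+ 2) = t / 2.
  by rewrite /t; field; rewrite lt0r_neq0.
rewrite -/t.
have xt : 1 + x ^+ 2 <= 1 + 2 * m ^+ 2 + 4 * s ^+ 2 * t.
  have -> : 4 * s ^+ 2 * t = 2 * (x - m) ^+ 2.
    by rewrite /t; field; rewrite lt0r_neq0.
  by have := sqr_ge0 (x - 2 * m); lra.
have e1 : expR (- t) = expR (- (t / 2)) * expR (- (t / 2)).
  by rewrite -expRD -opprD -splitr.
have e2 : expR (- (t / 2)) <= 1 by rewrite -[leRHS]expR0 ler_expR; lra.
have e3 : t / 2 * expR (- (t / 2)) <= 1.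
  by rewrite expRN ler_pdivrMr ?expR_gt0// mul1r; have := expR_ge1Dx (t / 2); lra.
rewrite e1 mulrA ler_wpM2r ?expR_ge0//.
apply: (le_trans (ler_wpM2r (expR_ge0 _) xt)).
have : (1 + 2 * m ^+ 2) * expR (- (t / 2)) <= 1 + 2 * m ^+ 2.
  by rewrite ler_piMr//; have := sqr_ge0 m; lra.
have : s ^+ 2 * (t / 2 * expR (- (t / 2))) <= s ^+ 2 by rewrite ler_piMr// ltW.
by rewrite /A; lra.
Qed.

Lemma integrable_quadratic_normal_pdf (m s K : R) (f : R -> R) : 0 < s ->
  measurable_fun setT f -> (forall x, `|f x| <= K * (1 + x ^+ 2)) ->
  mu.-integrable setT (fun x => (f x * normal_pdf m s x)%:E).
Proof.
move=> s0 mf fK; have [C C0 CE] := normal_pdf_quadratic m s0.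
have K0 : 0 <= K.
  by have := le_trans (normr_ge0 _) (fK 0); rewrite expr0n addr0 mulr1.
have := integrableZl measurableT (K * C) (@integrable_normal_pdf R m (Num.sqrt 2 * s)).
apply: le_integrable => //.
  by apply/measurable_EFinP/measurable_funM => //; exact: measurable_normal_pdf.
move=> x _; rewrite /= lee_fin !normrM (ger0_norm K0) (gtr0_norm C0).
rewrite !(ger0_norm (normal_pdf_ge0 _ _ _)) -mulrA.
apply: le_trans (ler_wpM2l K0 (CE x)); rewrite mulrA ler_wpM2r ?normal_pdf_ge0//.
Qed.

Lemma integrable_quadratic_normal_prob (m s K : R) (f : R -> R) : 0 < s ->
  measurable_fun setT f -> (forall x, `|f x| <= K * (1 + x ^+ 2)) ->
  (normal_prob m s).-integrable setT (EFin \o f).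
Proof.
move=> s0 mf fK; apply: integrable_normal_prob => //.
exact: integrable_quadratic_normal_pdf fK.
Qed.

End NormalDensity.

(** * Stein's identity in one variable *)

Section SteinIdentity.
Context {R : realType}.
Local Notation mu := (@lebesgue_measure R).

Lemma is_derive_normal_pdf (m s x : R) : s != 0 ->
  is_derive x 1 (normal_pdf m s) (- ((x - m) / s ^+ 2) * normal_pdf m s x).
Proof.
move=> s0; rewrite normal_pdfE//.
have hin : is_derive x 1 (fun y => - (y - m) ^+ 2 / (s ^+ 2 *+ 2)) (- ((x - m) / s ^+ 2)).
  have h (c : R) : is_derive x 1 (fun y => - (y - m) ^+ 2 * c) (- (2 * (x - m)) * c).
    by apply: is_derive_eq; rewrite /GRing.scale/=; ring.
  by apply: (is_derive_eq (h _)); field.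
have hexp := is_derive1_comp (is_derive_expR _) hin.
apply: (is_derive_eq (is_deriveZ (normal_peak s) hexp)).
by rewrite /GRing.scale/= /normal_fun; ring.
Qed.

Lemma is_derive_continuous (f f' : R -> R) :
  (forall x : R, is_derive x 1 f (f' x)) -> continuous f.
Proof.
by move=> df x; apply: derivable_continuous; exact: ex_derive.
Qed.

(** Integration by parts: s^2 times f times the density has derivative equal to the difference of
    the two integrands. The fundamental theorem on [[-N, N]], dominated convergence and vanishing
    boundary terms conclude. *)
Lemma stein_normal (m s K : R) (f f' : R -> R) : 0 < s ->
  (forall x : R, is_derive x 1 f (f' x)) -> continuous f' ->
  (forall x : R, `|f x| <= K * `|x|) -> (forall x : R, `|f' x| <= K) ->
  (\int[normal_prob m s]_x ((x - m) * f x)%:E =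
   \int[normal_prob m s]_x (s ^+ 2 * f' x)%:E)%E.
Proof.
move=> s0 df cf' fK f'K.
have s20 : s ^+ 2 != 0 by rewrite expf_neq0// gt_eqF.
have K0 : 0 <= K by exact: le_trans (normr_ge0 _) (f'K 0).
have cf := is_derive_continuous df.
have mf : measurable_fun setT f by exact: continuous_measurable_fun.
have mf' : measurable_fun setT f' by exact: continuous_measurable_fun.
have mxf : measurable_fun setT (fun x : R => (x - m) * f x).
  by apply: measurable_funM => //; exact: measurable_funB.
have quad1 (x : R) : `|(x - m) * f x| <= K * (2 + `|m|) * (1 + x ^+ 2).
  rewrite normrM; have xm : `|x - m| <= `|x| + `|m|.
    by rewrite (le_trans (ler_normD _ _))// normrN.
  apply: (le_trans (ler_pM (normr_ge0 _) (normr_ge0 _) xm (fK x))).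
  rewrite mulrCA -mulrA ler_wpM2l// -[x ^+ 2]real_normK ?num_real//.
  have := sqr_ge0 (`|x| - 1); have := normr_ge0 m; have := normr_ge0 x => hx hm h.
  have : 0 <= `|m| * (1 - `|x| + `|x| ^+ 2).
    by rewrite mulr_ge0//; have := sqr_ge0 (`|x| - 1 / 2); lra.
  by lra.
have quad2 (x : R) : `|s ^+ 2 * f' x| <= s ^+ 2 * K * (1 + x ^+ 2).
  rewrite normrM (ger0_norm (sqr_ge0 _)) -mulrA ler_wpM2l ?sqr_ge0//.
  by apply: le_trans (f'K x) _; rewrite ler_peMr// lerDl sqr_ge0.
have ms2f' : measurable_fun setT (fun x : R => s ^+ 2 * f' x) by exact: measurable_funM.
have i1 := integrable_quadratic_normal_pdf m s0 mxf quad1.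
have i2 := integrable_quadratic_normal_pdf m s0 ms2f' quad2.
rewrite !integral_normal_prob//.
pose Fd (x : R) : R := s ^+ 2 * f' x * normal_pdf m s x - (x - m) * f x * normal_pdf m s x.
pose F (x : R) : R := s ^+ 2 * (f x * normal_pdf m s x).
have iFd : mu.-integrable setT (EFin \o Fd).
  rewrite (_ : _ \o _ = (fun x => (s ^+ 2 * f' x * normal_pdf m s x)%:E) \-
    (fun x => ((x - m) * f x * normal_pdf m s x)%:E))%E; first exact: integrableB.
  by apply/funext => x; rewrite /= EFinB.
suff Fd0 : (\int[mu]_x (Fd x)%:E = 0)%E.
  move: Fd0; rewrite /Fd; under eq_integral do rewrite EFinB.
  have fA := integrable_fin_num measurableT i1.
  have fB := integrable_fin_num measurableT i2.
  rewrite integralB// -(fineK fA) -(fineK fB) -EFinB => -[] h.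
  by congr EFin; lra.
have dF (x : R) : is_derive x 1 F (Fd x).
  have hp := is_derive_normal_pdf m x (lt0r_neq0 s0).
  have hf := df x.
  by apply: is_derive_eq; rewrite /GRing.scale/= /Fd; field; rewrite gt_eqF.
have cpdf := @continuous_normal_pdf R m _ (lt0r_neq0 s0).
have cFd : continuous Fd.
  move=> x; apply: cvgB.
    by apply: cvgM; [apply: cvgM; [exact: cvg_cst|exact: cf']|exact: cpdf].
  apply: cvgM; last exact: cpdf.
  by apply: cvgM; [apply: cvgB; [exact: cvg_id|exact: cvg_cst]|exact: cf].
have cF := is_derive_continuous dF.
have [C C0 CE] := normal_pdf_quadratic m s0.
(* As f is at most linear, |x F(x)| is at most s^2 K x^2 times the density, which is bounded by a
   multiple of the peak of the wider normal density. *)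
pose B := s ^+ 2 * (K * (C * normal_peak (Num.sqrt 2 * s))).
have F_le (x : R) : 1 <= `|x| -> `|F x| <= B / `|x|.
  move=> x1; have x0 : 0 < `|x| by lra.
  rewrite ler_pdivlMr// /F /B /= normrM (normrM (f x)) (ger0_norm (sqr_ge0 _)) -[leLHS]mulrA ler_wpM2l ?sqr_ge0// -mulrA.
  rewrite (ger0_norm (normal_pdf_ge0 _ _ _)).
  have := CE x; have := normal_pdf_ub m x (_ : Num.sqrt 2 * s != 0).
  rewrite mulf_neq0 ?lt0r_neq0 ?sqrtr_gt0// => /(_ isT) ub h.
  apply: (@le_trans _ _ (K * `|x| * (normal_pdf m s x * `|x|))).
    by rewrite ler_wpM2r// mulr_ge0 ?normal_pdf_ge0.
  rewrite -mulrA ler_wpM2l//; apply: le_trans (ler_wpM2l (ltW C0) ub).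
  apply: le_trans h; rewrite mulrCA -expr2 mulrC ler_wpM2r ?normal_pdf_ge0//.
  by rewrite real_normK ?num_real// lerDr.
have lim1 : (\int[mu]_x ((Fd \_ `[(- n.+1%:R)%R, n.+1%:R]) x)%:E)%E @[n --> \oo] -->
    (\int[mu]_x (Fd x)%:E)%E.
  apply: (@dominated_cvg _ _ _ mu setT measurableT _ _ (fun x => `|(Fd x)%:E|%E)) => //.
  - move=> n; apply/measurable_EFinP; apply/(measurable_restrictT _ _).1 => //.
    by apply: measurable_funTS; exact: continuous_measurable_fun.
  - move=> x _; apply: cvg_near_cst; near=> n.
    rewrite patchE mem_set//= in_itv/= -ler_norml.
    rewrite (le_trans (ltW (truncnS_gt _)))// ler_nat ltnS.
    by near: n; exact: nbhs_infty_ge.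
  - exact: integrable_abse.
  - move=> n x _; rewrite patchE; case: ifPn => _ //.
    by rewrite abse0 abse_ge0.
have FTC n : (\int[mu]_x ((Fd \_ `[(- n.+1%:R)%R, n.+1%:R]) x)%:E =
    (F n.+1%:R - F (- n.+1%:R))%:E)%E.
  rewrite (_ : (\int[mu]_x _)%E = \int[mu]_(x in `[(- n.+1%:R)%R, n.+1%:R]) (Fd x)%:E)%E.
    rewrite (@continuous_FTC2 _ Fd F)//.
    - by rewrite -subr_gt0 opprK addr_gt0.
    - exact: continuous_subspaceT.
    - split; first by move=> x _; exact: ex_derive.
        exact/cvg_at_right_filter/cF.
      exact/cvg_at_left_filter/cF.
    - by move=> x _; rewrite derive1E derive_val.
  rewrite [RHS]integral_mkcond; apply: eq_integral => x _.
  by rewrite restrict_EFin.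
have lim2 : (F n.+1%:R - F (- n.+1%:R))%:E @[n --> \oo] --> (0 : \bar R).
  apply/cvg_EFin; first by apply: nearW.
  apply/cvgr0Pnorm_le => e e0; near=> n.
  have n1 : 1 <= n.+1%:R :> R by rewrite ler1n.
  have n0 : 0 < n.+1%:R :> R by [].
  have h1 : `|F n.+1%:R| <= B / n.+1%:R.
    by have := F_le n.+1%:R; rewrite (ger0_norm (ltW n0)); exact.
  have h2 : `|F (- n.+1%:R)| <= B / n.+1%:R.
    by have := F_le (- n.+1%:R); rewrite normrN (ger0_norm (ltW n0)); exact.
  rewrite /= (le_trans (ler_normB _ _))// (le_trans (lerD h1 h2))//.
  rewrite -mulrDl ler_pdivrMr// mulrC -ler_pdivrMr//.
  rewrite (le_trans (ltW (truncnS_gt _)))// ler_nat ltnS.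
  by near: n; exact: nbhs_infty_ge.
move: lim1; rewrite (funext FTC) => lim1.
by apply: (cvg_unique _ lim1 lim2).
Unshelve. all: by end_near. Qed.

End SteinIdentity.

(** * Stein's identity for products of normal laws *)

Section SteinProduct.
Context {R : realType}.

Lemma cvg0_quadratic (u : R -> R) (C : R) : (forall z, `|u z| <= C * z ^+ 2) ->
  u z @[z --> (0 : R)] --> (0 : R).
Proof.
move=> uC; have h : C * (z * z) @[z --> (0 : R)] --> (0 : R).
  rewrite -[X in _ --> X](mulr0 C) -[X in C * X](mulr0 (0 : R)).
  by apply: cvgM; [exact: cvg_cst|apply: cvgM; exact: cvg_id].
apply/norm_cvg0P; apply: (squeeze_cvgr _ (cvg_cst 0) h).
by near=> z; rewrite normr_ge0 -expr2 uC.
Unshelve. all: by end_near. Qed.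

(* Since |k q| <= K q, the map x |-> x k (a + x^2) is C^1 even at x = a = 0, although
   k is only differentiable off 0. *)
Definition radial_profile (K : R) (k k1 : R -> R) :=
  [/\ forall q : R, 0 < q -> is_derive q 1 k (k1 q),
      forall q : R, 0 < q -> {for q, continuous k1},
      measurable_fun setT k /\ measurable_fun setT k1 &
      forall q : R, 0 <= q ->
        [/\ `|k q| <= K, `|k q| <= K * q, `|k1 q| <= K & `|q * k1 q| <= K]].

Section profile.
Variables (K : R) (k k1 : R -> R).
Hypothesis kP : radial_profile K k k1.

Lemma radial_profile_ge0 : 0 <= K.
Proof.
by case: kP => _ _ _ /(_ 0 (lexx _))[h _ _ _]; exact: le_trans (normr_ge0 _) h.
Qed.

Lemma is_derive_radial (a x : R) : 0 <= a ->
  is_derive x 1 (fun y => y * k (a + y ^+ 2))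
    (k (a + x ^+ 2) + 2 * (x ^+ 2 * k1 (a + x ^+ 2))).
Proof.
move=> a0; have [dk _ _ bk] := kP.
have : 0 <= a + x ^+ 2 by rewrite addr_ge0 ?sqr_ge0.
rewrite le_eqVlt => /orP[/eqP/esym/eqP|q0].
  rewrite paddr_eq0 ?sqr_ge0// sqrf_eq0 => /andP[/eqP -> /eqP ->].
  have k0 : k 0 = 0.
    have [_ + _ _] := bk 0 (lexx _).
    by rewrite mulr0 normr_le0 => /eqP.
  rewrite expr0n/= addr0 mul0r mulr0 addr0 k0.
  (* At the origin the difference quotient is k(z^2), at most K z^2 in absolute value, so the
     derivative is 0 there. *)
  apply/is_derive1_caratheodory; exists (fun z => k (0 + z ^+ 2)); split.
  - by move=> z; rewrite mul0r !subr0 mulrC.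
  - rewrite /prop_for /continuous_at expr0n addr0 k0; apply: (@cvg0_quadratic _ K) => z.
    by have [_ + _ _] := bk (z ^+ 2) (sqr_ge0 z); rewrite add0r.
  - by rewrite expr0n/= addr0.
have hq : is_derive x 1 (fun y => a + y ^+ 2) (2 * x).
  by apply: is_derive_eq; rewrite /GRing.scale/=; ring.
have hk := @is_derive1_comp R k (fun y => a + y ^+ 2) x _ _ (dk _ q0) hq.
apply: (is_derive_eq (is_deriveM (is_derive_id x 1) hk)).
by rewrite /GRing.scale/=; ring.
Qed.

Lemma radial_derivative_le (a q : R) : 0 <= a -> 0 <= q ->
  `|k (a + q) + 2 * (q * k1 (a + q))| <= 3 * K.
Proof.
move=> a0 q0; have [_ _ _ bk] := kP.
have [h1 _ _ h4] := bk _ (addr_ge0 a0 q0).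
have : `|q * k1 (a + q)| <= K.
  apply: le_trans h4; rewrite !normrM ler_wpM2r//.
  by rewrite !ger0_norm ?addr_ge0// lerDr.
have := ler_normD (k (a + q)) (2 * (q * k1 (a + q))).
by rewrite normrM (ger0_norm (_ : 0 <= 2))//; lra.
Qed.

Lemma continuous_radial_derivative (a : R) : 0 <= a ->
  continuous (fun x : R => k (a + x ^+ 2) + 2 * (x ^+ 2 * k1 (a + x ^+ 2))).
Proof.
move=> a0 x; have [dk ck1 _ bk] := kP.
have : 0 <= a + x ^+ 2 by rewrite addr_ge0 ?sqr_ge0.
rewrite le_eqVlt => /orP[/eqP/esym/eqP|q0].
  rewrite paddr_eq0 ?sqr_ge0// sqrf_eq0 => /andP[/eqP -> /eqP ->].
  have k0 : k 0 = 0.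
    have [_ + _ _] := bk 0 (lexx _).
    by rewrite mulr0 normr_le0 => /eqP.
  rewrite /continuous_at expr0n/= addr0 k0 mul0r mulr0 addr0.
  apply: (@cvg0_quadratic _ (3 * K)) => z; rewrite add0r.
  have z2 := sqr_ge0 z; have [_ h2 h3 _] := bk _ z2.
  have := ler_normD (k (z ^+ 2)) (2 * (z ^+ 2 * k1 (z ^+ 2))).
  rewrite (normrM 2) (normrM (z ^+ 2)) (ger0_norm (_ : 0 <= 2))// (ger0_norm z2).
  by have := ler_wpM2l z2 h3; lra.
have cq : a + z ^+ 2 @[z --> x] --> a + x ^+ 2.
  by apply: cvgD; [exact: cvg_cst|exact: exprn_continuous].
have ck : {for a + x ^+ 2, continuous k}.
  by apply: derivable_continuous; apply: ex_derive; exact: dk.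
apply: cvgD; first exact: (cvg_comp _ _ cq ck).
apply: cvgM; first exact: cvg_cst.
by apply: cvgM; [exact: exprn_continuous|exact: (cvg_comp _ _ cq (ck1 _ q0))].
Qed.

Lemma stein_radial1 (m s a : R) : 0 < s -> 0 <= a ->
  (\int[normal_prob m s]_x ((x - m) * (x * k (a + x ^+ 2)))%:E =
   \int[normal_prob m s]_x
      (s ^+ 2 * (k (a + x ^+ 2) + 2 * (x ^+ 2 * k1 (a + x ^+ 2))))%:E)%E.
Proof.
move=> s0 a0; have [_ _ _ bk] := kP; have K0 := radial_profile_ge0.
apply: (stein_normal m (K := 3 * K) s0) => [x||x|x].
- exact: is_derive_radial.
- exact: continuous_radial_derivative.
- rewrite normrM mulrC ler_wpM2r//.
  have [h _ _ _] := bk (a + x ^+ 2) (addr_ge0 a0 (sqr_ge0 x)).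
  by lra.
- by apply: radial_derivative_le => //; exact: sqr_ge0.
Qed.

End profile.

End SteinProduct.

Section SteinProductLaw.
Context {R : realType}.

Lemma ler_pM1D (u v : R) : 0 <= u -> 0 <= v -> u <= u * (1 + v).
Proof. by move=> u0 v0; rewrite mulrDr mulr1 lerDl mulr_ge0. Qed.

Lemma sqnorm_ge0 n (x : n.-tuple R) : 0 <= sqnorm x.
Proof. by apply: sumr_ge0 => i _; exact: sqr_ge0. Qed.

Lemma sqnorm_consp n (z : R * n.-tuple R) : sqnorm (consp z) = z.1 ^+ 2 + sqnorm z.2.
Proof.
rewrite /sqnorm big_ord_recl /consp tnth0; congr (_ + _).
by apply: eq_bigr => i _; rewrite tnthS.
Qed.

Lemma integrable_le_quadratic d (T : measurableType d) (P : probability T R)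
    (q F : T -> R) (C : R) :
  measurable_fun setT q -> (forall x, 0 <= q x) ->
  (\int[P]_x (q x)%:E < +oo)%E -> measurable_fun setT F ->
  (forall x, `|F x| <= C * (1 + q x)) ->
  P.-integrable setT (fun x => (F x)%:E).
Proof.
move=> mq q0 qfin mF FC.
have iq : P.-integrable setT (fun x => (q x)%:E).
  apply/integrableP; split; first exact/measurable_EFinP.
  by under eq_integral do rewrite abse_EFin ger0_norm//.
have i1 : P.-integrable setT (fun x => (1 : R)%:E) by exact: finite_measure_integrable_cst.
have := integrableZl measurableT C (integrableD measurableT i1 iq).
apply: le_integrable => //; first exact/measurable_EFinP.
move=> x _; rewrite /= lee_fin.
by rewrite (le_trans (FC x))// ler_norm.
Qed.

Lemma integral_probability_cst d (T : measurableType d) (P : probability T R) (c : \bar R) :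
  (\int[P]_x c = c)%E.
Proof.
transitivity (c * P setT)%E; first exact: integral_cst.
by rewrite probability_setT mule1.
Qed.

Section product.
Context d (T : measurableType d).
Variables (P : probability (measurableTypeR R) R) (Q : probability T R).
Hypothesis Pfin : (\int[P]_x (x ^+ 2)%:E < +oo)%E.
Variable q : T -> R.
Hypotheses (mq : measurable_fun setT q) (q_ge0 : forall t, 0 <= q t).
Hypothesis Qfin : (\int[Q]_t (q t)%:E < +oo)%E.

Lemma measurable_product_sqr :
  measurable_fun setT (fun z : measurableTypeR R * T => z.1 ^+ 2 + q z.2).
Proof.
apply: measurable_funD; first by apply: measurable_funX; exact: measurable_fst.
exact: measurableT_comp.
Qed.

Lemma product_sqr_lty : (\int[(P \x Q)%E]_z (z.1 ^+ 2 + q z.2)%:E < +oo)%E.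
Proof.
rewrite fubini_tonelli1//=; last 2 first.
- by apply/measurable_EFinP; exact: measurable_product_sqr.
- by move=> z; rewrite lee_fin addr_ge0 ?sqr_ge0.
rewrite (_ : (\int[P]_x _)%E = \int[P]_x ((x ^+ 2)%:E + \int[Q]_t (q t)%:E))%E.
  rewrite ge0_integralD//; last 3 first.
  - by move=> x _; rewrite lee_fin sqr_ge0.
  - exact/measurable_EFinP/measurable_funX.
  - by move=> x _; apply: integral_ge0 => t _; rewrite lee_fin.
  by rewrite integral_probability_cst lte_add_pinfty.
apply: eq_integral => x _; rewrite /fubini_F/=.
under eq_integral do rewrite EFinD.
rewrite ge0_integralD//; last 3 first.
- by move=> t _; rewrite lee_fin sqr_ge0.
- by move=> t _; rewrite lee_fin.
- exact/measurable_EFinP.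
by rewrite integral_probability_cst.
Qed.

End product.

Lemma normal_prob_sqr_lty (m s : R) : 0 < s ->
  (\int[normal_prob m s]_x (x ^+ 2)%:E < +oo)%E.
Proof.
move=> s0; have mx2 : measurable_fun setT (fun x : R => x ^+ 2) by exact: measurable_funX.
have := @integrable_quadratic_normal_prob R m s 1 _ s0 mx2.
move=> /(_ _)/integrableP[|_].
  by move=> x; rewrite mul1r ger0_norm ?sqr_ge0// lerDr.
apply: le_lt_trans; rewrite le_eqVlt; apply/orP; left; apply/eqP.
by apply: eq_integral => x _; rewrite /= ger0_norm ?sqr_ge0.
Qed.

Lemma measurable_consp_comp n (F : n.+1.-tuple R -> R) : measurable_fun setT F ->
  measurable_fun setT (fun z : measurableTypeR R * n.-tuple R => F (consp z)).
Proof. by move=> mF; apply: measurableT_comp mF _; exact: measurable_consp. Qed.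

Lemma ge0_integral_prod_lawS n (nu : nat -> probability (measurableTypeR R) R)
    (F : n.+1.-tuple R -> R) : measurable_fun setT F -> (forall x, 0 <= F x) ->
  (\int[prod_law n.+1 nu]_x (F x)%:E =
   \int[(nu 0%N \x prod_law n (fun i => nu i.+1))%E]_z (F (consp z))%:E)%E.
Proof.
move=> mF F0 /=; rewrite ge0_integral_distribution//; exact/measurable_EFinP.
Qed.

Section law.
Variable s : R.
Hypothesis s0 : 0 < s.

Lemma prod_law_sqnorm_lty n (mean : nat -> R) :
  (\int[prod_law n (fun i => normal_prob (mean i) s)]_x (sqnorm x)%:E < +oo)%E.
Proof.
elim: n mean => [|n ih] mean.
  rewrite (_ : (\int[_]_x _)%E = \int[prod_law 0 (fun i => normal_prob (mean i) s)]_x 0)%E.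
    by rewrite integral0.
  by apply: eq_integral => x _; rewrite /sqnorm big_ord0.
rewrite ge0_integral_prod_lawS//; [|exact: measurable_sqnorm|exact: sqnorm_ge0].
under eq_integral do rewrite sqnorm_consp.
apply: product_sqr_lty.
- exact: normal_prob_sqr_lty.
- exact: measurable_sqnorm.
- exact: sqnorm_ge0.
- exact: (ih (fun i => mean i.+1)).
Qed.

(** Induction on the dimension. The offset [a] holds the squares of the coordinates that are
    currently frozen, which is what lets the statement reproduce itself when one coordinate is split
    off. *)
Lemma stein_prod_law n (mean : nat -> R) (K : R) (k k1 : R -> R) (a : R) :
  radial_profile K k k1 -> 0 <= a ->
  (\int[prod_law n (fun i => normal_prob (mean i) s)]_x
     (\sum_(i < n) (tnth x i - mean i) * (tnth x i * k (a + sqnorm x)))%:E =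
   \int[prod_law n (fun i => normal_prob (mean i) s)]_x
     (s ^+ 2 * (n%:R * k (a + sqnorm x) + 2 * (sqnorm x * k1 (a + sqnorm x))))%:E)%E.
Proof.
move=> kP; have K0 := radial_profile_ge0 kP; have [_ _ [mk mk1] bk] := kP.
elim: n mean a => [|n ih] mean a a0.
  apply: eq_integral => x _; congr EFin.
  by rewrite /sqnorm !big_ord0 !mul0r mulr0 addr0 mulr0.
pose P := normal_prob (mean 0%N) s.
pose Q := prod_law n (fun i => normal_prob (mean i.+1) s).
pose r (z : measurableTypeR R * n.-tuple R) := a + (z.1 ^+ 2 + sqnorm z.2).
have mq2 := measurable_product_sqr (@measurable_sqnorm R n).
have q2fin : (\int[(P \x Q)%E]_z (z.1 ^+ 2 + sqnorm z.2)%:E < +oo)%E.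
  apply: product_sqr_lty; [exact: normal_prob_sqr_lty|exact: measurable_sqnorm|exact: sqnorm_ge0|].
  exact: (@prod_law_sqnorm_lty n (fun i => mean i.+1)).
have q2_ge0 (z : measurableTypeR R * n.-tuple R) : 0 <= z.1 ^+ 2 + sqnorm z.2.
  by rewrite addr_ge0 ?sqr_ge0 ?sqnorm_ge0.
have mr : measurable_fun setT r by apply: measurable_funD.
have mkr : measurable_fun setT (k \o r) by exact: measurableT_comp.
have mk1r : measurable_fun setT (k1 \o r) by exact: measurableT_comp.
have r_ge0 z : 0 <= r z by rewrite addr_ge0.
have mx : measurable_fun setT (fun z : measurableTypeR R * n.-tuple R => z.1).
  exact: measurable_fst.
have mt i : measurable_fun setT (fun z : measurableTypeR R * n.-tuple R => tnth z.2 i).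
  by apply: (@measurableT_comp _ _ _ _ _ _ (fun x => tnth x i)) => //; exact: measurable_tnth.
have integrable_of (F : measurableTypeR R * n.-tuple R -> R) (C : R) : measurable_fun setT F ->
    (forall z, `|F z| <= C * (1 + (z.1 ^+ 2 + sqnorm z.2))) ->
    ((P \x Q)%E).-integrable setT (fun z => (F z)%:E).
  by move=> mF FC; apply: (integrable_le_quadratic mq2 q2_ge0 q2fin mF FC).
pose A z := (z.1 - mean 0%N) * (z.1 * k (r z)).
pose B z := \sum_(i < n) (tnth z.2 i - mean i.+1) * (tnth z.2 i * k (r z)).
pose A' z := s ^+ 2 * (k (r z) + 2 * (z.1 ^+ 2 * k1 (r z))).
pose B' z := s ^+ 2 * (n%:R * k (r z) + 2 * (sqnorm z.2 * k1 (r z))).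
have mA : measurable_fun setT A.
  by apply: measurable_funM; [exact: measurable_funB|exact: measurable_funM].
have mB : measurable_fun setT B.
  apply: measurable_sum => i; apply: measurable_funM; first exact: measurable_funB.
  exact: measurable_funM.
have mA' : measurable_fun setT A'.
  apply: measurable_funM => //; apply: measurable_funD => //; apply: measurable_funM => //.
  by apply: measurable_funM => //; exact: measurable_funX.
have mB' : measurable_fun setT B'.
  apply: measurable_funM => //; apply: measurable_funD; first exact: measurable_funM.
  apply: measurable_funM => //; apply: measurable_funM => //.
  by apply: measurableT_comp; [exact: measurable_sqnorm|exact: measurable_snd].
have term_le (c x q : R) : 0 <= q -> `|(x - c) * (x * k q)| <= K * ((1 + `|c|) * (1 + x ^+ 2)).
  move=> q0; have [h _ _ _] := bk q q0.
  rewrite mulrA normrM [leRHS]mulrC; apply: ler_pM => //.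
  rewrite normrM; apply: (@le_trans _ _ ((`|x| + `|c|) * `|x|)).
    by rewrite ler_wpM2r// (le_trans (ler_normD _ _))// normrN.
  rewrite -[in leRHS](real_normK (num_real x)).
  have h1 := normr_ge0 c; have h2 := normr_ge0 x.
  have : 0 <= `|c| * (1 - `|x| + `|x| ^+ 2).
    by rewrite mulr_ge0//; have := sqr_ge0 (`|x| - 1 / 2); lra.
  by lra.
have prof_le (j q p : R) : 0 <= j -> 0 <= q -> q <= p ->
    `|s ^+ 2 * (j * k p + 2 * (q * k1 p))| <= s ^+ 2 * ((j + 2) * K).
  move=> j0 q0 qp; have p0 : 0 <= p by lra.
  have [h1 _ _ h2] := bk p p0.
  rewrite normrM (ger0_norm (sqr_ge0 _)) ler_wpM2l ?sqr_ge0//.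
  rewrite (le_trans (ler_normD _ _))// (normrM j) (normrM 2).
  rewrite (ger0_norm j0) (ger0_norm (_ : 0 <= 2))//.
  have : `|q * k1 p| <= K.
    by apply: le_trans h2; rewrite !normrM ler_wpM2r// !ger0_norm.
  by have := ler_wpM2l j0 h1; lra.
have iA : ((P \x Q)%E).-integrable setT (fun z => (A z)%:E).
  apply: (integrable_of _ (K * (1 + `|mean 0%N|))) => // z.
  apply: (le_trans (term_le _ _ _ (r_ge0 z))); rewrite mulrA ler_wpM2l//.
    by rewrite mulr_ge0 ?addr_ge0.
  by rewrite lerD2l lerDl sqnorm_ge0.
have iB : ((P \x Q)%E).-integrable setT (fun z => (B z)%:E).
  apply: (integrable_of _ (\sum_(i < n) K * (1 + `|mean i.+1|))) => // z.
  rewrite mulr_suml (le_trans (ler_norm_sum _ _ _))//; apply: ler_sum => i _.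
  apply: (le_trans (term_le _ _ _ (r_ge0 z))); rewrite mulrA ler_wpM2l//.
    by rewrite mulr_ge0 ?addr_ge0.
  rewrite lerD2l; apply: (@le_trans _ _ (sqnorm z.2)); last by rewrite lerDr sqr_ge0.
  by rewrite /sqnorm (bigD1 i)//= lerDl sumr_ge0// => j _; exact: sqr_ge0.
have iA' : ((P \x Q)%E).-integrable setT (fun z => (A' z)%:E).
  apply: (integrable_of _ (s ^+ 2 * ((1 + 2) * K))) => // z.
  rewrite /A' -[k (r z) in leLHS]mul1r; apply: (@le_trans _ _ (s ^+ 2 * ((1 + 2) * K))).
    by apply: prof_le; rewrite ?sqr_ge0// /r; have := sqnorm_ge0 z.2; lra.
  by apply: ler_pM1D; [rewrite (mulr_ge0 (sqr_ge0 _))// mulr_ge0 ?addr_ge0|exact: q2_ge0].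
have iB' : ((P \x Q)%E).-integrable setT (fun z => (B' z)%:E).
  apply: (integrable_of _ (s ^+ 2 * ((n%:R + 2) * K))) => // z.
  apply: (@le_trans _ _ (s ^+ 2 * ((n%:R + 2) * K))).
    apply: prof_le; rewrite ?sqnorm_ge0// /r; have := sqr_ge0 z.1; lra.
  by apply: ler_pM1D; [rewrite (mulr_ge0 (sqr_ge0 _))// mulr_ge0 ?addr_ge0|exact: q2_ge0].
have consE (F : n.+1.-tuple R -> R) (C : R) : measurable_fun setT F ->
    (forall x, `|F x| <= C * (1 + sqnorm x)) ->
    (\int[prod_law n.+1 (fun i => normal_prob (mean i) s)]_x (F x)%:E =
     \int[(P \x Q)%E]_z (F (consp z))%:E)%E.
  move=> mF FC /=; rewrite integral_distribution//; first exact/measurable_EFinP.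
  apply: (integrable_of _ C); first exact: measurable_consp_comp.
  by move=> z; rewrite -sqnorm_consp; exact: FC.
have mk_sq : measurable_fun setT (fun x : n.+1.-tuple R => a + sqnorm x).
  by apply: measurable_funD => //; exact: measurable_sqnorm.
have mkx : measurable_fun setT (fun x : n.+1.-tuple R => k (a + sqnorm x)).
  exact: measurableT_comp mk mk_sq.
have mk1x : measurable_fun setT (fun x : n.+1.-tuple R => k1 (a + sqnorm x)).
  exact: measurableT_comp mk1 mk_sq.
transitivity (\int[(P \x Q)%E]_z (A z + B z)%:E)%E.
  rewrite (consE _ (\sum_(i < n.+1) K * (1 + `|mean i|))).
  - apply: eq_integral => z _; congr EFin.
    rewrite big_ord_recl /= sqnorm_consp /A /B /r {1 2}/consp tnth0; congr (_ + _).
    by apply: eq_bigr => i _; rewrite /consp tnthS.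
  - apply: measurable_sum => i; apply: measurable_funM.
      by apply: measurable_funB => //; exact: measurable_tnth.
    by apply: measurable_funM => //; exact: measurable_tnth.
  - move=> x; rewrite mulr_suml (le_trans (ler_norm_sum _ _ _))//; apply: ler_sum => i _.
    apply: (le_trans (term_le _ _ _ (addr_ge0 a0 (sqnorm_ge0 x)))); rewrite mulrA ler_wpM2l//.
      by rewrite mulr_ge0 ?addr_ge0.
    rewrite lerD2l /sqnorm (bigD1 i)//= lerDl sumr_ge0// => j _; exact: sqr_ge0.
rewrite [RHS](_ : _ = \int[(P \x Q)%E]_z (A' z + B' z)%:E)%E; last first.
  rewrite (consE _ (s ^+ 2 * ((n.+1%:R + 2) * K))).
  - apply: eq_integral => z _; congr EFin.
    by rewrite sqnorm_consp /A' /B' /r -natr1; ring.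
  - apply: measurable_funM => //; apply: measurable_funD; first exact: measurable_funM.
    apply: measurable_funM => //; apply: measurable_funM => //.
    exact: measurable_sqnorm.
  - move=> x; apply: (@le_trans _ _ (s ^+ 2 * ((n.+1%:R + 2) * K))).
      by apply: prof_le; rewrite ?sqnorm_ge0 ?lerDr.
    by apply: ler_pM1D; [rewrite (mulr_ge0 (sqr_ge0 _))// mulr_ge0 ?addr_ge0|exact: sqnorm_ge0].
under eq_integral do rewrite EFinD.
under [RHS]eq_integral do rewrite EFinD.
(* Fubini in opposite orders: the term of the first coordinate is integrated over that coordinate
   innermost, by the identity in one variable; the other terms have the remaining coordinates
   innermost, by induction. *)
rewrite integralD// integralD//; congr (_ + _)%E.
  rewrite -(integral21_prod_meas1 iA) -(integral21_prod_meas1 iA'); apply: eq_integral => t _.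
  rewrite /fubini_G /A /A' /r /=.
  under eq_integral do rewrite (addrC (_ ^+ 2)) addrA.
  under [RHS]eq_integral do rewrite (addrC (_ ^+ 2)) addrA.
  by apply: (stein_radial1 kP) => //; rewrite addr_ge0 ?sqnorm_ge0.
rewrite -(integral12_prod_meas1 iB) -(integral12_prod_meas1 iB'); apply: eq_integral => x _.
rewrite /fubini_F /B /B' /r /=.
under eq_integral do rewrite addrA.
under [RHS]eq_integral do rewrite addrA.
by apply: (ih (fun i => mean i.+1)); rewrite addr_ge0 ?sqr_ge0.
Qed.

End law.

End SteinProductLaw.

(** * Perturbations with Delta > 0 *)

Section UpperBound.
Context {R : realType}.

Lemma finite_set_lt (F : set R) : finite_set F -> exists M : R, forall v, F v -> v < M.
Proof.
move=> /finite_seqP[s ->]; elim: s => [|x s [M ih]]; first by exists 0.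
exists (Num.max M (x + 1)) => v; rewrite /= in_cons => /orP[/eqP ->|vs].
  by rewrite lt_max; apply/orP; right; rewrite ltrDl.
by rewrite lt_max ih.
Qed.

(** The Caratheodory slope is continuous and keeps the sign of [a] near [x]. Multiplication by [a]
    treats both signs at once. *)
Lemma is_derive_sign (f : R -> R) (x a r : R) : is_derive x 1 f a -> a != 0 -> 0 < r ->
  exists e : R, [/\ 0 < e, e < r, 0 < a * (f (x + e) - f x) & 0 < a * (f x - f (x - e))].
Proof.
move=> /is_derive1_caratheodory[g [fg cg ga]] a0 r0.
have : \forall z \near x, 0 < a * g z.
  have : a * g z @[z --> x] --> a * g x by apply: cvgM => //; exact: cvg_cst.
  by move=> /cvgr_gt; apply; rewrite ga -expr2 exprn_even_gt0.
move=> /nbhs_ballP[r' /= r'0 hr].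
have m0 : 0 < Num.min r r' by rewrite lt_min r0.
have m1 : Num.min r r' <= r by rewrite ge_min lexx.
have m2 : Num.min r r' <= r' by rewrite ge_min lexx orbT.
exists (Num.min r r' / 2); have : 0 < Num.min r r' / 2 by rewrite divr_gt0.
have : Num.min r r' / 2 < Num.min r r' by rewrite ltr_pdivrMr//; lra.
move: (_ / 2) => e em e0; split => //; first by lra.
  have := hr (x + e); rewrite /ball/= opprD addrA subrr sub0r normrN gtr0_norm// => agz.
  rewrite fg (_ : x + e - x = e); last by lra.
  by rewrite mulrA mulr_gt0// agz//; lra.
have := hr (x - e); rewrite /ball/= opprB addrC subrK gtr0_norm// => agz.
rewrite -(opprB (f (x - e)) (f x)) fg (_ : x - e - x = - e); last by lra.
by rewrite !mulrN opprK mulrA mulr_gt0// agz//; lra.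
Qed.

Lemma limf_einf_ge0P (f : R -> R) (e : R) : 0 < e ->
  (0 <= limf_einf (fun w => (f w)%:E) +oo%R)%E -> \forall w \near +oo, - e <= f w.
Proof.
move=> e0; rewrite limf_einfE => h.
have : (- e%:E < 0 :> \bar R)%E by rewrite oppe_lt0 lte_fin.
move=> /lt_le_trans/(_ h)/ereal_sup_gt[_ [V FV <-]] hV.
apply: filterS FV => w Vw; rewrite -lee_fin EFinN (le_trans (ltW hV))//.
by apply: ereal_inf_lbound; exists w.
Qed.

Lemma limf_esup_le1P (f : R -> R) (e : R) : 0 < e ->
  (limf_esup (fun w => (f w)%:E) +oo%R <= 1)%E -> \forall w \near +oo, f w <= 1 + e.
Proof.
move=> e0; rewrite limf_esupE => h.
have : (1 < (1 + e)%:E :> \bar R)%E by rewrite lte_fin ltrDl.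
move=> /(le_lt_trans h)/ereal_inf_lt[_ [V FV <-]] hV.
apply: filterS FV => w Vw; rewrite -lee_fin (le_trans _ (ltW hV))//.
by apply: ereal_sup_ubound; exists w.
Qed.

Section regular.
Variables (phi : R -> R) (M : R).
Hypothesis M0 : 0 < M.
Hypothesis dphi : forall w : R, M <= w -> derivable phi w 1.

Lemma eventually_continuous (x : R) : M <= x -> {for x, continuous phi}.
Proof.
by move=> Mx; exact: derivable_continuous (dphi Mx).
Qed.

Lemma eventually_is_derive (w : R) : M <= w -> is_derive w 1 phi (derive1 phi w).
Proof. by move=> Mw; exact: derivable_is_derive (dphi Mw). Qed.

(** A zero of a nonnegative function is an interior minimum. This covers the points where the
    quotient w phi' / phi of (A4) is 0 by the convention on division and carries no information. *)
Lemma derive1_eq0_min0 (w : R) : M < w -> (forall v : R, 0 <= v -> 0 <= phi v) ->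
  phi w = 0 -> derive1 phi w = 0.
Proof.
move=> Mw phi_ge0 phiw; apply/eqP; case: (eqVneq (derive1 phi w) 0) => // d0.
have M_gt0 := M0; have wM0 : 0 < w - M by lra.
have [e [e0 ew]] := is_derive_sign (eventually_is_derive (ltW Mw)) d0 wM0.
have p1 : 0 <= phi (w + e) by apply: phi_ge0; lra.
have p2 : 0 <= phi (w - e) by apply: phi_ge0; lra.
rewrite phiw subr0 sub0r mulrN => h1 h2.
case: (lerP 0 (derive1 phi w)) => d; first by have := mulr_ge0 d p2; lra.
by have := mulr_le0_ge0 (ltW d) p1; lra.
Qed.

(* A minimum over [x, y] would be interior, hence a local minimum, hence part of a
   plateau reaching back below x, where phi' vanishes. *)
Lemma derive1_le0_persistent (F : set R) (x y : R) :
  (forall v, F v -> v < M) ->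
  (forall w : R, 0 <= w -> local_max phi w \/ local_min phi w ->
     exists v, [/\ F v, 0 <= v & same_plateau phi v w]) ->
  M < x -> x <= y -> derive1 phi x < 0 -> derive1 phi y <= 0.
Proof.
move=> FM FP Mx xy dx; rewrite leNgt; apply/negP => dy.
have {}xy : x < y.
  by rewrite lt_neqAle xy andbT; apply/eqP => xy'; move: dx dy; rewrite xy'; lra.
have M_gt0 := M0; have xy0 : 0 < y - x by lra.
have cphi : {within `[x, y], continuous phi}.
  apply: continuous_in_subspaceT => u /set_mem; rewrite /= in_itv/= => /andP[xu _].
  by apply: eventually_continuous; lra.
have [z /itvP zxy zmin] := EVT_min (ltW xy) cphi.
have isdx := eventually_is_derive (ltW Mx).
have isdy : is_derive y 1 phi (derive1 phi y) by apply: eventually_is_derive; exact: (le_trans (ltW Mx) (ltW xy)).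
have [e [e0 exy h1 _]] := is_derive_sign isdx (ltr0_neq0 dx) xy0.
have [e' [e'0 e'xy _ h2]] := is_derive_sign isdy (lt0r_neq0 dy) xy0.
have zx : x < z.
  rewrite lt_neqAle zxy andbT; apply/eqP => zx; have : phi z <= phi (x + e).
    by apply: zmin; rewrite in_itv/=; apply/andP; split; lra.
  by rewrite -zx -subr_ge0 => /(mulr_le0_ge0 (ltW dx)); lra.
have zy : z < y.
  rewrite lt_neqAle zxy andbT; apply/eqP => zy; have : phi z <= phi (y - e').
    by apply: zmin; rewrite in_itv/=; apply/andP; split; lra.
  by rewrite zy -subr_ge0 => /(mulr_ge0 (ltW dy)); lra.
have [v [Fv v0 plateau]] : exists v, [/\ F v, 0 <= v & same_plateau phi v z].
  apply: FP; first by lra.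
  right; near=> u => _; apply: zmin; rewrite in_itv/=; apply/andP; split; near: u.
    by apply: filterS (lt_nbhsr zx) => u /ltW.
  exact: lt_le_nbhsl.
have vM := FM v Fv.
have xz0 : 0 < Num.min (x - v) (z - x) by rewrite lt_min; apply/andP; split; lra.
have [d [d0 dxz h3 _]] := is_derive_sign isdx (ltr0_neq0 dx) xz0.
move: dxz; rewrite lt_min => /andP[dv dz].
suff [e1 e2] : phi (x + d) = phi z /\ phi x = phi z by move: h3; rewrite e1 e2 subrr mulr0 ltxx.
have vz : v <= z by lra.
by split; apply: plateau; rewrite (min_idPl vz) (max_idPr vz); apply/andP; split; lra.
Unshelve. all: by end_near. Qed.

End regular.

End UpperBound.

(** * The margin left by the upper bound on phi *)

Section Margin.
Context {R : realType}.

(** (A3) and (A4) freed of limits and quotients. The tolerance in the lower bound is left free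
    because it must be adapted to a gap between [phi] and c; in the upper bound a tolerance of 1 is
    enough, whence the factor 2. *)
Lemma PhiA_eventually p n (phi : R -> R) (e : R) : PhiA p n phi -> 0 < e ->
  exists M : R, 0 < M /\ forall w : R, M < w ->
    [/\ derivable phi w 1, {for w, continuous (derive1 phi)},
        - (e * phi w) <= w * derive1 phi w & w * derive1 phi w <= 2 * phi w].
Proof.
move=> [_ [_ phi_ge0] _ [/finite_set_lt[M0 discM] _] [A1 A2]] e0.
have [M1 [_ hM1]] := limf_einf_ge0P e0 A1.
have [M2 [_ hM2]] := limf_esup_le1P (ltr01 : 0 < 1 :> R) A2.
pose M := Num.max (Num.max M0 1) (Num.max M1 M2).
have [MM0 M_1 MM1 MM2] : [/\ M0 <= M, 1 <= M, M1 <= M & M2 <= M].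
  by split; rewrite /M !le_max lexx ?orbT.
have reg (w : R) : M <= w -> derivable phi w 1 /\ {for w, continuous (derive1 phi)}.
  move=> Mw; apply: contrapT => nreg; suff : w < M0 by lra.
  by apply: discM; split => //; lra.
have M_gt0 : 0 < M by lra.
exists M; split => // w Mw; have [dw cw] := reg w (ltW Mw).
have w0 : 0 < w by lra.
split => //.
  case: (eqVneq (phi w) 0) => [p0|p0].
    rewrite (derive1_eq0_min0 M_gt0 (fun u hu => (reg u hu).1) Mw phi_ge0 p0).
    by rewrite p0 !mulr0 oppr0.
  have {}p0 : 0 < phi w by rewrite lt_neqAle eq_sym p0 phi_ge0// ltW.
  have := hM1 w; rewrite ler_pdivlMr// mulNr; apply; lra.
case: (eqVneq (phi w) 0) => [p0|p0].
  rewrite (derive1_eq0_min0 M_gt0 (fun u hu => (reg u hu).1) Mw phi_ge0 p0).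
  by rewrite p0 !mulr0.
have {}p0 : 0 < phi w by rewrite lt_neqAle eq_sym p0 phi_ge0// ltW.
have := hM2 w; rewrite ler_pdivrMr// (_ : 1 + 1 = 2); first apply; lra.
Qed.

(* If phi' < 0 somewhere far out then phi decreases from there on, so phi stays a
   fixed amount below c, which absorbs the vanishing term w phi'(w). *)
Lemma upper_bound_margin p n (phi : R -> R) (b wstar : R) : (3 <= p)%N ->
  PhiA p n phi -> 1 < wstar -> 1 < b ->
  (forall w : R, wstar <= w -> phi w <= cst_c p n - b * (beta_star p n / ln w)) ->
  exists w0 : R, [/\ 1 < w0, 1 <= ln w0 & forall w : R, w0 <= w ->
    [/\ derivable phi w 1, {for w, continuous (derive1 phi)},
        `|w * derive1 phi w| <= 2 * phi w, phi w <= cst_c p n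
      & 2 * (b * (beta_star p n / ln w)) <=
        2 * (cst_c p n - phi w) + cst_d n * (w * derive1 phi w)]].
Proof.
move=> p3 phiA wstar1 b1 phi_ub.
have c0 : 0 < cst_c p n :> R by exact: cst_c_gt0.
have d0 : 0 < cst_d n :> R by exact: cst_d_gt0.
have bb0 : 0 < b * beta_star p n :> R.
  rewrite beta_starE mulr_gt0 ?divr_gt0 ?mulr_gt0//; first by lra.
  by rewrite addr_gt0.
have [_ [_ phi_ge0] [F /finite_set_lt[MF FM] FP] _ _] := phiA.
have [M1 [M1_gt0 hM1]] := PhiA_eventually phiA (ltr01 : 0 < 1 :> R).
pose M := Num.max (Num.max MF M1) (Num.max (expR 1) wstar) + 1.
have [MMF MM1 MMe MMs] : [/\ MF < M, M1 < M, expR 1 <= M & wstar <= M].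
  have [a1 a2 a3 a4] : [/\ MF <= M - 1, M1 <= M - 1, expR 1 <= M - 1 & wstar <= M - 1].
    by split; rewrite /M addrK !le_max lexx ?orbT.
  by split; lra.
have ln_ge1 (w : R) : M <= w -> 1 <= ln w.
  move=> Mw; rewrite -[leLHS](expRK 1) ler_ln ?posrE ?expR_gt0//; lra.
have phi_lt (w : R) : M <= w -> phi w <= cst_c p n.
  move=> Mw; apply: (le_trans (phi_ub w _)); first by lra.
  by rewrite gerBl mulrA divr_ge0 ?ltW//; have := ln_ge1 w Mw; lra.
have reg (w : R) : M <= w -> derivable phi w 1.
  by move=> Mw; have [//|//] := hM1 w _; lra.
have M_gt0 : 0 < M by lra.
have absd (w : R) : M <= w -> `|w * derive1 phi w| <= 2 * phi w.
  move=> Mw; have [|_ _ l u] := hM1 w; first by lra.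
  by rewrite ler_norml u andbT; have := phi_ge0 w; lra.
case: (pselect (exists x : R, M < x /\ derive1 phi x < 0)) => [[x [Mx dx]]|npos].
  have dle (y : R) : x <= y -> derive1 phi y <= 0.
    move=> xy; apply: (derive1_le0_persistent M_gt0 reg _ FP Mx xy dx).
    by move=> v /FM; lra.
  have mono (y : R) : x <= y -> phi y <= phi x.
    move=> xy; apply: (@ler0_derive1_nincry R phi x) => // z.
    - by rewrite in_itv/= andbT => xz; apply: reg; lra.
    - by rewrite in_itv/= andbT => xz; apply: dle; lra.
    apply: continuous_in_subspaceT => u /set_mem; rewrite /= in_itv/= andbT => xu.
    by apply: (eventually_continuous reg); lra.
  pose k := b * beta_star p n / ln x.
  have lx := ln_ge1 x (ltW Mx).
  have k0 : 0 < k by rewrite divr_gt0//; lra.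
  (* With this tolerance and phi <= c, the term d w phi' is at least - k, where [k] bounds the gap c
     - phi from below beyond [x]. *)
  have e0 : 0 < k / (cst_d n * cst_c p n) by rewrite divr_gt0// mulr_gt0.
  have [M2 [M2_gt0 hM2]] := PhiA_eventually phiA e0.
  (* From x^2 on, ln w >= 2 ln x, so the required margin 2 b beta_star / ln w is at most k; 2 (c -
     phi) supplies 2 k, of which d w phi' takes at most k. *)
  pose w0 := Num.max (M2 + 1) (x ^+ 2).
  have [w01 w02] : M2 + 1 <= w0 /\ x ^+ 2 <= w0 by rewrite /w0 !le_max !lexx orbT.
  have x1 : 1 < x by lra.
  have xx : x <= x ^+ 2 by rewrite expr2 ler_peMr//; lra.
  exists w0; split => [||w w0w]; first by lra.
    by apply: ln_ge1; lra.
  have [|dw cw l u] := hM2 w; first by lra.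
  split => //; [by apply: absd; lra|by apply: phi_lt; lra|].
  have lw : 2 * ln x <= ln w.
    by rewrite mulr_natl -lnXn ?ler_ln ?posrE; lra.
  have : 2 * (b * (beta_star p n / ln w)) <= k.
    rewrite mulrA mulrA /k ler_pdivrMr; last by lra.
    rewrite [leRHS]mulrAC ler_pdivlMr; last by lra.
    by have := ler_wpM2l (ltW bb0) lw; lra.
  have : k <= cst_c p n - phi w.
    have := phi_ub x; have := mono w; rewrite /k -mulrA; lra.
  have : - k <= cst_d n * (w * derive1 phi w).
    apply: (@le_trans _ _ (cst_d n * - (k / (cst_d n * cst_c p n) * phi w))); last first.
      by rewrite ler_wpM2l// ltW.
    rewrite mulrN lerN2 [leLHS](_ : _ = k * (phi w / cst_c p n)); last first.
      have cancel (u1 v k' y : R) : u1 != 0 -> v != 0 -> u1 * (k' / (u1 * v) * y) = k' * (y / v).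
        by move=> u0 v0; field; rewrite u0 v0.
      by apply: cancel; exact: lt0r_neq0.
    by rewrite ler_piMr ?(ltW k0)// ler_pdivrMr// mul1r phi_lt//; lra.
  by lra.
exists (M + 1); split => [||w Mw]; first by lra.
  by apply: ln_ge1; lra.
have [|dw cw l u] := hM1 w; first by lra.
split => //; [by apply: absd; lra|by apply: phi_lt; lra|].
have d' : 0 <= derive1 phi w.
  by rewrite leNgt; apply/negP => d'; apply: npos; exists w; split => //; lra.
have : 0 <= cst_d n * (w * derive1 phi w) by rewrite !mulr_ge0// ?ltW//; lra.
have := phi_ub w; lra.
Qed.

End Margin.

(** * The logarithmic perturbation and the profiles it yields *)

Section Perturbation.
Context {R : realType}.

(** Squaring the positive part is what makes the perturbation continuously differentiable at
    [w0]. *)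
Lemma is_derive_sqr_max0 (x : R) :
  is_derive x 1 (fun z : R => Num.max 0 z ^+ 2) (2 * Num.max 0 x).
Proof.
case: (ltgtP x 0) => [x0|x0|->].
- rewrite mulr0; apply: (@near_eq_is_derive _ _ _ (cst (0 : R))).
  by near=> z; rewrite (max_idPl _) ?expr0n//; near: z; exact: lt_le_nbhsl.
- apply: (@near_eq_is_derive _ _ _ (fun z : R => z ^+ 2)).
    near=> z; rewrite (max_idPr _)//; near: z.
    by apply: filterS (lt_nbhsr x0) => z /ltW.
  by apply: is_derive_eq; rewrite /GRing.scale/=; ring.
rewrite mulr0; apply/is_derive1_caratheodory.
exists (fun z : R => Num.max 0 z); split.
- move=> z; rewrite maxxx expr0n/= !subr0 expr2.
  by case: (leP 0 z) => // z0; rewrite !mul0r.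
- by apply: continuous_max; [exact: cvg_cst|exact: cvg_id].
- by rewrite maxxx.
Unshelve. all: by end_near. Qed.

(* The perturbation is g w = e ((1 - w0 / w)^+)^2 / ln w; below, r stands for
   (1 - w0 / w)^+, so that w r' = 1 - r. *)
Lemma log_perturbation (w0 e : R) : 1 < w0 -> 1 <= ln w0 -> 0 < e ->
  exists g g1 : R -> R, [/\ forall w : R, is_derive w 1 g (g1 w), continuous g1,
    forall w : R, w <= w0 -> g w = 0 /\ g1 w = 0 &
    forall w : R, w0 < w ->
      [/\ 0 < g w, g w <= e / ln w, - (g w / ln w) <= w * g1 w & `|w * g1 w| <= 3 * e]].
Proof.
move=> w01 lw0 e0.
pose m (w : R) := Num.max 0 (w - w0).
pose v (w : R) := w ^+ 2 * ln w.
pose v1 (w : R) := 2 * w * ln w + w.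
(* The factor 1 / w^2 is merged with 1 / ln w, so that differentiation needs one inverse only; [v]
   is positive from [w0] on, and to the left [m] vanishes. *)
pose g (w : R) := e * (m w ^+ 2 * (v w)^-1).
pose g1 (w : R) := e * (2 * m w * (v w)^-1 - m w ^+ 2 * (v1 w * (v w ^+ 2)^-1)).
have m0 (w : R) : w <= w0 -> m w = 0 by move=> ww0; rewrite /m (max_idPl _)// subr_le0.
have lnw (w : R) : w0 <= w -> 1 <= ln w.
  by move=> w0w; rewrite (le_trans lw0)// ler_ln ?posrE; lra.
have v0 (w : R) : w0 <= w -> 0 < v w.
  by move=> w0w; have := lnw w w0w => ?; rewrite mulr_gt0 ?exprn_gt0//; lra.
have gE0 (w : R) : w <= w0 -> g w = 0.
  by move=> /m0 mw; rewrite /g mw expr0n mul0r mulr0.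
have g1E0 (w : R) : w <= w0 -> g1 w = 0.
  by move=> /m0 mw; rewrite /g1 mw expr0n !(mul0r, mulr0) subr0 mulr0.
have dm (w : R) : is_derive w 1 (fun z => m z ^+ 2) (2 * m w).
  have hw : is_derive w 1 (fun z : R => z - w0) 1.
    by apply: is_derive_eq; rewrite subr0.
  have := @is_derive1_comp R (fun z => Num.max 0 z ^+ 2) (fun z : R => z - w0) w _ _
    (is_derive_sqr_max0 _) hw.
  by rewrite mulr1.
have dv (w : R) : w0 <= w -> is_derive w 1 v (v1 w).
  move=> w0w; have wp : 0 < w by lra.
  have := is_derive1_ln wp => dln.
  rewrite /v; apply: is_derive_eq.
  by rewrite /GRing.scale/= /v1; field; lra.
have dg (w : R) : is_derive w 1 g (g1 w).
  case: (ltP w w0) => w0w.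
    rewrite g1E0 ?ltW//; apply: (@near_eq_is_derive _ _ _ (cst (0 : R))).
    by near=> z; rewrite gE0//; near: z; exact: lt_le_nbhsl.
  have vw := v0 w w0w.
  have dV := is_deriveV (f := v) (lt0r_neq0 vw) (dv w w0w).
  apply: (is_derive_eq (is_deriveZ e (is_deriveM (dm w) dV))).
  by rewrite /GRing.scale/= /g1; field; lra.
have cm : continuous m.
  move=> w; apply: (@continuous_max _ _ (cst 0) (fun z => z - w0)); first exact: cvg_cst.
  by apply: cvgB; [exact: cvg_id|exact: cvg_cst].
have cg1 : continuous g1.
  move=> w; case: (ltP w w0) => w0w.
    rewrite /continuous_at g1E0 ?ltW//; apply: cvg_near_cst.
    by near=> z; rewrite g1E0//; near: z; exact: lt_le_nbhsl.
  have wp := lt_le_trans (lt_trans ltr01 w01) w0w.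
  have vw := v0 w w0w; have cl := continuous_ln wp.
  have cv : v z @[z --> w] --> v w by apply: cvgM => //; exact: exprn_continuous.
  have cv1 : v1 z @[z --> w] --> v1 w.
    apply: cvgD; last exact: cvg_id.
    by apply: cvgM => //; apply: cvgM; [exact: cvg_cst|exact: cvg_id].
  apply: cvgM; first exact: cvg_cst.
  apply: cvgB.
    apply: cvgM; first by apply: cvgM; [exact: cvg_cst|exact: cm].
    by apply: cvgV => //; rewrite gt_eqF.
  apply: cvgM; first by rewrite expr2; apply: cvgM; exact: cm.
  apply: cvgM => //; apply: cvgV; first by rewrite expf_neq0 ?gt_eqF.
  by rewrite expr2; apply: cvgM.
exists g, g1; split => // [w w0w|w w0w]; first by rewrite gE0 ?g1E0.
have lw := lnw w (ltW w0w); have vw := v0 w (ltW w0w).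
pose l := (ln w)^-1.
have [l0 l1] : 0 < l /\ l <= 1 by rewrite /l invr_gt0 invf_le1; lra.
pose r := (w - w0) / w.
have [r0 r1] : 0 < r /\ r < 1.
  by split; rewrite /r ?divr_gt0 ?ltr_pdivrMr//; lra.
have gE : g w = e * r ^+ 2 * l.
  by rewrite /g /m (max_idPr _) /v /r /l; [field|]; lra.
have g1E : w * g1 w = e * (2 * r * (1 - r) * l - r ^+ 2 * l ^+ 2).
  by rewrite /g1 /m (max_idPr _) /v /v1 /r /l; [field; rewrite !gt_eqF|]; lra.
have r2 : r ^+ 2 <= 1 by rewrite expr_le1//; lra.
have rl : 0 <= 2 * r * (1 - r) * l.
  by rewrite (mulr_ge0 _ (ltW l0))// mulr_ge0//; [rewrite mulr_ge0 ?(ltW r0)|rewrite subr_ge0 ltW].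
split.
- by rewrite gE (mulr_gt0 _ l0)// (mulr_gt0 e0)// exprn_gt0.
- by rewrite gE -/l ler_wpM2r ?(ltW l0)// -[leRHS]mulr1 ler_wpM2l ?(ltW e0).
- by rewrite gE g1E -/l; have := mulr_ge0 (ltW e0) rl; lra.
rewrite g1E normrM (gtr0_norm e0) mulrC ler_wpM2r ?(ltW e0)//.
have : 0 <= r ^+ 2 * l ^+ 2 <= 1.
  by rewrite mulr_ge0 ?sqr_ge0//= mulr_ile1 ?sqr_ge0// expr_le1//; lra.
have : 2 * r * (1 - r) * l <= 2.
  rewrite -[leRHS]mulr1 ler_pM//; try lra; first by have := rl; rewrite pmulr_lge0.
  by have := sqr_ge0 (r - 1); lra.
by rewrite ler_norml => ? /andP[? ?]; lra.
Unshelve. all: by end_near. Qed.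

End Perturbation.

Section TailProfile.
Context {R : realType}.

Lemma measurable_inv : measurable_fun setT (fun x : R => x^-1).
Proof.
have m0 : measurable [set (0 : R)] by exact: measurable_set1.
rewrite -(setUv [set (0 : R)]); apply/measurable_funU => //; first exact: measurableC.
split; first exact: measurable_fun_set1.
apply: open_continuous_measurable_fun; first by apply: closed_openC; exact: closed_eq.
by move=> x /set_mem/eqP x0; exact: inv_continuous.
Qed.

(* The functions k of W for which Stein's identity applies both to the normal
   variables in X, where W = q / s, and to those in S, where W = a / (t q). *)
Definition tail_profile (C w0 : R) (k k1 : R -> R) :=
  [/\ 1 < w0, 0 <= C, forall w : R, is_derive w 1 k (k1 w), continuous k1 &
    forall w : R, (w <= w0 -> k w = 0 /\ k1 w = 0) /\
      (w0 < w -> `|k w| * w <= C /\ `|w * k1 w| * w <= C)].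

Section profile.
Variables (C w0 : R) (k k1 : R -> R).
Hypothesis kP : tail_profile C w0 k k1.

Lemma tail_profile_continuous : continuous k.
Proof.
by have [_ _ dk _ _] := kP; exact: is_derive_continuous dk.
Qed.

Lemma tail_profile_measurable : measurable_fun setT k /\ measurable_fun setT k1.
Proof.
by split; apply: continuous_measurable_fun; [exact: tail_profile_continuous|case: kP].
Qed.

Lemma tail_profile_le (w : R) :
  [/\ `|k w| <= C, `|k1 w| <= C & `|w * k1 w| <= C].
Proof.
have [w01 C0 _ _ /(_ w)[small large]] := kP.
case: (leP w w0) => [/small[-> ->]|ww0]; first by rewrite mulr0 normr0.
have [h1 h2] := large ww0.
have a0 := normr_ge0 (k w); have b0 := normr_ge0 (w * k1 w).
have hb : `|w * k1 w| <= C by apply: le_trans h2; rewrite ler_peMr//; lra.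
split => //; first by apply: le_trans h1; rewrite ler_peMr//; lra.
by apply: le_trans hb; rewrite normrM ler_peMl// ger0_norm; lra.
Qed.

Lemma tail_profile_le_linear (w : R) : 0 <= w -> `|k w| <= C * w.
Proof.
have [w01 C0 _ _ /(_ w)[small _]] := kP => w_ge0.
case: (leP w w0) => [/small[-> _]|ww0]; first by rewrite normr0 mulr_ge0.
by have [h _ _] := tail_profile_le w; rewrite (le_trans h)// ler_peMr//; lra.
Qed.

Lemma tail_profile_decay (w : R) : 0 <= w -> `|k w| * w <= C /\ `|w * k1 w| * w <= C.
Proof.
have [w01 C0 _ _ /(_ w)[small large]] := kP => w_ge0.
by case: (leP w w0) => [/small[-> ->]|/large//]; rewrite mulr0 normr0 mul0r.
Qed.

Lemma radial_profile_scale (s : R) : 0 < s ->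
  radial_profile (C + C / s) (fun q => k (q / s)) (fun q => k1 (q / s) / s).
Proof.
move=> s0; have [w01 C0 dk ck1 _] := kP; have [mk mk1] := tail_profile_measurable.
have Cs : 0 <= C / s by rewrite divr_ge0// ltW.
have mq : measurable_fun setT (fun q : R => q / s) by exact: measurable_funM.
split.
- move=> q q0; have hq : is_derive q 1 (fun z : R => z / s) (s^-1).
    by apply: is_derive_eq; rewrite /GRing.scale/=; lra.
  exact: (@is_derive1_comp R k (fun z => z / s) q _ _ (dk _) hq).
- move=> q q0; apply: cvgM; last exact: cvg_cst.
  apply: (@continuous_comp R R R (fun z => z / s) k1); last exact: ck1.
  by apply: cvgM; [exact: cvg_id|exact: cvg_cst].
- split; first exact: measurableT_comp.
  by apply: measurable_funM => //; exact: measurableT_comp.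
move=> q q0; have qs : 0 <= q / s by rewrite divr_ge0// ltW.
have [h1 h2 h3] := tail_profile_le (q / s); split.
- by lra.
- apply: (le_trans (tail_profile_le_linear qs)).
  by have := mulr_ge0 C0 q0; lra.
- have : `|k1 (q / s) / s| <= C / s.
    by rewrite normrM (@gtr0_norm _ s^-1) ?invr_gt0// ler_wpM2r// invr_ge0 ltW.
  by lra.
by rewrite (_ : q * _ = q / s * k1 (q / s)); [lra|ring].
Qed.

(** For fixed X the behaviour in q = 0 is that of [k] at infinity: the decay of [k] and of w k1 like
    1 / w becomes the linear bound in q. If a = 0, the argument stays at 0, below [w0], and
    everything vanishes. *)
Lemma radial_profile_inv (a t : R) : 0 <= a -> 0 < t ->
  radial_profile (C + C * (t / a)) (fun q => k (a / (t * q)))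
    (fun q => - (k1 (a / (t * q)) * (a / (t * q ^+ 2)))).
Proof.
move=> a0 t0; have [w01 C0 dk ck1 kE] := kP; have [mk mk1] := tail_profile_measurable.
have Ct : 0 <= C * (t / a) by rewrite mulr_ge0// divr_ge0// ltW.
have mq : measurable_fun setT (fun q : R => a / (t * q)).
  apply: measurable_funM => //; apply: (measurableT_comp measurable_inv).
  exact: measurable_funM.
have dq (q : R) : 0 < q -> is_derive q 1 (fun z : R => a / (t * z)) (- (a / (t * q ^+ 2))).
  move=> q0; have tq : t * q != 0 by rewrite mulf_neq0 ?gt_eqF.
  have h : is_derive q 1 (fun z : R => t * z) t.
    by apply: is_derive_eq; rewrite /GRing.scale/=; lra.
  apply: (is_derive_eq (is_deriveZ a (is_deriveV (f := fun z : R => t * z) tq h))).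
  by rewrite /GRing.scale/=; field; rewrite !gt_eqF.
split.
- move=> q q0; have := @is_derive1_comp R k (fun z => a / (t * z)) q _ _ (dk _) (dq q q0).
  by rewrite mulrN.
- move=> q q0; apply: cvgN; apply: cvgM.
    apply: (@continuous_comp R R R (fun z => a / (t * z)) k1); last exact: ck1.
    by apply: derivable_continuous; apply: ex_derive; exact: dq.
  apply: cvgM; first exact: cvg_cst.
  apply: cvgV; first by rewrite mulf_neq0 ?expf_neq0 ?gt_eqF.
  by apply: cvgM; [exact: cvg_cst|exact: exprn_continuous].
- split; first exact: measurableT_comp.
  apply: measurableT_comp => //; apply: measurable_funM; first exact: measurableT_comp.
  apply: measurable_funM => //; apply: (measurableT_comp measurable_inv).
  by apply: measurable_funM => //; exact: measurable_funX.
(* At q = 0 division by zero returns 0, so the profile is evaluated at 0, where it vanishes. *)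
move=> q; rewrite le_eqVlt => /predU1P[<-|q0].
  rewrite !mulr0 invr0 !mulr0; have [-> ->] : k 0 = 0 /\ k1 0 = 0 by apply: (kE 0).1; lra.
  by rewrite !mul0r oppr0 normr0; split => //; lra.
set w := a / (t * q).
have w_ge0 : 0 <= w by rewrite divr_ge0// mulr_ge0 ?ltW.
have [h1 h2 h3] := tail_profile_le w.
rewrite (_ : k1 w * _ = w * k1 w / q); last first.
  by rewrite /w; field; rewrite !gt_eqF.
have [|a_neq0] := eqVneq a 0.
  move=> az; have [-> ->] : k w = 0 /\ k1 w = 0.
    by apply: (kE w).1; rewrite /w az mul0r; lra.
  by rewrite !(mulr0, mul0r) oppr0 mulr0 normr0; split; rewrite ?mulr_ge0 ?addr_ge0 ?(ltW q0).
have {a_neq0}a0 : 0 < a by rewrite lt_neqAle eq_sym a_neq0.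
have wq : w^-1 = t / a * q by rewrite /w invf_div; ring.
have w0' : 0 < w by rewrite divr_gt0// mulr_gt0.
have [e1 e2] := tail_profile_decay w_ge0.
have {}e1 : `|k w| <= C * (t / a) * q.
  by rewrite -mulrA -wq ler_pdivlMr.
have {}e2 : `|w * k1 w| <= C * (t / a) * q.
  by rewrite -mulrA -wq ler_pdivlMr.
rewrite normrN; split; first by lra.
- by have := mulr_ge0 C0 (ltW q0); lra.
- by rewrite normrM (@gtr0_norm _ q^-1) ?invr_gt0// ler_pdivrMr//; have := mulr_ge0 C0 (ltW q0); lra.
by rewrite mulrN mulrCA mulfV ?gt_eqF// mulr1 normrN; lra.
Qed.

End profile.

End TailProfile.

Section Dominance.
Context {R : realType}.

Lemma tail_profileI (C w0 : R) (k k1 : R -> R) : 1 < w0 -> 0 <= C ->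
  (forall w : R, w <= w0 -> k w = 0 /\ k1 w = 0) ->
  (forall w : R, w0 <= w -> is_derive w 1 k (k1 w) /\ {for w, continuous k1}) ->
  (forall w : R, w0 < w -> `|k w| * w <= C /\ `|w * k1 w| * w <= C) ->
  tail_profile C w0 k k1.
Proof.
move=> w01 C0 k0 kd kC; split => // w; case: (ltP w w0) => ww0; try by case: (kd w ww0).
- rewrite (k0 w (ltW ww0)).2; apply: (@near_eq_is_derive _ _ _ (cst (0 : R))).
  by near=> z; rewrite (k0 z _).1//; near: z; exact: lt_le_nbhsl.
- rewrite /continuous_at (k0 w (ltW ww0)).2; apply: cvg_near_cst.
  by near=> z; rewrite (k0 z _).2//; near: z; exact: lt_le_nbhsl.
- by split => [|?]; [exact: k0|apply: kC].
- by split => [|?]; [exact: k0|apply: kC].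
Unshelve. all: by end_near. Qed.

Lemma normr_divrK (a w : R) : 0 < w -> `|a / w| * w = `|a|.
Proof. by move=> w0; rewrite normrM normfV (gtr0_norm w0) divfK ?gt_eqF. Qed.

Section profiles.
Variables (w0 c e : R) (phi g g1 : R -> R).
Hypotheses (w01 : 1 < w0) (c_gt0 : 0 < c) (e_gt0 : 0 < e).
Hypothesis phi_reg : forall w : R, w0 <= w ->
  [/\ derivable phi w 1, {for w, continuous (derive1 phi)},
      `|w * derive1 phi w| <= 2 * phi w & phi w <= c].
Hypothesis dg : forall w : R, is_derive w 1 g (g1 w).
Hypothesis cg1 : continuous g1.
Hypothesis g0 : forall w : R, w <= w0 -> g w = 0 /\ g1 w = 0.
Hypothesis gw : forall w : R, w0 < w -> [/\ 0 < g w, g w <= e & `|w * g1 w| <= 3 * e].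

Let cg : continuous g.
Proof. exact: is_derive_continuous dg. Qed.

(** Since [delta] for [phi] minus [delta] for [phi + g] is (g / W) X, the difference of squared
    errors is 2 X.(X - theta) [linear_part] - S [square_part], both taken at W. Stein's identity is
    applied to these two weights, in X and in S respectively. *)
Definition linear_part (w : R) := g w / w.
Definition linear_part1 (w : R) := (g1 w - g w / w) / w.
Definition square_part (w : R) := g w * (2 * phi w + g w) / w.
Definition square_part1 (w : R) :=
  (2 * (derive1 phi w * g w + phi w * g1 w + g w * g1 w) - square_part w) / w.

Lemma tail_profile_linear_part : tail_profile (4 * e) w0 linear_part linear_part1.
Proof.
apply: tail_profileI => //; first by rewrite mulr_ge0// ltW.
- by move=> w /g0[e1 e2]; rewrite /linear_part /linear_part1 e1 e2 !mul0r subrr mul0r.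
- move=> w w0w; have w_gt0 : 0 < w by have := w01; lra.
  split; last first.
    have cV : z^-1 @[z --> w] --> w^-1 by apply: inv_continuous; rewrite gt_eqF.
    apply: cvgM => //; apply: cvgB; first exact: cg1.
    by apply: cvgM => //; exact: cg.
  have hV := is_deriveV (f := id) (lt0r_neq0 w_gt0) (is_derive_id w 1).
  apply: (is_derive_eq (is_deriveM (dg w) hV)).
  by rewrite /GRing.scale/= /linear_part1; field; rewrite gt_eqF.
- move=> w w0w; have [h1 h2 h3] := gw w0w; have w_gt0 : 0 < w by have := w01; lra.
  have e0 := e_gt0; split; first by rewrite normr_divrK// gtr0_norm//; lra.
  rewrite /linear_part1 mulrCA mulfV ?gt_eqF// mulr1.
  rewrite (_ : g1 w - g w / w = (w * g1 w - g w) / w); last by field; rewrite gt_eqF.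
  by rewrite normr_divrK// (le_trans (ler_normB _ _))// (gtr0_norm h1); lra.
Qed.

Lemma tail_profile_square_part : (forall w : R, 0 <= w -> 0 <= phi w) ->
  exists C : R, tail_profile C w0 square_part square_part1.
Proof.
move=> phi_ge0; have e0 := e_gt0; have c0 := c_gt0.
exists (12 * (c * e) + 7 * e ^+ 2); apply: tail_profileI => //.
- by rewrite addr_ge0 ?mulr_ge0 ?sqr_ge0// ltW.
- move=> w /g0[e1 e2]; rewrite /square_part1 /square_part e1 e2.
  by rewrite !(mul0r, mulr0, addr0, subr0).
- move=> w w0w; have w_gt0 : 0 < w by have := w01; lra.
  have [dphi cdphi _ _] := phi_reg w0w.
  have cV : z^-1 @[z --> w] --> w^-1 by apply: inv_continuous; rewrite gt_eqF.
  have isdphi := derivable_is_derive dphi; have cphi := derivable_continuous dphi.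
  have csq : {for w, continuous (fun z => g z * (2 * phi z + g z) / z)}.
    apply: cvgM => //; apply: cvgM; first exact: cg.
    by apply: cvgD; [apply: cvgM => //; exact: cvg_cst|exact: cg].
  split; last first.
    apply: cvgM => //; apply: cvgB => //; apply: cvgM; first exact: cvg_cst.
    by apply: cvgD; [apply: cvgD|]; apply: cvgM => //; [exact: cg|exact: cg1|exact: cg|exact: cg1].
  have hV := is_deriveV (f := id) (lt0r_neq0 w_gt0) (is_derive_id w 1).
  have hs := is_deriveD (is_deriveZ 2 isdphi) (dg w).
  apply: (is_derive_eq (is_deriveM (is_deriveM (dg w) hs) hV)).
  rewrite /GRing.scale/= /square_part1 /square_part.
  rewrite (_ : (_ * _) w = g w * (2 * phi w + g w))// (_ : (_ + _) w = 2 * phi w + g w)//.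
  by field; rewrite gt_eqF.
- move=> w w0w; have [h1 h2 h3] := gw w0w; have w_gt0 : 0 < w by have := w01; lra.
  have [_ _ hd hc] := phi_reg (ltW w0w); have p0 := phi_ge0 w (ltW w_gt0).
  have gp : g w * phi w <= c * e by rewrite mulrC ler_pM ?(ltW h1).
  have gp0 : 0 <= g w * phi w by rewrite mulr_ge0 ?(ltW h1).
  have gg : g w ^+ 2 <= e ^+ 2 by rewrite ler_sqr ?nnegrE ?(ltW h1) ?(ltW e0).
  have ce0 : 0 <= c * e by rewrite mulr_ge0// ltW.
  have sq : `|g w * (2 * phi w + g w)| <= 2 * (c * e) + e ^+ 2.
    by rewrite ger0_norm ?mulr_ge0 ?addr_ge0 ?mulr_ge0 ?(ltW h1)//; lra.
  split; first by rewrite normr_divrK//; have := sqr_ge0 e; lra.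
  rewrite /square_part1 mulrCA mulfV ?gt_eqF// mulr1 -(normr_divrK _ w_gt0).
  set u := w * derive1 phi w in hd; set v := w * g1 w in h3.
  (* The available bounds concern w phi' and w g', so the numerator is rewritten in these products
     over w; the spare factor w cancels the denominator. *)
  rewrite normr_divrK// (_ : _ - _ =
    (2 * (u * g w + phi w * v + g w * v) - g w * (2 * phi w + g w)) / w); last first.
    by rewrite /u /v /square_part; field; rewrite gt_eqF.
  rewrite normr_divrK// (le_trans (ler_normB _ _))// normrM (ger0_norm (_ : 0 <= 2))//.
  have h4 : `|u * g w| <= 2 * (c * e).
    rewrite normrM (gtr0_norm h1) (le_trans (ler_wpM2r (ltW h1) hd))//; lra.
  have h5 : `|phi w * v| <= 3 * (c * e).
    rewrite normrM (ger0_norm p0) (le_trans (ler_wpM2l p0 h3))//.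
    by have := ler_wpM2r (ltW e0) hc; lra.
  have h6 : `|g w * v| <= 3 * e ^+ 2.
    rewrite normrM (gtr0_norm h1) (le_trans (ler_wpM2l (ltW h1) h3))//.
    by have := ler_wpM2r (ltW e0) h2; lra.
  have := ler_normD (u * g w + phi w * v) (g w * v).
  have := ler_normD (u * g w) (phi w * v).
  by lra.
Qed.

End profiles.

End Dominance.

(** * Positivity of Delta for the perturbation *)

Section DeltaPositive.
Context {R : realType}.

(** With l = 1 / ln w, the product w Delta is at least g l (2 b beta_star - e - d e - d (1 + c)).
    Here d (1 + c) = 2 beta_star, and the choice of [e] spends half of the excess 2 (b - 1)
    beta_star. *)
Lemma Delta_gt0 p n (phi g g1 : R -> R) (b e w : R) : 1 < w -> 1 <= ln w -> 1 < b ->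
  0 < e -> e * (1 + cst_d n) = (b - 1) * beta_star p n ->
  derivable phi w 1 -> is_derive w 1 g (g1 w) -> 0 <= phi w <= cst_c p n ->
  2 * (b * (beta_star p n / ln w)) <=
    2 * (cst_c p n - phi w) + cst_d n * (w * derive1 phi w) ->
  0 < g w -> g w <= e / ln w -> - (g w / ln w) <= w * g1 w ->
  0 < Delta p n phi g w.
Proof.
move=> w1 lw b1 e0 eE dphi dg /andP[p0 pc] margin g0 ge ugl.
have w0 : 0 < w by lra.
have d0 : 0 < cst_d n :> R by exact: cst_d_gt0.
have betaE := beta_starE p n : beta_star p n = _ :> R.
have gdrv : derive1 g w = g1 w by rewrite derive1E; exact: derive_val.
rewrite DeltaE ?gt_eqF// gdrv.
move: betaE eE margin; set c := cst_c p n in pc *; set d := cst_d n in d0 *.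
set be := beta_star p n => betaE eE margin.
set v := derive1 phi w in margin *.
set l := (ln w)^-1 in margin ge ugl *.
have l0 : 0 < l by rewrite invr_gt0; lra.
have l1 : l <= 1 by rewrite invf_le1; lra.
set u := w * g1 w in ugl.
rewrite -(pmulr_rgt0 _ w0) [ltRHS](_ : _ =
  g w * (2 * (c - phi w) + d * (w * v) - g w + d * u) + d * u * (1 + phi w)); last first.
  by rewrite /u; field; rewrite gt_eqF.
have gl0 : 0 < g w * l by exact: mulr_gt0.
have gle : g w <= e by rewrite (le_trans ge)// ler_piMr// ltW.
have f1 := ler_wpM2l (ltW g0) margin.
have f2 : g w * g w <= g w * (e * l) by rewrite ler_wpM2l// ltW.
have f3 : g w * (g w * l) <= g w * (e * l) by rewrite ler_wpM2l ?ler_wpM2r// ltW.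
have f4 : - (d * (g w * (e * l))) <= g w * (d * u).
  have := ler_wpM2l (mulr_ge0 (ltW d0) (ltW g0)) ugl.
  by have := ler_wpM2l (ltW d0) f3; lra.
have f5 : - (d * (g w * l) * (1 + c)) <= d * u * (1 + phi w).
  have q0 : 0 <= 1 + phi w by lra.
  have := ler_wpM2l (mulr_ge0 (ltW d0) q0) ugl.
  by have := ler_wpM2l (mulr_ge0 (ltW d0) (ltW gl0)) pc; lra.
have be0 : 0 < (b - 1) * be by rewrite -eE mulr_gt0//; lra.
have := mulr_gt0 gl0 be0.
have f6 : d * (g w * l) * (1 + c) = 2 * (g w * l * be) by rewrite betaE; lra.
have f7 : g w * l * (e * (1 + d)) = g w * l * ((b - 1) * be) by rewrite eE.
lra.
Qed.

(** The left side is what Stein's identities leave of the loss difference. The derivative of the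
    square part enters with the opposite sign because W decreases as S grows. *)
Lemma Delta_parts p n (phi g g1 : R -> R) (w : R) : 0 < w ->
  derivable phi w 1 -> is_derive w 1 g (g1 w) ->
  2 * (p%:R * linear_part g w + 2 * (w * linear_part1 g g1 w)) -
    (n%:R * square_part phi g w - 2 * (w * square_part1 phi g g1 w)) =
  (n%:R + 2) * Delta p n phi g w.
Proof.
move=> w0 dphi dg.
have gdrv : derive1 g w = g1 w by rewrite derive1E; exact: derive_val.
rewrite DeltaE ?gt_eqF// gdrv /linear_part /linear_part1 /square_part1 /square_part.
have n2 : n%:R + 2 != 0 :> R by rewrite gt_eqF.
by rewrite /cst_c /cst_d; field; rewrite n2 gt_eqF.
Qed.

End DeltaPositive.

(** * Stein's identity in the model *)

Section SteinModel.
Context {R : realType}.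
Variables (p n : nat) (theta : p.-tuple R) (s : R).
Hypothesis s0 : 0 < s.

Let P := normal_vec_law theta s.
Let Q := scaled_chi2_law n s.

Lemma measurable_Wstat : measurable_fun setT (@Wstat R p).
Proof.
apply: measurable_funM.
  by apply: measurableT_comp; [exact: measurable_sqnorm|exact: measurable_fst].
by apply: (measurableT_comp measurable_inv); exact: measurable_snd.
Qed.

Lemma Wstat_ge0 (z : p.-tuple R * R) : 0 <= z.2 -> 0 <= Wstat z.
Proof. by move=> z0; rewrite divr_ge0 ?sqnorm_ge0. Qed.

(** Off the sample space W <= 0, the value being 0 at S = 0 by the convention on division. Tail
    profiles vanish there, so integrals can be taken over the whole space. *)
Lemma Wstat_le0 (z : p.-tuple R * R) : z.2 <= 0 -> Wstat z <= 0.
Proof. by move=> z0; rewrite mulr_ge0_le0 ?sqnorm_ge0 ?invr_le0. Qed.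

Lemma scaled_chi2_lty : (\int[Q]_y (`|y|)%:E < +oo)%E.
Proof.
rewrite ge0_integral_distribution//; last by apply/measurable_EFinP; exact: normr_measurable.
rewrite (_ : (\int[_]_x _)%E =
  \int[prod_law n (fun=> normal_prob 0 1)]_x ((s ^+ 2)%:E * (sqnorm x)%:E))%E.
  rewrite ge0_integralZl//; last 3 first.
  - by apply/measurable_EFinP; exact: measurable_sqnorm.
  - by move=> x _; rewrite lee_fin sqnorm_ge0.
  - by rewrite lee_fin sqr_ge0.
  apply: lte_mul_pinfty => //; first by rewrite lee_fin sqr_ge0.
  exact: (@prod_law_sqnorm_lty R 1 ltr01 n (cst 0)).
apply: eq_integral => x _.
by rewrite /= ger0_norm// /scaled_sqnorm mulr_ge0 ?sqr_ge0 ?sqnorm_ge0.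
Qed.

Let q (z : p.-tuple R * R) := sqnorm z.1 + `|z.2|.

Let mq : measurable_fun setT q.
Proof.
apply: measurable_funD.
  by apply: measurableT_comp; [exact: measurable_sqnorm|exact: measurable_fst].
by apply: measurableT_comp => //; exact: measurable_snd.
Qed.

Let q_ge0 z : 0 <= q z. Proof. by rewrite addr_ge0 ?sqnorm_ge0. Qed.

Let q_lty : (\int[model n theta s]_z (q z)%:E < +oo)%E.
Proof.
rewrite fubini_tonelli1//=; last by apply/measurable_EFinP; exact: mq.
rewrite (_ : (\int[P]_x _)%E = \int[P]_x ((sqnorm x)%:E + \int[Q]_y (`|y|)%:E))%E.
  rewrite ge0_integralD//; last 3 first.
  - by move=> x _; rewrite lee_fin sqnorm_ge0.
  - by apply/measurable_EFinP; exact: measurable_sqnorm.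
  - by move=> x _; apply: integral_ge0 => y _; rewrite lee_fin.
  rewrite integral_probability_cst lte_add_pinfty ?scaled_chi2_lty//.
  exact: (prod_law_sqnorm_lty s0).
apply: eq_integral => x _; rewrite /fubini_F/=.
transitivity (\int[Q]_y ((sqnorm x)%:E + (`|y|)%:E))%E; first exact: eq_integral.
rewrite ge0_integralD//; first by rewrite (@integral_probability_cst R _ _ Q).
- by move=> y _; rewrite lee_fin sqnorm_ge0.
- by apply/measurable_EFinP; exact: normr_measurable.
Qed.

(** |X|^2 + |S| has finite mean, and the integrands met below grow no faster than this. *)
Lemma integrable_model (F : p.-tuple R * R -> R) (C : R) : measurable_fun setT F ->
  (forall z, `|F z| <= C * (1 + (sqnorm z.1 + `|z.2|))) ->
  (model n theta s).-integrable setT (fun z => (F z)%:E).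
Proof. by move=> mF FC; exact: (integrable_le_quadratic mq q_ge0 q_lty mF FC). Qed.

Section profile.
Variables (C w0 : R) (k k1 : R -> R).
Hypothesis kP : tail_profile C w0 k k1.

Let C_ge0 : 0 <= C. Proof. by case: kP. Qed.

Let mk : measurable_fun setT (fun z : p.-tuple R * R => k (Wstat z)).
Proof.
by have [h _] := tail_profile_measurable kP; exact: measurableT_comp h measurable_Wstat.
Qed.

Let mk1 : measurable_fun setT (fun z : p.-tuple R * R => k1 (Wstat z)).
Proof.
by have [_ h] := tail_profile_measurable kP; exact: measurableT_comp h measurable_Wstat.
Qed.

Let k_small (w : R) : w <= 0 -> k w = 0 /\ k1 w = 0.
Proof. by move=> h; have [w01 _ _ _ /(_ w)[+ _]] := kP; apply; lra. Qed.

Lemma integrable_stein (j j' : R) : (model n theta s).-integrable setT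
  (fun z => (s ^+ 2 * (j * k (Wstat z) + j' * (Wstat z * k1 (Wstat z))))%:E).
Proof.
apply: (@integrable_model _ (s ^+ 2 * ((`|j| + `|j'|) * C))).
  apply: measurable_funM => //; apply: measurable_funD; first exact: measurable_funM.
  by apply: measurable_funM => //; apply: measurable_funM => //; exact: measurable_Wstat.
move=> z; apply: (@le_trans _ _ (s ^+ 2 * ((`|j| + `|j'|) * C))); last first.
  apply: ler_pM1D; last by rewrite addr_ge0 ?sqnorm_ge0.
  by rewrite mulr_ge0 ?sqr_ge0// mulr_ge0 ?addr_ge0.
rewrite normrM (ger0_norm (sqr_ge0 s)) ler_wpM2l ?sqr_ge0//.
rewrite (le_trans (ler_normD _ _))// mulrDl (normrM j) (normrM j').
by have [h1 _ h2] := tail_profile_le kP (Wstat z); rewrite lerD// ler_wpM2l.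
Qed.

Lemma integrable_normal_part : (model n theta s).-integrable setT
  (fun z => (\sum_(i < p) (tnth z.1 i - tnth theta i) * (tnth z.1 i * k (Wstat z)))%:E).
Proof.
have mt i : measurable_fun setT (fun z : p.-tuple R * R => tnth z.1 i).
  apply: (@measurableT_comp _ _ _ _ _ _ (fun x => tnth x i)); first exact: measurable_tnth.
  exact: measurable_fst.
apply: (@integrable_model _ (\sum_(i < p) C * (1 + `|tnth theta i|))).
  apply: measurable_sum => i; apply: measurable_funM; first exact: measurable_funB.
  exact: measurable_funM.
move=> z; rewrite mulr_suml (le_trans (ler_norm_sum _ _ _))//; apply: ler_sum => i _.
have [h _ _] := tail_profile_le kP (Wstat z).
have : `|(tnth z.1 i - tnth theta i) * (tnth z.1 i * k (Wstat z))| <=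
    C * ((1 + `|tnth theta i|) * (1 + tnth z.1 i ^+ 2)).
  move: (tnth z.1 i) (tnth theta i) => x c.
  rewrite mulrA normrM [leRHS]mulrC; apply: ler_pM => //.
  rewrite normrM; apply: (@le_trans _ _ ((`|x| + `|c|) * `|x|)).
    by rewrite ler_wpM2r// (le_trans (ler_normD _ _))// normrN.
  rewrite -[in leRHS](real_normK (num_real x)).
  have h1 := normr_ge0 c; have h2 := normr_ge0 x.
  have : 0 <= `|c| * (1 - `|x| + `|x| ^+ 2).
    by rewrite mulr_ge0//; have := sqr_ge0 (`|x| - 1 / 2); lra.
  by have := sqr_ge0 (`|x| - 1 / 2); lra.
move=> /le_trans; apply; rewrite mulrA ler_wpM2l//; first by rewrite mulr_ge0 ?addr_ge0.
rewrite lerD2l; apply: (@le_trans _ _ (sqnorm z.1)); last by rewrite lerDl.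
by rewrite /sqnorm (bigD1 i)//= lerDl sumr_ge0// => ? _; exact: sqr_ge0.
Qed.

Lemma integrable_chi2_part : (model n theta s).-integrable setT
  (fun z => (z.2 * k (Wstat z))%:E).
Proof.
apply: (@integrable_model _ C); first by apply: measurable_funM => //; exact: measurable_snd.
move=> z; have [h _ _] := tail_profile_le kP (Wstat z).
rewrite normrM mulrC; apply: ler_pM => //.
by have := sqnorm_ge0 z.1; lra.
Qed.

Lemma stein_normal_part :
  (\int[model n theta s]_z
     (\sum_(i < p) (tnth z.1 i - tnth theta i) * (tnth z.1 i * k (Wstat z)))%:E =
   \int[model n theta s]_z
     (s ^+ 2 * (p%:R * k (Wstat z) + 2 * (Wstat z * k1 (Wstat z))))%:E)%E.
Proof.
rewrite -(integral21_prod_meas1 integrable_normal_part).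
rewrite -(integral21_prod_meas1 (integrable_stein _ _)).
apply: eq_integral => y _; rewrite /fubini_G/=.
have [y0|y0] := leP y 0.
  have W0 (x : p.-tuple R) : k (Wstat (x, y)) = 0 /\ k1 (Wstat (x, y)) = 0.
    by apply: k_small; exact: Wstat_le0.
  apply: eq_integral => x _; have [-> ->] := W0 x; congr EFin.
  by rewrite !mulr0 addr0 mulr0 big1// => i _; rewrite !mulr0.
have := stein_prod_law s0 p (fun i => nth 0 theta i) (radial_profile_scale kP y0) (lexx 0).
under eq_integral do rewrite add0r.
under [X in _ = X -> _]eq_integral do rewrite add0r.
rewrite /P /normal_vec_law => h.
rewrite -[RHS](_ : (\int[prod_law p (fun i : nat => normal_prob (nth 0%R theta i) s)]_x
  (s ^+ 2 * (p%:R * k (sqnorm x / y) + 2 * (sqnorm x * (k1 (sqnorm x / y) / y))))%:E)%E = _).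
  rewrite -h; apply: eq_integral => x _; congr EFin; apply: eq_bigr => i _.
  by rewrite (tnth_nth 0 theta).
apply: eq_integral => x _; congr EFin; rewrite /Wstat/=; congr (_ * (_ + _ * _)).
by ring.
Qed.

(** S is s^2 |Z|^2 with Z standard normal in dimension n, and for X fixed S k(W) is s^2 times the
    sum of z_i (z_i k(a / (s^2 |z|^2))). This is the left side of Stein's identity with mean 0 and
    variance 1; the minus sign comes from differentiating the inverse. *)
Lemma stein_chi2_part :
  (\int[model n theta s]_z (z.2 * k (Wstat z))%:E =
   \int[model n theta s]_z
     (s ^+ 2 * (n%:R * k (Wstat z) + (- 2) * (Wstat z * k1 (Wstat z))))%:E)%E.
Proof.
rewrite -(integral12_prod_meas1 integrable_chi2_part).
rewrite -(integral12_prod_meas1 (integrable_stein _ _)).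
apply: eq_integral => x _; rewrite /fubini_F/= /Wstat/=.
have a0 := sqnorm_ge0 x; set a := sqnorm x in a0 *.
have t0 : 0 < s ^+ 2 by rewrite exprn_gt0.
have [dk mk_mk1] := tail_profile_measurable kP.
have mw : measurable_fun setT (fun y : R => a / y).
  by apply: measurable_funM => //; exact: measurable_inv.
have mws : measurable_fun setT (fun x' : n.-tuple R => a / scaled_sqnorm s x').
  exact: measurableT_comp mw (@measurable_scaled_sqnorm R n s).
have mks := measurableT_comp dk mws; have mk1s := measurableT_comp mk_mk1 mws.
have int_of (F : n.-tuple R -> R) (c : R) : measurable_fun setT F ->
    (forall x', `|F x'| <= c * (1 + sqnorm x')) ->
    (prod_law n (fun=> normal_prob 0 1)).-integrable setT (fun x' => (F x')%:E).
  apply: integrable_le_quadratic; first exact: measurable_sqnorm.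
    exact: sqnorm_ge0.
  exact: (@prod_law_sqnorm_lty R 1 ltr01 n (cst 0)).
pose f1 (x' : n.-tuple R) := sqnorm x' * k (a / scaled_sqnorm s x').
pose f2 (x' : n.-tuple R) := n%:R * k (a / scaled_sqnorm s x') +
  (- 2) * (a / scaled_sqnorm s x' * k1 (a / scaled_sqnorm s x')).
have mf1 : measurable_fun setT f1.
  by apply: measurable_funM => //; exact: measurable_sqnorm.
have mf2 : measurable_fun setT f2.
  apply: measurable_funD; first exact: measurable_funM.
  by apply: measurable_funM => //; exact: measurable_funM.
have f1C x' : `|f1 x'| <= C * (1 + sqnorm x').
  have [h _ _] := tail_profile_le kP (a / scaled_sqnorm s x').
  rewrite normrM (ger0_norm (sqnorm_ge0 _)) mulrC ler_pM ?sqnorm_ge0//.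
  by rewrite lerDr.
have f2C x' : `|f2 x'| <= (n%:R + 2) * C * (1 + sqnorm x').
  have [h1 _ h2] := tail_profile_le kP (a / scaled_sqnorm s x').
  apply: (@le_trans _ _ ((n%:R + 2) * C)); last first.
    by apply: ler_pM1D; [rewrite mulr_ge0 ?addr_ge0|exact: sqnorm_ge0].
  apply: (le_trans (ler_normD _ _)); rewrite (normrM n%:R) (normrM (- 2)) normrN.
  rewrite (ger0_norm (_ : 0 <= n%:R))// (ger0_norm (_ : 0 <= 2))// [leRHS]mulrDl.
  by rewrite lerD// ler_wpM2l.
have scaledE (x' : n.-tuple R) : scaled_sqnorm s x' * k (a / scaled_sqnorm s x') = s ^+ 2 * f1 x'.
  by rewrite mulrA.
have normZ (c u v : R) : `|u| <= c * v -> `|s ^+ 2 * u| <= s ^+ 2 * c * v.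
  by move=> uc; rewrite normrM (gtr0_norm t0) -mulrA ler_wpM2l// ltW.
rewrite !integral_distribution//=; first last.
- apply: (int_of _ (s ^+ 2 * C)).
    by apply: measurable_funM => //; exact: measurable_scaled_sqnorm.
  by move=> x'; rewrite scaledE; exact: (normZ _ _ _ (f1C x')).
- apply/measurable_EFinP; apply: measurable_funM => //.
  exact: measurableT_comp dk mw.
- apply: (int_of _ (s ^+ 2 * ((n%:R + 2) * C))); first exact: measurable_funM.
  move=> x'; exact: (normZ _ _ _ (f2C x')).
- apply/measurable_EFinP; apply: measurable_funM => //; apply: measurable_funD.
    by apply: measurable_funM => //; exact: measurableT_comp dk mw.
  apply: measurable_funM => //; apply: measurable_funM => //.
  exact: measurableT_comp mk_mk1 mw.
transitivity ((s ^+ 2)%:E * \int[prod_law n (fun=> normal_prob 0 1)]_x' (f1 x')%:E)%E.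
  rewrite -integralZl//; last exact: (int_of _ C).
  by apply: eq_integral => x' _; rewrite scaledE EFinM.
transitivity ((s ^+ 2)%:E * \int[prod_law n (fun=> normal_prob 0 1)]_x' (f2 x')%:E)%E; last first.
  by rewrite -integralZl//; exact: (int_of _ ((n%:R + 2) * C)).
congr (_ * _)%E.
have := stein_prod_law (ltr01 : 0 < 1 :> R) n (cst 0) (radial_profile_inv kP a0 t0) (lexx 0).
under eq_integral do rewrite add0r.
under [X in _ = X -> _]eq_integral do rewrite add0r expr1n mul1r.
move=> h; rewrite [LHS](_ : _ = \int[prod_law n (fun i : nat => normal_prob (cst 0%R i) 1)]_x'
  (\sum_(i < n) (tnth x' i - cst 0 i) *
     (tnth x' i * k (a / (s ^+ 2 * sqnorm x'))))%:E)%E.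
  rewrite h; apply: eq_integral => x' _; congr EFin; rewrite /f2 /scaled_sqnorm.
  (* At |z| = 0 both sides are 0 by the convention on inverses; elsewhere this is plain
     simplification. *)
  congr (_ + _); have [->|q0] := eqVneq (sqnorm x') 0; first by rewrite !(mulr0, mul0r, invr0).
  by field; rewrite q0 gt_eqF.
apply: eq_integral => x' _; congr EFin.
rewrite /f1 /scaled_sqnorm /sqnorm mulr_suml; apply: eq_bigr => i _.
by rewrite subr0 expr2 mulrA.
Qed.

End profile.

End SteinModel.

(** * Comparison of risks *)

Section Risk.
Context {R : realType}.

Lemma integral_lincomb d (T : measurableType d) (mu : {measure set T -> \bar R})
    (f1 f2 : T -> R) (a b : R) :
  mu.-integrable setT (fun x => (f1 x)%:E) -> mu.-integrable setT (fun x => (f2 x)%:E) ->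
  (\int[mu]_x (a * f1 x + b * f2 x)%:E =
   a%:E * \int[mu]_x (f1 x)%:E + b%:E * \int[mu]_x (f2 x)%:E)%E.
Proof.
move=> i1 i2; under eq_integral do rewrite EFinD !EFinM.
rewrite integralD//; [|exact: integrableZl|exact: integrableZl].
by rewrite !integralZl.
Qed.

Lemma integrable_lincomb d (T : measurableType d) (mu : {measure set T -> \bar R})
    (f1 f2 : T -> R) (a b : R) :
  mu.-integrable setT (fun x => (f1 x)%:E) -> mu.-integrable setT (fun x => (f2 x)%:E) ->
  mu.-integrable setT (fun x => (a * f1 x + b * f2 x)%:E).
Proof.
move=> i1 i2; apply: (eq_integrable _
  (fun x => (a%:E * (f1 x)%:E + b%:E * (f2 x)%:E)%E)) => //.
by apply: integrableD => //; exact: integrableZl.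
Qed.

Lemma integral_gt0_of_gt0 d (T : measurableType d) (mu : {measure set T -> \bar R})
    (f : T -> R) (A : set T) : measurable A -> (0 < mu A)%E -> measurable_fun setT f ->
  (forall x, 0 <= f x) -> (forall x, A x -> 0 < f x) -> (0 < \int[mu]_x (f x)%:E)%E.
Proof.
move=> mA muA mf f0 fA; rewrite lt_neqAle integral_ge0 ?andbT; last first.
  by move=> x _; rewrite lee_fin.
apply/eqP => /esym if0; move: muA.
have mEf : measurable_fun setT (EFin \o f) by exact/measurable_EFinP.
have /ae_eq_integral_abs : (\int[mu]_x `|(EFin \o f) x| = 0)%E.
  by rewrite -if0; apply: eq_integral => x _; rewrite /= ger0_norm.
move=> /(_ measurableT mEf) [N [mN N0 sub]].
rewrite (subset_measure0 mA mN _ N0) ?ltxx// => x Ax; apply: sub => /= /(_ I) [fx0].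
by have := fA x Ax; rewrite fx0 ltxx.
Qed.

Section phi.
Variable phi : R -> R.
Hypothesis acphi : forall b, 0 <= b -> abs_continuous 0 b phi.

(** [phi] is controlled on nonnegative arguments only. Truncation at 0 gives a function measurable
    everywhere that agrees with it at W on the sample space. *)
Lemma continuous_max0 : continuous (fun w : R => phi (Num.max 0 w)).
Proof.
move=> x; pose b := Num.max 0 x + 1.
have b0 : 0 <= b by rewrite /b addr_ge0// le_max lexx.
have m0 (y : R) : 0 <= Num.max 0 y by rewrite le_max lexx.
have cm : Num.max 0 y @[y --> x] --> Num.max 0 x.
  by apply: continuous_max; [exact: cvg_cst|exact: cvg_id].
apply/cvgrPdist_lt => e e0.
have xb : 0 <= Num.max 0 x <= b by apply/andP; split; [exact: m0|rewrite /b lerDl].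
have [k k0 hk] := abs_continuous_dist b0 (acphi b0) xb e0.
have near_le1 : \forall y \near x, `|Num.max 0 x - Num.max 0 y| <= 1.
  by move/cvgrPdist_le : cm => /(_ 1 ltr01).
have near_lt : \forall y \near x, `|Num.max 0 x - Num.max 0 y| < k.
  by move/cvgrPdist_lt : cm => /(_ k k0).
near=> y; rewrite distrC; apply: hk.
  rewrite m0/= /b -lerBlDl.
  apply: le_trans (ler_norm _) _; rewrite distrC; near: y; exact: near_le1.
by rewrite distrC; near: y; exact: near_lt.
Unshelve. all: by end_near. Qed.

Lemma measurable_max0 : measurable_fun setT (fun w : R => phi (Num.max 0 w)).
Proof. exact: continuous_measurable_fun continuous_max0. Qed.

(** Near 0 the quotient phi / w is close to the right derivative; on the middle range [phi] is
    bounded and w is away from 0; further out growth is at most linear. A bounded shrinkage factor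
    makes the loss integrable. *)
Lemma shrinkage_bounded (c w0 : R) : phi 0 = 0 -> derivative_right_continuous0 phi ->
  0 <= w0 -> (forall w : R, w0 <= w -> 0 <= w -> `|phi w| <= c * w) ->
  exists M : R, forall w : R, 0 <= w -> `|1 - phi w / w| <= M.
Proof.
move=> phi0 [l + _] w0_ge0 large; rewrite phi0 => dphi.
move/cvgrPdist_le : dphi => /(_ 1 ltr01)[d /= d0 hd].
have [M1 hM1] := abs_continuous_bounded w0_ge0 (acphi w0_ge0).
pose M := `|l| + 1 + `|M1| / d + `|c|.
have M0 : 0 <= `|M1| / d by rewrite divr_ge0// ltW.
exists (1 + M) => w w_ge0; rewrite (le_trans (ler_normB _ _))// normr1 lerD2l.
have l0 := normr_ge0 l; have c0 := normr_ge0 c.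
have [->|w_neq0] := eqVneq w 0; first by rewrite invr0 mulr0 normr0 /M; lra.
have {w_neq0}w_gt0 : 0 < w by rewrite lt_neqAle eq_sym w_neq0.
have [wd|dw] := ltP w d.
  have := hd w; rewrite /= sub0r normrN gtr0_norm// subr0 => /(_ wd w_gt0).
  have := ler_distD l (phi w / w) 0; rewrite !subr0 (distrC _ l) => h1 h2.
  by rewrite /M; lra.
have [ww0|w0w] := leP w w0.
  rewrite normrM normfV (gtr0_norm w_gt0).
  have : `|phi w| / w <= `|M1| / d.
    apply: ler_pM => //; first by rewrite invr_ge0.
      by rewrite (le_trans (hM1 w _)) ?w_ge0// ler_norm.
    by rewrite lef_pV2 ?posrE.
  by rewrite /M; lra.
have : `|phi w / w| <= `|c|.
  rewrite normrM normfV (gtr0_norm w_gt0) ler_pdivrMr//.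
  by rewrite (le_trans (large w (ltW w0w) w_ge0))// ler_wpM2r// ler_norm.
by rewrite /M; lra.
Qed.

End phi.
End Risk.

(** * Integrability of the loss *)

Section Loss.
Context {R : realType}.

Lemma finite_expectation_bounded p n (h : R -> R) (K : R) : measurable_fun setT h ->
  (forall w : R, `|h w| <= K) -> finite_expectation p n h.
Proof.
move=> mh hK theta s s0; apply: (integrableS measurableT) => //.
  exact: measurable_sample_space.
apply: (integrable_model n theta s0 (C := K)).
  exact: measurableT_comp mh (@measurable_Wstat R p).
move=> z; rewrite (le_trans (hK _))// ler_pM1D ?addr_ge0 ?sqnorm_ge0//.
exact: le_trans (normr_ge0 _) (hK 0).
Qed.

Lemma model_Wstat_gt_gt0 p n (w0 : R) : (0 < p)%N -> (0 < n)%N -> 0 < w0 ->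
  (0 < model n [tuple of nseq p (0 : R)%R] 1%R [set z | (w0 < Wstat z)%R])%E.
Proof.
move=> p0 n0 w0_gt0.
(* With this [a], S <= n a^2 < 1 / w0, so |X|^2 >= 1 yields W > w0. *)
pose a : R := Num.min 1 (1 / (2 * n%:R * w0)).
have n1 : 1 <= n%:R :> R by rewrite ler1n.
have a0 : 0 < a by rewrite lt_min ltr01 divr_gt0// !mulr_gt0//; lra.
have a1 : a <= 1 by rewrite ge_min lexx.
have na : n%:R * a ^+ 2 < w0^-1.
  have : a <= 1 / (2 * n%:R * w0) by rewrite ge_min lexx orbT.
  rewrite ler_pdivlMr; last by rewrite !mulr_gt0//; lra.
  move=> h; rewrite -[ltRHS]mul1r ltr_pdivlMr//.
  have : n%:R * a ^+ 2 * w0 <= n%:R * a * w0.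
    rewrite ler_wpM2r ?(ltW w0_gt0)// ler_wpM2l// expr2 ler_piMr// ltW//.
  by lra.
pose A := [set x : p.-tuple R | 1 <= sqnorm x].
pose B : set R := `]0, n%:R * a ^+ 2]%classic.
have mA : measurable A.
  rewrite (_ : A = setT `&` (@sqnorm R p @^-1` `[1, +oo[)).
    by apply: measurable_sqnorm => //; exact: measurable_itv.
  by rewrite setTI; apply/seteqP; split => x /=; rewrite in_itv/= andbT.
have mB : measurable B by exact: measurable_itv.
set th := [tuple of _].
apply: (@lt_le_trans _ _ (model n th 1%R (A `*` B))).
  have -> : model n th 1%R (A `*` B) = (normal_vec_law th 1%R A * scaled_chi2_law n 1%R B)%E :=
    @product_measure1E _ _ _ _ R (normal_vec_law th 1) (scaled_chi2_law n 1) A B mA mB.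
  apply: mule_gt0; first exact: normal_vec_sqnorm_ge1.
  apply: lt_le_trans (scaled_chi2_itv_ge n0 a0 _); last by lra.
  rewrite lte_fin exprn_gt0// mulr_gt0//.
  by rewrite normal_pdfE ?oner_neq0// mulr_gt0 ?expR_gt0// normal_peak_gt0// oner_neq0.
apply: le_measure.
- by apply: mem_set; exact: measurableX.
- apply: mem_set; rewrite (_ : [set _ | _] = setT `&` (@Wstat R p @^-1` `]w0, +oo[)).
    by apply: measurable_Wstat => //; exact: measurable_itv.
  by rewrite setTI; apply/seteqP; split => x /=; rewrite in_itv/= andbT.
move=> [x y] [/= Ax]; rewrite /B/= in_itv/= => /andP[y0 ya].
rewrite /Wstat/= ltr_pdivlMr//; apply: lt_le_trans Ax.
have : y < w0^-1 by exact: le_lt_trans ya na.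
by rewrite -[X in _ < X]mul1r ltr_pdivlMr// mulrC.
Qed.

Section psi.
Variables (p n : nat) (psi : R -> R).
Hypothesis psi0 : psi 0 = 0.
Hypothesis mpsi : measurable_fun setT (fun w : R => psi (Num.max 0 w)).

Let r (z : p.-tuple R * R) := 1 - psi (Num.max 0 (Wstat z)) / Wstat z.

Let mr : measurable_fun setT r.
Proof.
apply: measurable_funB => //; apply: measurable_funM.
  exact: measurableT_comp mpsi (@measurable_Wstat R p).
exact: measurableT_comp measurable_inv (@measurable_Wstat R p).
Qed.

Let mt i : measurable_fun setT (fun z : p.-tuple R * R => tnth z.1 i).
Proof.
apply: (@measurableT_comp _ _ _ _ _ _ (fun x => tnth x i)); first exact: measurable_tnth.
exact: measurable_fst.
Qed.

Let rE (z : p.-tuple R * R) : sample_space z -> 1 - psi (Wstat z) / Wstat z = r z.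
Proof. by move=> /ltW/Wstat_ge0 W0; rewrite /r (max_idPr _). Qed.

Lemma measurable_delta : measurable_fun (@sample_space R p) (delta (p := p) psi).
Proof.
apply: (eq_measurable_fun (fun z => [tuple r z * tnth z.1 i | i < p])).
  by move=> z /set_mem zD; apply: eq_from_tnth => i; rewrite !tnth_mktuple rE.
apply: measurable_funTS; apply/measurable_fun_tnthP => i.
rewrite (_ : _ \o _ = fun z => r z * tnth z.1 i); first exact: measurable_funM.
by apply/funext => z; rewrite /= tnth_mktuple.
Qed.

Lemma integrable_loss (M : R) (theta : p.-tuple R) (s : R) : 0 < s ->
  (forall w : R, 0 <= w -> `|1 - psi w / w| <= M) ->
  (model n theta s).-integrable (@sample_space R p)
    (fun z => (loss (delta psi z) theta s)%:E).
Proof.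
move=> s0 psiM.
apply: (eq_integrable (@measurable_sample_space R p)
  (fun z => ((\sum_(i < p) (r z * tnth z.1 i - tnth theta i) ^+ 2) / s ^+ 2)%:E)).
  move=> z /set_mem zD; congr EFin; rewrite /loss; congr (_ / _).
  by apply: eq_bigr => i _; rewrite tnth_mktuple rE.
apply: (integrableS measurableT) => //; first exact: measurable_sample_space.
have rM z : `|r z| <= M.
  rewrite /r; have [W0|W0] := leP 0 (Wstat z); first exact: psiM.
  by rewrite psi0 mul0r subr0; have := psiM 0 (lexx 0); rewrite psi0 mul0r subr0.
have M0 : 0 <= M by exact: le_trans (normr_ge0 _) (psiM 0 (lexx 0)).
have si0 : 0 <= (s ^+ 2)^-1 by rewrite invr_ge0 sqr_ge0.
apply: (integrable_model n theta s0 (C := 2 * (M ^+ 2 + sqnorm theta) / s ^+ 2)).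
  apply: measurable_funM => //; apply: measurable_sum => i; apply: measurable_funX.
  by apply: measurable_funB => //; exact: measurable_funM.
move=> z; rewrite normrM (ger0_norm si0) ger0_norm; last first.
  by apply: sumr_ge0 => i _; exact: sqr_ge0.
rewrite mulrAC ler_wpM2r//.
apply: (@le_trans _ _ (\sum_(i < p) (2 * M ^+ 2 * tnth z.1 i ^+ 2 + 2 * tnth theta i ^+ 2))).
  apply: ler_sum => i _.
  have : (r z * tnth z.1 i) ^+ 2 <= M ^+ 2 * tnth z.1 i ^+ 2.
    rewrite exprMn ler_wpM2r ?sqr_ge0// -(real_normK (num_real (r z))).
    by rewrite ler_sqr ?nnegrE.
  by have := sqr_ge0 (r z * tnth z.1 i + tnth theta i); lra.
rewrite big_split/= -!mulr_sumr -/(sqnorm z.1) -/(sqnorm theta).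
have t0 := sqnorm_ge0 theta; have x0 := sqnorm_ge0 z.1; have y0 := normr_ge0 z.2.
have := mulr_ge0 (sqr_ge0 M) y0; have := mulr_ge0 t0 (addr_ge0 x0 y0).
by have := sqr_ge0 M; lra.
Qed.

End psi.

End Loss.

(** * Quasi-inadmissibility and inadmissibility *)

Section QuasiInadmissibility.
Context {R : realType}.

Section perturbation.
Variables (p n : nat) (phi g g1 : R -> R) (w0 e : R).
Hypotheses (p_gt0 : (0 < p)%N) (n_gt0 : (0 < n)%N) (w0_gt1 : 1 < w0) (e_gt0 : 0 < e).
Hypothesis acphi : forall b, 0 <= b -> abs_continuous 0 b phi.
Hypotheses (phi0 : phi 0 = 0) (phi_ge0 : forall w : R, 0 <= w -> 0 <= phi w).
Hypothesis dphi0 : derivative_right_continuous0 phi.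
Hypothesis c_gt0 : 0 < cst_c p n :> R.
Hypothesis phi_reg : forall w : R, w0 <= w ->
  [/\ derivable phi w 1, {for w, continuous (derive1 phi)},
      `|w * derive1 phi w| <= 2 * phi w & phi w <= cst_c p n].
Hypothesis dg : forall w : R, is_derive w 1 g (g1 w).
Hypothesis cg1 : continuous g1.
Hypothesis g0 : forall w : R, w <= w0 -> g w = 0 /\ g1 w = 0.
Hypothesis gw : forall w : R, w0 < w -> [/\ 0 < g w, g w <= e & `|w * g1 w| <= 3 * e].
Hypothesis Dgt0 : forall w : R, w0 < w -> 0 < Delta p n phi g w.

Lemma perturbation_derive1 : derive1 g = g1.
Proof. by apply/funext => w; rewrite derive1E; exact: derive_val. Qed.

Lemma perturbation_bounds (w : R) :
  [/\ 0 <= g w <= e, `|g1 w| <= 3 * e, `|g w / w| <= e & `|g w ^+ 2 / w| <= e ^+ 2].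
Proof.
have w1 := w0_gt1; have e0 := e_gt0.
have [ww0|w0w] := leP w w0.
  have [-> ->] := g0 ww0; rewrite expr0n/= !mul0r !normr0 lexx.
  by rewrite sqr_ge0 (ltW e0) mulr_ge0 ?(ltW e0).
have [h1 h2 h3] := gw w0w; have w_gt0 : 0 < w by lra.
have wi0 : 0 <= w^-1 by rewrite invr_ge0 ltW.
have wi1 : w^-1 <= 1 by rewrite invf_le1//; lra.
have g_ge0 := ltW h1; split.
- by rewrite g_ge0.
- by apply: le_trans h3; rewrite normrM ler_peMl// gtr0_norm//; lra.
- by rewrite ger0_norm ?mulr_ge0// -[leRHS]mulr1 ler_pM.
rewrite ger0_norm ?mulr_ge0 ?sqr_ge0// -[leRHS]mulr1 ler_pM ?sqr_ge0//.
by rewrite ler_sqr ?nnegrE// ltW.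
Qed.

Lemma perturbation_Phi : Phi p n g.
Proof.
have mg : measurable_fun setT g.
  exact: continuous_measurable_fun (is_derive_continuous dg).
have mg1 : measurable_fun setT g1 by exact: continuous_measurable_fun.
split => [b b0|].
  apply: (@abs_continuous_lipschitz _ _ _ _ (3 * e)).
  apply: (is_derive_lipschitz (fun w _ => dg w)) => w _.
  by have [] := perturbation_bounds w.
rewrite perturbation_derive1; split.
- apply: (finite_expectation_bounded _ _ (K := e ^+ 2)) => [|w].
    by apply: measurable_funM; [exact: measurable_funX|exact: measurable_inv].
  by have [] := perturbation_bounds w.
- apply: (finite_expectation_bounded _ _ (K := e)) => [|w].
    by apply: measurable_funM => //; exact: measurable_inv.
  by have [] := perturbation_bounds w.
- apply: (finite_expectation_bounded _ _ (K := 3 * e)) => // w.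
  by have [] := perturbation_bounds w.
apply: (finite_expectation_bounded _ _ (K := e * (3 * e))) => [|w].
  exact: measurable_funM.
have [/andP[ge0 ge] h _ _] := perturbation_bounds w.
by rewrite normrM ler_pM// ger0_norm.
Qed.

Lemma perturbation_Delta_ge0 : Delta_ge0 p n phi g.
Proof.
move=> w w_gt0 dphi dgw; have [ww0|w0w] := leP w w0; last exact/ltW/Dgt0.
have [g_0 g1_0] := g0 ww0.
by rewrite DeltaE ?gt_eqF// perturbation_derive1 g_0 g1_0 !(mul0r, mulr0) addr0.
Qed.

Lemma perturbation_quasi_inadmissible : quasi_inadmissible p n phi.
Proof.
exists g; split; [exact: perturbation_Phi| |exact: perturbation_Delta_ge0].
have w1 := w0_gt1; exists w0, (w0 + 1); split; [lra|by rewrite ltrDl|].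
by move=> w /andP[w0w _]; have [h _ _] := gw w0w; rewrite gt_eqF.
Qed.

Let G := linear_part g.
Let G1 := linear_part1 g g1.
Let H := square_part phi g.
Let H1 := square_part1 phi g g1.

Let GP : tail_profile (4 * e) w0 G G1.
Proof. exact: (tail_profile_linear_part w0_gt1 e_gt0 dg cg1 g0 gw). Qed.

Let HP : exists C : R, tail_profile C w0 H H1.
Proof. exact: (tail_profile_square_part w0_gt1 c_gt0 e_gt0 phi_reg dg cg1 g0 gw phi_ge0). Qed.

Section gain.
Variables (theta : p.-tuple R) (s : R).
Hypothesis s_gt0 : 0 < s.

Let a (z : p.-tuple R * R) :=
  \sum_(i < p) (tnth z.1 i - tnth theta i) * (tnth z.1 i * G (Wstat z)).

Let b (z : p.-tuple R * R) := z.2 * H (Wstat z).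

Definition loss_gain (z : p.-tuple R * R) := 2 / s ^+ 2 * a z + - (s ^+ 2)^-1 * b z.

Let vanish (w : R) : w <= w0 -> [/\ G w = 0, G1 w = 0, H w = 0 & H1 w = 0].
Proof.
have [C [_ _ _ _ HP']] := HP; have [_ _ _ _ GP'] := GP => ww0.
by have [] := (GP' w).1 ww0; have [] := (HP' w).1 ww0.
Qed.

Lemma loss_gainE (z : p.-tuple R * R) : sample_space z ->
  loss (delta phi z) theta s = loss (delta (phi \+ g) z) theta s + loss_gain z.
Proof.
move=> zD; have W0 := Wstat_ge0 (ltW zD); have w1 := w0_gt1.
have s2 : s ^+ 2 != 0 by rewrite expf_neq0 ?gt_eqF.
suff E : \sum_(i < p) (tnth (delta phi z) i - tnth theta i) ^+ 2 =
    \sum_(i < p) (tnth (delta (phi \+ g) z) i - tnth theta i) ^+ 2 + (2 * a z - b z).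
  by rewrite /loss E /loss_gain; field; rewrite gt_eqF.
have [Ww0|w0W] := leP (Wstat z) w0.
  have [EG _ EH _] := vanish Ww0; have [Eg _] := g0 Ww0.
  have -> : a z = 0 by rewrite /a big1 // => i _; rewrite EG !mulr0.
  rewrite /b EH !mulr0 subr0 addr0; apply: eq_bigr => i _.
  by rewrite !tnth_mktuple /= Eg addr0.
have Wn0 : Wstat z != 0 by rewrite gt_eqF//; lra.
have -> : b z = \sum_(i < p) tnth z.1 i ^+ 2 *
    (g (Wstat z) * (2 * phi (Wstat z) + g (Wstat z)) / Wstat z ^+ 2).
  rewrite -mulr_suml -/(sqnorm z.1) (_ : sqnorm z.1 = Wstat z * z.2); last first.
    by rewrite /Wstat divfK// gt_eqF.
  by rewrite /b /H /square_part; field.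
rewrite /a mulr_sumr -sumrB -big_split/=; apply: eq_bigr => i _.
by rewrite !tnth_mktuple /= /G /linear_part; field.
Qed.

Let ia : (model n theta s).-integrable setT (fun z => (a z)%:E).
Proof. exact: (integrable_normal_part n theta s_gt0 GP). Qed.

Let ib : (model n theta s).-integrable setT (fun z => (b z)%:E).
Proof. by have [C HP'] := HP; exact: (integrable_chi2_part n theta s_gt0 HP'). Qed.

Lemma integrable_loss_gain : (model n theta s).-integrable setT (fun z => (loss_gain z)%:E).
Proof. exact: integrable_lincomb. Qed.

Let reduced (z : p.-tuple R * R) :=
  2 * (p%:R * G (Wstat z) + 2 * (Wstat z * G1 (Wstat z))) -
  (n%:R * H (Wstat z) - 2 * (Wstat z * H1 (Wstat z))).

Lemma integral_loss_gainE : (\int[model n theta s]_z (loss_gain z)%:E =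
  \int[model n theta s]_z (reduced z)%:E)%E.
Proof.
have [C HP'] := HP.
rewrite /loss_gain integral_lincomb// (stein_normal_part n theta s_gt0 GP).
rewrite (stein_chi2_part n theta s_gt0 HP') -integral_lincomb.
- apply: eq_integral => z _; congr EFin; rewrite /reduced; field.
  by rewrite gt_eqF.
- exact: (integrable_stein n theta s_gt0 GP).
- exact: (integrable_stein n theta s_gt0 HP').
Qed.

Let reducedE (z : p.-tuple R * R) : w0 < Wstat z ->
  reduced z = (n%:R + 2) * Delta p n phi g (Wstat z).
Proof.
move=> w0W; have w1 := w0_gt1; have [dphi _ _ _] := phi_reg (ltW w0W).
by apply: Delta_parts => //; lra.
Qed.

Let reduced_gt0 (z : p.-tuple R * R) : w0 < Wstat z -> 0 < reduced z.
Proof. by move=> w0W; rewrite reducedE// mulr_gt0 ?Dgt0. Qed.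

Let reduced_ge0 (z : p.-tuple R * R) : 0 <= reduced z.
Proof.
have [Ww0|/reduced_gt0/ltW//] := leP (Wstat z) w0.
by rewrite /reduced; have [-> -> -> ->] := vanish Ww0; rewrite !mulr0 !addr0 !mulr0 subrr.
Qed.

Lemma integral_loss_gain_ge0 : (0 <= \int[model n theta s]_z (loss_gain z)%:E)%E.
Proof.
by rewrite integral_loss_gainE; apply: integral_ge0 => z _; rewrite lee_fin.
Qed.

Lemma integral_loss_gain_gt0 :
  (0 < model n theta s [set z | (w0 < Wstat z)%R])%E ->
  (0 < \int[model n theta s]_z (loss_gain z)%:E)%E.
Proof.
move=> A_gt0; rewrite integral_loss_gainE; apply: (integral_gt0_of_gt0 _ A_gt0) => //.
- rewrite (_ : [set _ | _] = setT `&` (@Wstat R p @^-1` `]w0, +oo[)).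
    by apply: measurable_Wstat => //; exact: measurable_itv.
  by rewrite setTI; apply/seteqP; split => x /=; rewrite in_itv/= andbT.
have mW := @measurable_Wstat R p.
have [mG mG1] := tail_profile_measurable GP.
have [C /tail_profile_measurable[mH mH1]] := HP.
apply: measurable_funB.
  apply: measurable_funM => //; apply: measurable_funD.
    by apply: measurable_funM => //; exact: measurableT_comp mG mW.
  by apply: measurable_funM => //; apply: measurable_funM => //; exact: measurableT_comp mG1 mW.
apply: measurable_funB.
  by apply: measurable_funM => //; exact: measurableT_comp mH mW.
by apply: measurable_funM => //; apply: measurable_funM => //; exact: measurableT_comp mH1 mW.
Qed.

(** Risks are integrals over the sample space whereas Stein's identity is proved on the whole space;
    the gain is 0 on the complement. *)
Lemma integral_loss_gain_sample_space :
  (\int[model n theta s]_(z in @sample_space R p) (loss_gain z)%:E =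
   \int[model n theta s]_z (loss_gain z)%:E)%E.
Proof.
rewrite integral_mkcond; apply: eq_integral => z _; rewrite patchE.
case: ifPn => // /negP zD; rewrite /loss_gain /a /b.
have [|EG _ EH _] := vanish (w := Wstat z).
  have w1 := w0_gt1; have : Wstat z <= 0; last by lra.
  apply: Wstat_le0; rewrite leNgt; apply/negP => z0.
  by apply: zD; exact: mem_set.
by rewrite EG EH big1 => [|i _]; rewrite ?mulr0 ?addr0.
Qed.

End gain.

Lemma perturbation_inadmissible : inadmissible n (delta (p := p) phi).
Proof.
have w1 := w0_gt1; have c0 := c_gt0.
have acphig b : 0 <= b -> abs_continuous 0 b (phi \+ g).
  by move=> b0; apply: abs_continuousD; [exact: acphi|exact: (perturbation_Phi.1)].
have g_0 : g 0 = 0 by apply: (g0 _).1; rewrite (le_trans ler01)// ltW.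
have [M phiM] : exists M : R, forall w : R, 0 <= w -> `|1 - phi w / w| <= M.
  apply: (shrinkage_bounded (c := cst_c p n) (w0 := w0) acphi phi0 dphi0) => [|w w0w w_ge0].
    by lra.
  have [_ _ _ h] := phi_reg w0w; rewrite ger0_norm ?phi_ge0// (le_trans h)//.
  by rewrite ler_peMr ?(ltW c0)//; lra.
have phigM (w : R) : 0 <= w -> `|1 - (phi \+ g) w / w| <= M + e.
  move=> w_ge0; have [_ _ h _] := perturbation_bounds w.
  rewrite /= mulrDl opprD addrA (le_trans (ler_normB _ _))// lerD//.
  exact: phiM.
have phig0 : (phi \+ g) 0 = 0 by rewrite /= phi0 g_0 addr0.
have iphig (theta : p.-tuple R) (s : R) (s_gt0 : 0 < s) :=
  integrable_loss n phig0 (measurable_max0 acphig) theta s_gt0 phigM.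
have mD := @measurable_sample_space R p.
have riskE (theta : p.-tuple R) (s : R) : 0 < s -> risk n (delta phi) theta s =
    (risk n (delta (phi \+ g)%R) theta s +
     \int[model n theta s]_z (loss_gain theta s z)%:E)%E.
  move=> s_gt0; rewrite -integral_loss_gain_sample_space /risk -integralD//; last 2 first.
  - exact: iphig.
  - by apply: (integrableS measurableT) => //; exact: integrable_loss_gain.
  by apply: eq_integral => z /set_mem zD; rewrite -EFinD loss_gainE.
have risk_fin (theta : p.-tuple R) (s : R) : 0 < s ->
    risk n (delta (phi \+ g)) theta s \is a fin_num.
  by move=> s_gt0; apply: integrable_fin_num => //; exact: iphig.
exists (delta (phi \+ g)); split.
- exact: measurable_delta (measurable_max0 acphig).
- by move=> theta s s_gt0; rewrite riskE// leeDl// integral_loss_gain_ge0.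
exists [tuple of nseq p 0], 1; split => //.
(* Finiteness of the risk of the competitor is what makes a positive gain a strict inequality in the
   extended reals. *)
rewrite riskE// lteDl ?risk_fin// integral_loss_gain_gt0//.
by apply: model_Wstat_gt_gt0 => //; lra.
Qed.

End perturbation.

Lemma quasi_inadmissible_of_le p n (phi : R -> R) : (3 <= p)%N -> (3 <= n)%N ->
  PhiA p n phi ->
  (exists wstar b : R, 1 < wstar /\ 1 < b /\ (forall w : R, wstar <= w ->
     phi w <= (p%:R - 2) / (n%:R + 2) - b * (beta_star p n / ln w))) ->
  quasi_inadmissible p n phi /\ inadmissible n (delta (p := p) phi).
Proof.
move=> p3 n3 phiA [wstar [b [wstar1 [b1 phi_ub]]]].
have [w0 [w01 lw0 reg]] := upper_bound_margin p3 phiA wstar1 b1 phi_ub.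
have d0 : 0 < cst_d n :> R by exact: cst_d_gt0.
have c0 : 0 < cst_c p n :> R by exact: cst_c_gt0.
have be0 : 0 < beta_star p n :> R.
  by rewrite beta_starE divr_gt0// mulr_gt0// addr_gt0.
(* The amplitude for which the quadratic terms, at most e (1 + d) in units of g / ln w, use up half
   of the excess 2 (b - 1) beta_star. *)
pose e := (b - 1) * beta_star p n / (1 + cst_d n).
have e0 : 0 < e by rewrite divr_gt0 ?(addr_gt0 ltr01 d0)// mulr_gt0//; lra.
have eE : e * (1 + cst_d n) = (b - 1) * beta_star p n.
  by rewrite divfK// gt_eqF// addr_gt0.
have [g [g1 [dg cg1 g0 gw]]] := log_perturbation w01 lw0 e0.
have ln_ge1 (w : R) : w0 < w -> 1 <= ln w.
  by move=> w0w; rewrite (le_trans lw0)// ler_ln ?posrE; lra.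
have gwe (w : R) : w0 < w -> [/\ 0 < g w, g w <= e & `|w * g1 w| <= 3 * e].
  move=> w0w; have [h1 h2 _ h4] := gw w w0w; have lw := ln_ge1 w w0w.
  by split => //; rewrite (le_trans h2)// ler_piMr ?(ltW e0)// invf_le1//; lra.
have [[acphi _] [phi0 phi_ge0] _ [_ dphi0] _] := phiA.
have reg' (w : R) : w0 <= w -> [/\ derivable phi w 1, {for w, continuous (derive1 phi)},
    `|w * derive1 phi w| <= 2 * phi w & phi w <= cst_c p n].
  by move=> /reg[].
have Dgt0 (w : R) : w0 < w -> 0 < Delta p n phi g w.
  move=> w0w; have [h1 h2 h3 _] := gw w w0w; have [r1 _ _ r4 r5] := reg w (ltW w0w).
  apply: (Delta_gt0 (g1 := g1) (b := b) (e := e)) => //; first by lra.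
    exact: ln_ge1.
  by rewrite r4 phi_ge0//; lra.
have p0 : (0 < p)%N by exact: leq_trans p3.
have n0 : (0 < n)%N by exact: leq_trans n3.
split; first exact: (perturbation_quasi_inadmissible w01 e0 dg cg1 g0 gwe Dgt0).
exact: (perturbation_inadmissible p0 n0 w01 e0 acphi phi0 phi_ge0 dphi0 c0 reg' dg cg1 g0 gwe Dgt0).
Qed.

End QuasiInadmissibility.

Theorem theorem2p1 (R : realType) (p n : nat) (hp : (3 <= p)%N) (hn : (3 <= n)%N)
    (phi : R -> R) (hphi : PhiA p n phi) :
  ((exists wstar b : R, 1 < wstar /\ b < 1 /\
      (forall w : R, wstar <= w ->
         (p%:R - 2) / (n%:R + 2) - b * (beta_star p n / ln w) <= phi w)) ->
     quasi_admissible p n phi)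
  /\
  ((exists wstar b : R, 1 < wstar /\ 1 < b /\
      (forall w : R, wstar <= w ->
         phi w <= (p%:R - 2) / (n%:R + 2) - b * (beta_star p n / ln w))) ->
     quasi_inadmissible p n phi /\ inadmissible n (delta (p := p) phi)).
Proof.
split; first exact: quasi_admissible_of_ge.
exact: quasi_inadmissible_of_le.
Qed.
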